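(* Let $(R,\mathfrak m,K)$ be a local ring of Krull dimension $d$ and let $\mathcal M=\{M_n\}_n$ be a lim Cohen-Macaulay sequence of $R$-modules. (a) If $\underline x=x_1,\dots,x_k$ is part of a system of parameters for $R$ and $\mathcal K_\bullet(\underline x;R)$ is the Koszul complex, then for all $i\ge1$ the cycles in $\mathcal K_i(\underline x;R)$ are contained in the $\mathcal M$-closure, with respect to $\nu$, of the boundaries in $\mathcal K_i(\underline x;R)$. (b) If $x_1,\dots,x_{k+1}$ is part of a system of parameters for $R$, then the ideal $(x_1,\dots,x_k)R:_Rx_{k+1}$ is contained in the $\mathcal M$-closure of $(x_1,\dots,x_k)R$ (in $R$) with respect to $\nu$. If $R$ is a domain or, more generally, if rank is defined for all of the modules in $\mathcal M$, the same results hold for $\mathcal M$-closure with respect to rank.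
   Context: A local ring is Noetherian. $\ell$ is length, $\nu(M)=\dim_K(K\otimes_RM)$, $H_i(\underline x;M)$ is Koszul homology. A sequence $\{M_n\}_n$ of nonzero finitely generated $R$-modules is lim Cohen-Macaulay if for some (equivalently, every) system of parameters $\underline x=x_1,\dots,x_d$ of $R$, $\ell(H_i(\underline x;M_n))=\mathrm o(\nu(M_n))$ as $n\to\infty$ for all $i\ge1$. A finitely generated $R$-module $M$ has rank $r$ if $\ell_{R_{\mathfrak p}}(M_{\mathfrak p})=r\,\ell_{R_{\mathfrak p}}(R_{\mathfrak p})$ for every minimal prime $\mathfrak p$ of $R$ with $\dim(R/\mathfrak p)=\dim R$ (for $R$ a domain this is torsion-free rank). Closure: let $\alpha$ be a function assigning a positive value to each $M_n$ (here $\nu$, or rank when it is defined and positive on all the $M_n$). For finitely generated $R$-modules $A\subseteq B$ with $B/A$ of finite length, the $\mathcal M$-closure $A^{*\mathcal M,\alpha}_B$ of $A$ in $B$ with respect to $\alpha$ is the largest submodule $A'$ with $A\subseteq A'\subseteq B$ such that $\ell\big(\operatorname{Im}(M_n\otimes_R(A'/A)\to M_n\otimes_R(B/A))\big)=\mathrm o(\alpha(M_n))$ as $n\to\infty$. In general $A^{*\mathcal M,\alpha}_B=\bigcap_t(A+\mathfrak m^tB)^{*\mathcal M,\alpha}_B$. *)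

(* Defs.v *)
From HB Require Import structures.
From mathcomp Require Import all_boot all_order all_algebra.
From mathcomp Require Import generic_quotient ring_quotient freeg.
From mathcomp Require Import boolp classical_sets reals constructive_ereal ereal.
From mathcomp Require Import topology ring.

Set Implicit Arguments.
Unset Strict Implicit.
Unset Printing Implicit Defensive.
Import GRing.Theory.
Local Open Scope ring_scope.
Local Open Scope quotient_scope.
Local Open Scope classical_set_scope.

(* Submodules of M are the boolean predicates submodClosed M, ideals of R are *)
(* those of R^o; their membership is decided classically by `[< _ >].         *)

Section Submodules.
Variables (R : pzRingType) (M M' : lmodType R).

Definition fullmod : {pred M} := predT.
Fact fullmod_closed : GRing.submod_closed fullmod.
Proof. by []. Qed.
HB.instance Definition _ :=
  GRing.isSubmodClosed.Build R M fullmod (GRing.submod_closed_semi fullmod_closed).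

Definition span (S : set M) : {pred M} :=
  fun x => `[< forall N : submodClosed M, (forall y, S y -> y \in N) -> x \in N >].
Fact span_closed S : GRing.submod_closed (span S).
Proof.
split=> [|a u v /asboolP uS /asboolP vS]; apply/asboolP => N SN.
  exact: rpred0.
by apply: rpredD; [apply: rpredZ; apply: uS | apply: vS].
Qed.
HB.instance Definition _ S :=
  GRing.isSubmodClosed.Build R M (span S) (GRing.submod_closed_semi (span_closed S)).

Definition lin_ker (f : {linear M -> M'}) : {pred M} := fun x => f x == 0.
Fact lin_ker_closed f : GRing.submod_closed (lin_ker f).
Proof.
split=> [|a u v]; rewrite /lin_ker !unfold_in ?linear0 //.
by rewrite linearP => /eqP-> /eqP->; rewrite scaler0 addr0.
Qed.
HB.instance Definition _ f :=
  GRing.isSubmodClosed.Build R M (lin_ker f) (GRing.submod_closed_semi (lin_ker_closed f)).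

Definition lin_img (f : {linear M -> M'}) : {pred M'} :=
  fun y => `[< exists x, y = f x >].
Fact lin_img_closed f : GRing.submod_closed (lin_img f).
Proof.
split=> [|a u v /asboolP[x ->] /asboolP[y ->]]; apply/asboolP.
  by exists 0; rewrite linear0.
by exists (a *: x + y); rewrite linearP.
Qed.
HB.instance Definition _ f :=
  GRing.isSubmodClosed.Build R M' (lin_img f) (GRing.submod_closed_semi (lin_img_closed f)).

Definition lin_preim (f : {linear M -> M'}) (N : submodClosed M') : {pred M} :=
  fun x => f x \in N.
Fact lin_preim_closed f N : GRing.submod_closed (lin_preim f N).
Proof.
split=> [|a u v uN vN]; rewrite unfold_in /lin_preim.
  by rewrite linear0 rpred0.
by rewrite linearP rpredD // rpredZ.
Qed.
HB.instance Definition _ f N :=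
  GRing.isSubmodClosed.Build R M (lin_preim f N)
    (GRing.submod_closed_semi (lin_preim_closed f N)).

Definition sum_submod (N N' : submodClosed M) : {pred M} :=
  fun x => `[< exists2 u, u \in N & exists2 v, v \in N' & x = u + v >].
Fact sum_submod_closed N N' : GRing.submod_closed (sum_submod N N').
Proof.
split=> [|a x y /asboolP[u uN [v vN' ->]] /asboolP[u' u'N [v' v'N' ->]]].
  apply/asboolP; exists 0; first exact: rpred0.
  by exists 0; [exact: rpred0 | rewrite addr0].
apply/asboolP; exists (a *: u + u'); first by rewrite rpredD // rpredZ.
exists (a *: v + v'); first by rewrite rpredD // rpredZ.
by rewrite scalerDr addrACA.
Qed.
HB.instance Definition _ N N' :=
  GRing.isSubmodClosed.Build R M (sum_submod N N')
    (GRing.submod_closed_semi (sum_submod_closed N N')).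

Definition submodule (N : submodClosed M) : Type := {x : M | x \in N}.
HB.instance Definition _ (N : submodClosed M) := SubChoice.on (submodule N).
HB.instance Definition _ (N : submodClosed M) :=
  [SubChoice_isSubLmodule of submodule N by <:].

End Submodules.
Arguments fullmod {R} M.

Section QuotientModules.
Variables (R : pzRingType) (M : lmodType R).

(* N as an instance of zmodClosed, so that ring_quotient applies *)
Definition zmodpred (N : submodClosed M) : {pred M} := N.
Fact zmodpred_closed N : zmod_closed (zmodpred N).
Proof.
split=> [|u v uN vN]; first exact: (rpred0 N).
by rewrite -[_ \in _]/(u - v \in N) -scaleN1r rpredD // rpredZ.
Qed.
HB.instance Definition _ N := GRing.isZmodClosed.Build M (zmodpred N) (zmodpred_closed N).

Definition quotmod (N : submodClosed M) : Type := Quotient.quot (zmodpred N).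
HB.instance Definition _ N := GRing.Zmodule.on (quotmod N).
HB.instance Definition _ N := Quotient.on (quotmod N).

Variable N : submodClosed M.
Definition quotmod_pi (x : M) : quotmod N := \pi_(quotmod N) x.

Lemma quotmod_eqP x y : quotmod_pi x = quotmod_pi y <-> x - y \in N.
Proof.
rewrite /quotmod_pi; split=> [/eqP|h].
  by rewrite -Quotient.idealrBE.
by apply/eqP; rewrite -Quotient.idealrBE.
Qed.
Lemma quotmod_piK (q : quotmod N) : quotmod_pi (repr q) = q.
Proof. exact: reprK. Qed.
Lemma quotmod_piD x y : quotmod_pi (x + y) = quotmod_pi x + quotmod_pi y.
Proof. by rewrite /quotmod_pi; rewrite raddfD. Qed.

Definition quotmod_scale (a : R) (q : quotmod N) : quotmod N :=
  quotmod_pi (a *: repr q).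
Lemma quotmod_scale_pi a x :
  quotmod_scale a (quotmod_pi x) = quotmod_pi (a *: x).
Proof.
apply/quotmod_eqP; rewrite -scalerBr; apply: rpredZ.
by apply/quotmod_eqP; rewrite quotmod_piK.
Qed.
Fact quotmod_scaleA a b q :
  quotmod_scale a (quotmod_scale b q) = quotmod_scale (a * b) q.
Proof. by rewrite -(quotmod_piK q) !quotmod_scale_pi scalerA. Qed.
Fact quotmod_scale1 : left_id 1 quotmod_scale.
Proof. by move=> q; rewrite -(quotmod_piK q) quotmod_scale_pi scale1r. Qed.
Fact quotmod_scaleDr : right_distributive quotmod_scale +%R.
Proof.
move=> a p q; rewrite -(quotmod_piK p) -(quotmod_piK q).
by rewrite -quotmod_piD !quotmod_scale_pi scalerDr quotmod_piD.
Qed.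
Fact quotmod_scaleDl q : {morph quotmod_scale^~ q : a b / a + b}.
Proof.
move=> a b /=; rewrite -(quotmod_piK q) !quotmod_scale_pi scalerDl.
exact: quotmod_piD.
Qed.
HB.instance Definition _ := GRing.Zmodule_isLmodule.Build R (quotmod N)
  quotmod_scaleA quotmod_scale1 quotmod_scaleDr quotmod_scaleDl.

Fact quotmod_pi_linear : linear quotmod_pi.
Proof.
move=> a x y; rewrite quotmod_piD -quotmod_scale_pi //.
Qed.
HB.instance Definition _ :=
  GRing.isLinear.Build R M (quotmod N) *:%R quotmod_pi quotmod_pi_linear.
End QuotientModules.

Section Subquotients.
Variables (R : pzRingType) (M : lmodType R).

Definition incl (N : submodClosed M) : submodule N -> M := val.
Fact incl_linear N : linear (@incl N).
Proof. by move=> a x y; rewrite /incl linearP. Qed.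
HB.instance Definition _ N :=
  GRing.isLinear.Build R (submodule N) M *:%R (@incl N) (@incl_linear N).

(* A'/A as a module, for A contained in A' *)
Definition subquot (A' A : submodClosed M) := quotmod (lin_preim (@incl A') A).

Definition subquot_incl (A' A : submodClosed M) : subquot A' A -> quotmod A :=
  fun q => quotmod_pi A (incl (repr q)).
Lemma subquot_incl_pi (A' A : submodClosed M) (x : submodule A') :
  subquot_incl (quotmod_pi (lin_preim (@incl A') A) x) = quotmod_pi A (incl x).
Proof.
apply/quotmod_eqP; rewrite -linearB.
by move/quotmod_eqP: (quotmod_piK (quotmod_pi (lin_preim (@incl A') A) x)).
Qed.
Fact subquot_incl_linear (A' A : submodClosed M) : linear (@subquot_incl A' A).
Proof.
move=> a p q; rewrite -(quotmod_piK p) -(quotmod_piK q) -linearP.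
by rewrite !subquot_incl_pi !linearP.
Qed.
HB.instance Definition _ A' A :=
  GRing.isLinear.Build R (subquot A' A) (quotmod A) *:%R (@subquot_incl A' A)
    (@subquot_incl_linear A' A).
End Subquotients.

Section TensorProduct.
Variables (R : comNzRingType).

Section Def.
Variables (M N : lmodType R).
Local Notation free := {freeg (M * N)%type / R}.
Definition free_gen (m : M) (n : N) : free := Freeg [:: (1, (m, n))].

Inductive bilin_rel : set free :=
| BilinDl m m' n : bilin_rel (free_gen (m + m') n - free_gen m n - free_gen m' n)
| BilinDr m n n' : bilin_rel (free_gen m (n + n') - free_gen m n - free_gen m n')
| BilinZl a m n : bilin_rel (free_gen (a *: m) n - a *: free_gen m n)
| BilinZr a m n : bilin_rel (free_gen m (a *: n) - a *: free_gen m n).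

Definition tensor := quotmod (span bilin_rel).
HB.instance Definition _ := GRing.Lmodule.on tensor.
Definition tens (m : M) (n : N) : tensor := quotmod_pi _ (free_gen m n).

Lemma tensDl m m' n : tens (m + m') n = tens m n + tens m' n.
Proof.
rewrite -linearD; apply/quotmod_eqP/asboolP => P; apply.
by rewrite opprD addrA; exact: BilinDl.
Qed.
Lemma tensDr m n n' : tens m (n + n') = tens m n + tens m n'.
Proof.
rewrite -linearD; apply/quotmod_eqP/asboolP => P; apply.
by rewrite opprD addrA; exact: BilinDr.
Qed.
Lemma tensZl a m n : tens (a *: m) n = a *: tens m n.
Proof. by rewrite -linearZ; apply/quotmod_eqP/asboolP => P; apply; exact: BilinZl. Qed.
Lemma tensZr a m n : tens m (a *: n) = a *: tens m n.
Proof. by rewrite -linearZ; apply/quotmod_eqP/asboolP => P; apply; exact: BilinZr. Qed.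

Lemma free_gen_decomp (z : free) :
  exists s : seq (R * (M * N)), z = \sum_(u <- s) u.1 *: free_gen u.2.1 u.2.2.
Proof.
exists [seq (coeff u z, u) | u <- dom z].
rewrite -[LHS]freeg_sumE [in RHS]big_map; apply: eq_bigr => -[m n] _ /=.
apply/eqP/freeg_eqP => u; rewrite coeffZ !coeffU mul1r.
by case: (_ == _).
Qed.

Lemma tensorP (t : tensor) :
  exists s : seq (R * (M * N)), t = \sum_(u <- s) u.1 *: tens u.2.1 u.2.2.
Proof.
have [s Es] := free_gen_decomp (repr t); exists s.
rewrite -[LHS]quotmod_piK Es linear_sum.
by apply: eq_bigr => u _; rewrite linearZ.
Qed.
End Def.

Lemma tensor_ext (M N P : lmodType R) (f g : tensor M N -> P) :
  linear f -> linear g -> (forall m n, f (tens m n) = g (tens m n)) -> f =1 g.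
Proof.
move=> lf lg fg t.
pose F := HB.pack_for {linear tensor M N -> P} f (GRing.isLinear.Build _ _ _ _ f lf).
pose G := HB.pack_for {linear tensor M N -> P} g (GRing.isLinear.Build _ _ _ _ g lg).
have [s ->] := tensorP t.
rewrite -[f _]/(F _) -[g _]/(G _) !linear_sum.
by apply: eq_bigr => u _; rewrite !linearZ /= fg.
Qed.

Section Functoriality.
Variables (M M' N N' : lmodType R).
Variables (f : {linear M -> M'}) (g : {linear N -> N'}).

Definition free_lift (z : {freeg (M * N)%type / R}) : tensor M' N' :=
  fglift (fun u => tens (f u.1) (g u.2)) z.
Fact free_lift_gen m n : free_lift (free_gen m n) = tens (f m) (g n).
Proof. by rewrite /free_lift liftU scale1r. Qed.
Fact free_lift_additive : zmod_morphism free_lift.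
Proof. exact: lift_is_additive. Qed.
HB.instance Definition _ := GRing.isZmodMorphism.Build
  {freeg (M * N)%type / R} (tensor M' N') free_lift free_lift_additive.
Fact free_lift_linear : linear free_lift.
Proof.
move=> a x y; rewrite raddfD /=; congr (_ + _).
elim/freeg_ind_dom0: x => [|k u z _ _ IH]; first by rewrite scaler0 raddf0 scaler0.
have -> := scalerDr a (Freeg [:: (k, u)]) z.
rewrite !raddfD /= IH; congr (_ + _).
suff -> : a *: Freeg [:: (k, u)] = Freeg [:: (a * k, u)].
  by rewrite /free_lift !liftU scalerA.
by apply/eqP/freeg_eqP => v; rewrite coeffZ !coeffU mulrA.
Qed.
HB.instance Definition _ := GRing.isScalable.Build R {freeg (M * N)%type / R}
  (tensor M' N') *:%R free_lift (scalable_linear free_lift_linear).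

Definition tensor_map (t : tensor M N) : tensor M' N' := free_lift (repr t).
Fact tensor_map_pi z : tensor_map (quotmod_pi _ z) = free_lift z.
Proof.
apply/eqP; rewrite -subr_eq0 -linearB.
have /quotmod_eqP/asboolP h := quotmod_piK (quotmod_pi (span (@bilin_rel M N)) z).
apply: (h (lin_ker free_lift)) => _ [m m' n|m n n'|a m n|a m n];
  rewrite unfold_in /lin_ker !linearB /= ?linearZ /= !free_lift_gen.
- by rewrite linearD tensDl addrAC addrK subrr.
- by rewrite linearD tensDr addrAC addrK subrr.
- by rewrite linearZ tensZl scalerN subrr.
- by rewrite linearZ tensZr scalerN subrr.
Qed.
Lemma tensor_mapE m n : tensor_map (tens m n) = tens (f m) (g n).
Proof. by rewrite tensor_map_pi free_lift_gen. Qed.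
Fact tensor_map_linear : linear tensor_map.
Proof.
move=> a p q; rewrite -(quotmod_piK p) -(quotmod_piK q) -linearP.
by rewrite !tensor_map_pi linearP.
Qed.
HB.instance Definition _ := GRing.isLinear.Build R (tensor M N)
  (tensor M' N') *:%R tensor_map tensor_map_linear.
End Functoriality.
End TensorProduct.

Section ResidueRing.
Variables (R : comNzRingType) (I : idealr R).

Definition quotring_pi (a : R) : {ideal_quot I} := \pi_{ideal_quot I} a.
Definition quotring_scale (a : R) (q : {ideal_quot I}) : {ideal_quot I} :=
  quotring_pi a * q.
Lemma quotring_piD a b : quotring_pi (a + b) = quotring_pi a + quotring_pi b.
Proof. exact: rmorphD. Qed.
Lemma quotring_piM a b : quotring_pi (a * b) = quotring_pi a * quotring_pi b.
Proof. exact: rmorphM. Qed.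
Lemma quotring_pi1 : quotring_pi 1 = 1.
Proof. exact: rmorph1. Qed.
Fact quotring_scaleA a b q :
  quotring_scale a (quotring_scale b q) = quotring_scale (a * b) q.
Proof. by rewrite /quotring_scale quotring_piM mulrA. Qed.
Fact quotring_scale1 : left_id 1 quotring_scale.
Proof. by move=> q; rewrite /quotring_scale quotring_pi1 mul1r. Qed.
Fact quotring_scaleDr : right_distributive quotring_scale +%R.
Proof. by move=> a p q; rewrite /quotring_scale mulrDr. Qed.
Fact quotring_scaleDl q : {morph quotring_scale^~ q : a b / a + b}.
Proof. by move=> a b; rewrite /quotring_scale quotring_piD mulrDl. Qed.
HB.instance Definition _ := GRing.Zmodule_isLmodule.Build R {ideal_quot I}
  quotring_scaleA quotring_scale1 quotring_scaleDr quotring_scaleDl.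

Definition quotring_mul (k q : {ideal_quot I}) : {ideal_quot I} := k * q.
Fact quotring_mul_linear k : linear (quotring_mul k).
Proof.
move=> a p q; rewrite /quotring_mul mulrDr; congr (_ + _).
by rewrite /GRing.scale /= /quotring_scale mulrCA.
Qed.
HB.instance Definition _ k := GRing.isLinear.Build R {ideal_quot I}
  {ideal_quot I} *:%R (quotring_mul k) (quotring_mul_linear k).

(* the base change (R/I) (x) M as an R/I-module *)
Variable M : lmodType R.
Definition base_change : Type := tensor ({ideal_quot I} : lmodType R) M.
HB.instance Definition _ := GRing.Zmodule.on base_change.
Definition base_change_scale (k : {ideal_quot I}) (t : base_change) : base_change :=
  tensor_map (quotring_mul k) idfun t.
Let T := tensor ({ideal_quot I} : lmodType R) M.
Fact base_change_scaleDr : right_distributive base_change_scale +%R.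
Proof. by move=> k t u; apply: (linearD (tensor_map (quotring_mul k) idfun)). Qed.
Fact base_change_scaleA k l t :
  base_change_scale k (base_change_scale l t) = base_change_scale (k * l) t.
Proof.
apply: (@tensor_ext R _ _ T (tensor_map (quotring_mul k) idfun \o tensor_map (quotring_mul l) idfun)
  (tensor_map (quotring_mul (k * l)) idfun)).
- exact: linearP.
- exact: linearP.
- by move=> q m; rewrite /= !tensor_mapE /= /quotring_mul mulrA.
Qed.
Fact base_change_scale1 : left_id 1 base_change_scale.
Proof.
move=> t; apply: (@tensor_ext R _ _ T (tensor_map (quotring_mul 1) idfun) idfun).
- exact: linearP.
- exact: linearP.
- by move=> q m; rewrite /= !tensor_mapE /= /quotring_mul mul1r.
Qed.
Fact base_change_scaleDl t : {morph base_change_scale^~ t : k l / k + l}.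
Proof.
move=> k l; apply: (@tensor_ext R _ _ T (tensor_map (quotring_mul (k + l)) idfun)
  (tensor_map (quotring_mul k) idfun \+ tensor_map (quotring_mul l) idfun)).
- exact: linearP.
- exact: linearP.
- by move=> q m; rewrite /= !tensor_mapE /= /quotring_mul mulrDl tensDl.
Qed.
HB.instance Definition _ := GRing.Zmodule_isLmodule.Build {ideal_quot I}
  base_change base_change_scaleA base_change_scale1 base_change_scaleDr
  base_change_scaleDl.
End ResidueRing.

Section Localization.
Variables (R : comNzRingType) (p : prime_idealr R).

Definition denom : Type := {s : R | s \notin p}.
HB.instance Definition _ := SubChoice.on denom.
Fact denom1_subproof : 1 \notin p. Proof. by rewrite idealr1. Qed.
Definition denom1 : denom := exist _ 1 denom1_subproof.
Fact denomM_subproof (s t : denom) : val s * val t \notin p.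
Proof. by rewrite prime_idealrM negb_or (valP s) (valP t). Qed.
Definition denomM (s t : denom) : denom := exist _ (val s * val t) (denomM_subproof s t).
Lemma val_denom1 : val denom1 = 1. Proof. by []. Qed.
Lemma val_denomM s t : val (denomM s t) = val s * val t. Proof. by []. Qed.
Let valE := (val_denom1, val_denomM).

Section LocalizedModule.
Variable M : lmodType R.

Definition loc_rel (x y : M * denom) : bool :=
  `[< exists u : denom, (val u * val y.2) *: x.1 = (val u * val x.2) *: y.1 >].
Fact loc_rel_equiv : equiv_class_of loc_rel.
Proof.
split=> [x|x y|y x z].
- by apply/asboolP; exists denom1.
- by apply/asboolP/asboolP => -[u Eu]; exists u.
move=> /asboolP[u Eu] /asboolP[v Ev].
apply/asboolP; exists (denomM (denomM u v) y.2); rewrite !valE.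
transitivity ((val v * val z.2) *: ((val u * val y.2) *: x.1)).
  by rewrite scalerA; congr (_ *: _); ring.
transitivity ((val u * val x.2) *: ((val v * val z.2) *: y.1)).
  by rewrite Eu !scalerA; congr (_ *: _); ring.
by rewrite Ev scalerA; congr (_ *: _); ring.
Qed.
Canonical loc_equiv := EquivRelPack loc_rel_equiv.
Canonical loc_encModRel := defaultEncModRel loc_rel.

Definition loc : Type := {eq_quot loc_rel}.
HB.instance Definition _ := Choice.on loc.
HB.instance Definition _ := Quotient.on loc.
HB.instance Definition _ : EqQuotient _ loc_rel loc := EqQuotient.on loc.

Definition frac (m : M) (s : denom) : loc := \pi_loc (m, s).
Lemma frac_eqP m s n t : frac m s = frac n t <->
  exists u : denom, (val u * val t) *: m = (val u * val s) *: n.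
Proof. by split=> [/eqmodP/asboolP //|h]; apply/eqmodP/asboolP. Qed.
Lemma frac_repr (x : loc) : x = frac (repr x).1 (repr x).2.
Proof. by rewrite /frac -surjective_pairing reprK. Qed.
Lemma fracP (x : loc) : exists m s, x = frac m s.
Proof. by exists (repr x).1, (repr x).2; apply: frac_repr. Qed.

Definition loc_zero : loc := frac 0 denom1.
Definition loc_opp (x : loc) : loc := frac (- (repr x).1) (repr x).2.
Definition loc_add (x y : loc) : loc :=
  frac (val (repr y).2 *: (repr x).1 + val (repr x).2 *: (repr y).1)
       (denomM (repr x).2 (repr y).2).

Lemma loc_opp_frac m s : loc_opp (frac m s) = frac (- m) s.
Proof.
have /frac_eqP[u Eu] := frac_repr (frac m s).
by apply/frac_eqP; exists u; rewrite !scalerN Eu.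
Qed.
Lemma loc_add_frac m s n t :
  loc_add (frac m s) (frac n t) = frac (val t *: m + val s *: n) (denomM s t).
Proof.
have /frac_eqP[u Eu] := frac_repr (frac m s).
have /frac_eqP[v Ev] := frac_repr (frac n t).
rewrite /loc_add; move: (repr (frac m s)) (repr (frac n t)) Eu Ev => x y Eu Ev.
apply/frac_eqP; exists (denomM u v); rewrite !valE !scalerDr !scalerA; congr (_ + _).
  transitivity ((val v * val t * val y.2) *: ((val u * val s) *: x.1)).
    by rewrite scalerA; congr (_ *: _); ring.
  by rewrite -Eu scalerA; congr (_ *: _); ring.
transitivity ((val u * val s * val x.2) *: ((val v * val t) *: y.1)).
  by rewrite scalerA; congr (_ *: _); ring.
by rewrite -Ev scalerA; congr (_ *: _); ring.
Qed.

Fact loc_addA : associative loc_add.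
Proof.
move=> x y z.
have [x1 [x2 ->]] := fracP x.
have [y1 [y2 ->]] := fracP y.
have [z1 [z2 ->]] := fracP z.
rewrite !loc_add_frac.
apply/frac_eqP; exists denom1; rewrite !valE !scalerDr !scalerA -addrA.
by congr (_ + (_ + _)); congr (_ *: _); ring.
Qed.
Fact loc_addC : commutative loc_add.
Proof.
move=> x y.
have [x1 [x2 ->]] := fracP x.
have [y1 [y2 ->]] := fracP y.
rewrite !loc_add_frac.
apply/frac_eqP; exists denom1; rewrite !valE [in RHS]addrC !scalerDr !scalerA.
by congr (_ + _); congr (_ *: _); ring.
Qed.
Fact loc_add0 : left_id loc_zero loc_add.
Proof.
move=> x.
have [x1 [x2 ->]] := fracP x.
rewrite loc_add_frac scaler0 add0r ?valE scale1r.
by apply/frac_eqP; exists denom1; rewrite !valE !mul1r.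
Qed.
Fact loc_addN : left_inverse loc_zero loc_opp loc_add.
Proof.
move=> x.
have [x1 [x2 ->]] := fracP x.
rewrite loc_opp_frac loc_add_frac scalerN addNr.
by apply/frac_eqP; exists denom1; rewrite !scaler0.
Qed.
HB.instance Definition _ := GRing.isZmodule.Build loc loc_addA loc_addC loc_add0 loc_addN.
Lemma frac_add m s n t :
  frac m s + frac n t = frac (val t *: m + val s *: n) (denomM s t).
Proof. exact: loc_add_frac. Qed.
End LocalizedModule.

Section Action.
Variable M : lmodType R.
Definition loc_scale (a : loc R^o) (x : loc M) : loc M :=
  frac (((repr a).1 : R) *: (repr x).1) (denomM (repr a).2 (repr x).2).
Lemma loc_scale_frac (a : R) s (m : M) t :
  loc_scale (frac (a : R^o) s) (frac m t) = frac (a *: m) (denomM s t).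
Proof.
have /frac_eqP[u Eu] := frac_repr (frac (a : R^o) s).
have /frac_eqP[v Ev] := frac_repr (frac m t).
rewrite /loc_scale; move: (repr (frac (a : R^o) s)) (repr (frac m t)) Eu Ev => b x Eu Ev.
have {}Eu : val u * val b.2 * a = val u * val s * (b.1 : R) := Eu.
apply/frac_eqP; exists (denomM u v); rewrite !valE !scalerA.
transitivity ((val u * val s * (b.1 : R)) *: ((val v * val t) *: x.1)).
  by rewrite scalerA; congr (_ *: _); ring.
rewrite -Ev -Eu scalerA; congr (_ *: _); ring.
Qed.
End Action.

Let regE (a b : R) : a *: (b : R^o) = a * b :> R. Proof. by []. Qed.
Lemma loc_scaleA (M : lmodType R) (a b : loc R^o) (x : loc M) :
  loc_scale a (loc_scale b x) = loc_scale (loc_scale a b) x.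
Proof.
have [a1 [a2 ->]] := fracP a.
have [b1 [b2 ->]] := fracP b.
have [x1 [x2 ->]] := fracP x.
rewrite (loc_scale_frac b1 b2 x1 x2) (loc_scale_frac a1 a2 b1 b2) !loc_scale_frac.
apply/frac_eqP; exists denom1; rewrite !valE !scalerA.
by congr (_ *: _); rewrite ?regE; ring.
Qed.
Lemma loc_scaleC (a b : loc R^o) : loc_scale a b = loc_scale b a.
Proof.
have [a1 [a2 ->]] := fracP a.
have [b1 [b2 ->]] := fracP b.
rewrite !loc_scale_frac.
by apply/frac_eqP; exists denom1; rewrite !valE !regE; ring.
Qed.
Lemma loc_scale1 (M : lmodType R) (x : loc M) :
  loc_scale (frac (1 : R^o) denom1) x = x.
Proof.
have [x1 [x2 ->]] := fracP x.
rewrite loc_scale_frac scale1r.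
by apply/frac_eqP; exists denom1; rewrite !valE !mul1r.
Qed.
Lemma loc_scaleDl (M : lmodType R) (a b : loc R^o) (x : loc M) :
  loc_scale (a + b) x = loc_scale a x + loc_scale b x.
Proof.
have [a1 [a2 ->]] := fracP a.
have [b1 [b2 ->]] := fracP b.
have [x1 [x2 ->]] := fracP x.
rewrite frac_add !loc_scale_frac frac_add.
apply/frac_eqP; exists denom1; rewrite !valE !scalerA -scalerDl !scalerA.
by congr (_ *: _); rewrite ?regE; ring.
Qed.
Lemma loc_scaleDr (M : lmodType R) (a : loc R^o) (x y : loc M) :
  loc_scale a (x + y) = loc_scale a x + loc_scale a y.
Proof.
have [a1 [a2 ->]] := fracP a.
have [x1 [x2 ->]] := fracP x.
have [y1 [y2 ->]] := fracP y.
rewrite frac_add !loc_scale_frac frac_add.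
apply/frac_eqP; exists denom1; rewrite !valE !scalerDr !scalerA.
by congr (_ + _); congr (_ *: _); ring.
Qed.

Definition locring : Type := loc R^o.
HB.instance Definition _ := GRing.Zmodule.on locring.
Definition loc_one : locring := frac (1 : R^o) denom1.
Definition loc_mul (a b : locring) : locring := loc_scale a b.
Fact loc_mulA : associative loc_mul.
Proof. by move=> a b c; apply: loc_scaleA. Qed.
Fact loc_mulC : commutative loc_mul.
Proof. exact: loc_scaleC. Qed.
Fact loc_mul1 : left_id loc_one loc_mul.
Proof. by move=> a; apply: loc_scale1. Qed.
Fact loc_mulDl : left_distributive loc_mul +%R.
Proof. by move=> a b c; apply: loc_scaleDl. Qed.
Fact loc_nontriv : loc_one != 0.
Proof.
apply/eqP => /frac_eqP[u /=]; rewrite scaler0 mulr1 => u0.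
have {}u0 : val u = 0 by rewrite -[LHS]mulr1; exact: u0.
by move: (valP u); rewrite u0 idealr0.
Qed.
HB.instance Definition _ := GRing.Zmodule_isComNzRing.Build locring
  loc_mulA loc_mulC loc_mul1 loc_mulDl loc_nontriv.

Definition locmod (M : lmodType R) : Type := loc M.
HB.instance Definition _ M := GRing.Zmodule.on (locmod M).
Section LocModStructure.
Variable M : lmodType R.
Definition locmod_scale (a : locring) (x : locmod M) : locmod M := loc_scale a x.
Fact locmod_scaleA a b x :
  locmod_scale a (locmod_scale b x) = locmod_scale (a * b) x.
Proof. exact: loc_scaleA. Qed.
Fact locmod_scale1 : left_id 1 locmod_scale.
Proof. exact: loc_scale1. Qed.
Fact locmod_scaleDr : right_distributive locmod_scale +%R.
Proof. exact: loc_scaleDr. Qed.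
Fact locmod_scaleDl x : {morph locmod_scale^~ x : a b / a + b}.
Proof. by move=> a b; apply: loc_scaleDl. Qed.
HB.instance Definition _ := GRing.Zmodule_isLmodule.Build locring (locmod M)
  locmod_scaleA locmod_scale1 locmod_scaleDr locmod_scaleDl.
End LocModStructure.
End Localization.

Definition strict_sub (T : Type) (A B : {pred T}) :=
  {subset A <= B} /\ ~ {subset B <= A}.

Section LengthAndDimension.
Variables (F : realType) (R : comNzRingType).

Definition length (N : lmodType R) : \bar F :=
  ereal_sup [set k%:R%:E | k in [set k | exists c : nat -> submodClosed N,
    forall i, (i < k)%N -> strict_sub (c i) (c i.+1)]].

Definition krull_dim : \bar F :=
  ereal_sup [set k%:R%:E | k in [set k | exists c : nat -> prime_idealr R,
    forall i, (i < k)%N -> strict_sub (c i) (c i.+1)]].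

Definition is_basis_size (N : lmodType R) (n : nat) :=
  exists v : 'I_n -> N,
    (forall w, exists c : 'I_n -> R, w = \sum_(i < n) c i *: v i) /\
    (forall c : 'I_n -> R, \sum_(i < n) c i *: v i = 0 -> forall i, c i = 0).

(* dimension of a vector space, when R is a field and N is finitely generated *)
Definition vdim (N : lmodType R) : nat := xget 0%N [set n | is_basis_size N n].
End LengthAndDimension.

Section LocalRings.
Variable R : comNzRingType.

Definition fin_gen (M : lmodType R) :=
  exists s : seq M, forall v : M, v \in span [set` s].

Definition ideal_gen (x : seq R) : submodClosed R^o := span (M := R^o) [set` x].

Definition noetherian :=
  forall I : submodClosed R^o, exists x : seq R, I =i ideal_gen x.

Definition local_ring (m : idealr R) :=
  noetherian /\ forall I : idealr R, {subset I <= m}.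

Definition ideal_mul (M : lmodType R) (I : {pred R}) (N : submodClosed M) :
    submodClosed M :=
  span [set z | exists2 a, a \in I & exists2 v, v \in N & z = a *: v].
Fixpoint ideal_pow (I : {pred R}) (t : nat) : submodClosed R^o :=
  if t is t'.+1 then ideal_mul I (ideal_pow I t') else fullmod R^o.

Definition colon (I : submodClosed R^o) (y : R) : set R^o :=
  [set a : R^o | (a : R) * y \in I].

Variables (F : realType) (m : idealr R).

Definition sop (x : seq R) :=
  [/\ krull_dim F R = (size x)%:R%:E, {subset x <= m} &
      forall a, a \in m -> exists n, a ^+ n \in ideal_gen x].

Definition part_of_sop (x : seq R) := exists y, sop (x ++ y).

Definition nu (M : lmodType R) : nat := vdim (base_change m M).

Definition has_rank (M : lmodType R) (r : F) :=
  forall p : prime_idealr R,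
    (forall q : prime_idealr R, {subset q <= p} -> {subset p <= q}) ->
    krull_dim F {ideal_quot p} = krull_dim F R ->
    length F (locmod p M) = (r%:E * length F (locring p)^o)%E.

Definition rank (M : lmodType R) : F := xget 0 [set r | has_rank M r].
End LocalRings.

Section Koszul.
Variables (R : comNzRingType) (M : lmodType R).

(* K_i(x; M) is the direct sum of copies M e_S of M, #|S| = i, with           *)
(* d(v e_S) = \sum_(j in S) (-1)^#{t in S, t < j} x_j v e_(S \ j); the source *)
(* and target in degree 0 coincide, and the differential is 0 there.          *)
Definition koszul_index (k i : nat) : finType := {S : {set 'I_k} | #|S| == i}.
Definition koszul (k i : nat) : lmodType R := {ffun koszul_index k i -> M}.

Variable x : seq R.
Local Notation k := (size x).

Definition koszul_d (i : nat) (f : koszul k i) : koszul k i.-1 :=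
  [ffun T : koszul_index k i.-1 => \sum_(S : koszul_index k i)
    \sum_(j in val S | val S :\ j == val T)
      ((-1) ^+ #|[set t in val S | (t < j)%N]| * x`_j) *: f S].
Fact koszul_d_linear i : linear (@koszul_d i).
Proof.
move=> a f g; apply/ffunP => T; rewrite !ffunE scaler_sumr -big_split /=.
apply: eq_bigr => S _; rewrite scaler_sumr -big_split /=.
apply: eq_bigr => j _; rewrite !ffunE scalerDr !scalerA.
by congr (_ *: _ + _); rewrite mulrC.
Qed.
HB.instance Definition _ i := GRing.isLinear.Build R (koszul k i) (koszul k i.-1)
  *:%R (@koszul_d i) (@koszul_d_linear i).

Definition cycles (i : nat) : submodClosed (koszul k i) := lin_ker (@koszul_d i).
Definition boundaries (i : nat) : submodClosed (koszul k i) :=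
  lin_img (@koszul_d i.+1).
Definition koszul_homology (i : nat) : lmodType R :=
  subquot (cycles i) (boundaries i).
End Koszul.

Section LimCM.
Variables (F : realType) (R : comNzRingType) (m : idealr R) (M : nat -> lmodType R).

Definition little_o (l : nat -> \bar F) (a : nat -> F) :=
  forall eps : F, 0 < eps -> \forall n \near \oo, (l n <= (eps * a n)%:E)%E.

Definition lim_CM :=
  (forall n, fin_gen (M n) /\ exists v : M n, v != 0) /\
  exists2 x : seq R, sop F m x & forall i, (1 <= i)%N ->
    little_o (fun n => length F (koszul_homology (M n) x i))
             (fun n => (nu m (M n))%:R).

Variables (alpha : nat -> F) (B : lmodType R).

(* the image of M_n (x) (A'/A) -> M_n (x) (B/A) *)
Definition tensor_image (n : nat) (A A' : submodClosed B) : lmodType R :=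
  submodule (lin_img (tensor_map (idfun : M n -> M n) (@subquot_incl R B A' A))).

Definition closure_adm (A A' : submodClosed B) :=
  {subset A <= A'} /\ little_o (fun n => length F (tensor_image n A A')) alpha.

(* the largest admissible A', used when B/A has finite length *)
Definition mclosure_fl (A : submodClosed B) : set B :=
  [set b | exists A' : submodClosed B, [/\ closure_adm A A',
     forall A'' : submodClosed B, closure_adm A A'' -> {subset A'' <= A'} &
     b \in A']].

Definition mclosure (A : submodClosed B) : set B :=
  [set b | forall t, mclosure_fl (sum_submod A (ideal_mul (ideal_pow m t) (fullmod B))) b].
End LimCM.

(* Main.v *)
(* Lengths are suprema of lengths of strict chains; they are additive, and every
   estimate below is an inequality between lengths of subquotients.

   The Koszul complex K(x; M) is an iterated mapping cone, so the long exact sequence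
   of a cone computes l(H_i(a, x; M)) from multiplication by a on H_i(x; M) and
   H_(i-1)(x; M). So if l(H_i(x; M_n)) = o(nu(M_n)) for i >= p, then the same holds for
   a, x and i > p; the converse is true if some power of a is in (x), because the
   elements of (x) are null-homotopic on K(x; M). Hence for two systems of parameters x
   and y of length d, smallness of H_i(x; M_n) for all i >= 1 amounts to smallness of
   H_i(x, y; M_n) for all i > d, a condition symmetric in x and y.

   If z is a cycle of K_i(x; R) and y completes x to a system of parameters, then z is a
   cycle of K_i(x, y^t; R), and v |-> v z maps M_n to the cycles of K_i(x, y^t; M_n);
   whatever becomes a boundary there dies in M_n (x) K_i(x; R)/(B_i + m^t K_i). So the
   module measuring whether z is in the closure has length at most
   l(H_i(x, y^t; M_n)). The colon statement is the same argument for the last coordinate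
   of a cycle of K_1.

   For closure with respect to rank one needs nu(M_n) = O(rank M_n). With
   x^N = (x_1^N, ..., x_d^N) one has N^d l(M/xM) <= l(M/x^N M) + d N^d l(H_1(x; M)).
   In a prime filtration of M, the factors R/p with dim R/p < d contribute
   O(N^(d-1)) to l(M/x^N M), and those with dim R/p = d number at most
   the sum of the l(M_p) = rank(M) l(R_p) and contribute at most N^d l(R/x) each. Let N
   tend to infinity. *)

Require Import Defs.
From HB Require Import structures.
From mathcomp Require Import all_boot all_order all_algebra.
From mathcomp Require Import ring_quotient boolp classical_sets reals constructive_ereal.
From mathcomp Require Import ereal topology ring lra zify.
Set Implicit Arguments.
Unset Strict Implicit.
Unset Printing Implicit Defensive.
Import GRing.Theory Num.Theory Order.TTheory.
Local Open Scope ring_scope.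
Local Open Scope classical_set_scope.

(** * Submodules as sets, and finitely generated submodules *)

Section SubmoduleSets.
Variables (R : comNzRingType) (M : lmodType R).

(** Submodules are handled as plain sets with a closure proof, so that images, sums and
    intersections compose freely; [mkSub] packs them into structures when a chain has to be
    exhibited. *)
Definition is_submod (P : set M) := P 0 /\ forall a u v, P u -> P v -> P (a *: u + v).

Lemma submod0 P : is_submod P -> P 0. Proof. by case. Qed.
Lemma submodZ P a u : is_submod P -> P u -> P (a *: u).
Proof. by case=> P0 PL Pu; rewrite -[a *: u]addr0; apply: PL. Qed.
Lemma submodD P u v : is_submod P -> P u -> P v -> P (u + v).
Proof. by case=> P0 PL Pu Pv; rewrite -[u]scale1r; apply: PL. Qed.
Lemma submodN P u : is_submod P -> P u -> P (- u).
Proof. by move=> hP Pu; rewrite -scaleN1r; apply: submodZ. Qed.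
Lemma submodB P u v : is_submod P -> P u -> P v -> P (u - v).
Proof. by move=> hP Pu Pv; apply: submodD => //; apply: submodN. Qed.
Lemma submod_sum P (I : Type) (r : seq I) (C : pred I) (f : I -> M) :
  is_submod P -> (forall i, C i -> P (f i)) -> P (\sum_(i <- r | C i) f i).
Proof.
by move=> hP Pf; apply: big_ind => //; [exact: submod0 | move=> ? ?; exact: submodD].
Qed.

Definition smod_pred (P : set M) : {pred M} := fun x => `[< P x >].
Fact smod_pred_closed P : is_submod P -> GRing.submod_closed (smod_pred P).
Proof.
case=> P0 PD; split=> [|a u v /asboolP Pu /asboolP Pv]; apply/asboolP => //.
exact: PD.
Qed.
Definition mkSub (P : set M) (h : is_submod P) : submodClosed M :=
  HB.pack_for (submodClosed M) (smod_pred P) (GRing.isSubmodClosed.Build R M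
    (smod_pred P) (GRing.submod_closed_semi (smod_pred_closed h))).
Lemma mkSubE P h u : u \in @mkSub P h <-> P u.
Proof. by split=> /asboolP. Qed.

Lemma is_submod_pred (N : submodClosed M) : is_submod [set` N].
Proof.
split=> [|a u v uN vN] /=; first exact: rpred0.
by rewrite rpredD // rpredZ.
Qed.

Lemma submodClosedB (N : submodClosed M) u v : u \in N -> v \in N -> u - v \in N.
Proof. by move=> uN vN; rewrite -scaleN1r rpredD // rpredZ. Qed.

Lemma is_submod0 : is_submod [set 0].
Proof. by split=> // a u v -> ->; rewrite scaler0 addr0. Qed.
Lemma is_submodT : is_submod [set: M]. Proof. by []. Qed.
Lemma is_submodI P Q : is_submod P -> is_submod Q -> is_submod (P `&` Q).
Proof.
move=> [P0 PL] [Q0 QL]; split=> // a u v [Pu Qu] [Pv Qv].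
by split; [exact: PL | exact: QL].
Qed.

Definition addS (P Q : set M) : set M := [set u | exists a b, [/\ P a, Q b & u = a + b]].
Lemma is_submod_addS P Q : is_submod P -> is_submod Q -> is_submod (addS P Q).
Proof.
move=> hP hQ; split=> [|a _ _ [u [v [Pu Qv ->]]] [u' [v' [Pu' Qv' ->]]]].
  by exists 0, 0; split; rewrite ?addr0 //; exact: submod0.
exists (a *: u + u'), (a *: v + v'); split; first by case: hP => _; apply.
  by case: hQ => _; apply.
by rewrite scalerDr addrACA.
Qed.
Lemma addSl P Q u : is_submod Q -> P u -> addS P Q u.
Proof. by move=> hQ Pu; exists u, 0; split; rewrite ?addr0 //; exact: submod0. Qed.
Lemma addSr P Q u : is_submod P -> Q u -> addS P Q u.
Proof. by move=> hP Qu; exists 0, u; split; rewrite ?add0r //; exact: submod0. Qed.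
Lemma addS_min P Q S : is_submod S -> P `<=` S -> Q `<=` S -> addS P Q `<=` S.
Proof. by move=> hS PS QS _ [u [v [/PS Su /QS Sv ->]]]; exact: submodD. Qed.
Lemma addS_mono P Q P' Q' : P `<=` P' -> Q `<=` Q' -> addS P Q `<=` addS P' Q'.
Proof. by move=> PP QQ _ [u [v [/PP Su /QQ Sv ->]]]; exists u, v. Qed.

Definition line (v : M) : set M := [set u | exists a, u = a *: v].
Lemma is_submod_line v : is_submod (line v).
Proof.
split=> [|a _ _ [b ->] [c ->]]; first by exists 0; rewrite scale0r.
by exists (a * b + c); rewrite scalerDl scalerA.
Qed.
Lemma line_gen v : line v v. Proof. by exists 1; rewrite scale1r. Qed.
Lemma line_min P v : is_submod P -> P v -> line v `<=` P.
Proof. by move=> hP Pv _ [a ->]; exact: submodZ. Qed.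

Fixpoint gen (s : seq M) : set M :=
  if s is v :: s' then addS (line v) (gen s') else [set 0].
Lemma is_submod_gen s : is_submod (gen s).
Proof.
elim: s => [|v s IH]; first exact: is_submod0.
by apply: is_submod_addS => //; exact: is_submod_line.
Qed.
Lemma gen_mem s v : v \in s -> gen s v.
Proof.
elim: s => // w s IH; rewrite inE => /predU1P[->|/IH vs].
  by apply: addSl; [exact: is_submod_gen | exact: line_gen].
by apply: addSr => //; exact: is_submod_line.
Qed.
Lemma gen_min s P : is_submod P -> (forall v, v \in s -> P v) -> gen s `<=` P.
Proof.
move=> hP; elim: s => [_ _ ->|v s IH sP]; first exact: submod0.
apply: addS_min => //; last by apply: IH => w ws; apply: sP; rewrite inE ws orbT.
by apply: line_min => //; apply: sP; rewrite mem_head.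
Qed.

Lemma span_gen (s : seq M) (u : M) : u \in Defs.span [set` s] <-> gen s u.
Proof.
split=> [/asboolP h|us].
  by apply/(mkSubE (is_submod_gen s)); apply: h => y ys; apply/mkSubE; exact: gen_mem.
by apply/asboolP => N sN; exact: (gen_min (is_submod_pred N) sN us).
Qed.

End SubmoduleSets.

Lemma is_submod_preim (R : comNzRingType) (M M' : lmodType R) (f : {linear M -> M'}) P :
  is_submod P -> is_submod (f @^-1` P).
Proof.
move=> hP; split=> [|a u v /= Pu Pv] /=; first by rewrite linear0; exact: submod0.
by rewrite linearP; case: hP => _; apply.
Qed.
Lemma is_submod_img (R : comNzRingType) (M M' : lmodType R) (f : {linear M -> M'}) P :
  is_submod P -> is_submod (f @` P).
Proof.
move=> [P0 PL]; split=> [|a _ _ [u Pu <-] [v Pv <-]].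
  by exists 0; rewrite ?linear0.
by exists (a *: u + v); rewrite ?linearP //; apply: PL.
Qed.

(** * Lengths of subquotients *)

Section Length.
Variables (F : realType) (R : comNzRingType).
Implicit Types M : lmodType R.

Definition chain M (P Q : set M) (k : nat) := exists c : nat -> submodClosed M,
  forall i, (i < k)%N ->
    [/\ strict_sub (c i) (c i.+1), P `<=` [set` c i] & [set` c i.+1] `<=` Q].

(** For submodules P contained in Q this is the length of Q/P, obtained without forming the
    quotient. *)
Definition len M (P Q : set M) : \bar F :=
  ereal_sup [set k%:R%:E | k in [set k | chain P Q k]].

Lemma chain0 M (P Q : set M) : chain P Q 0.
Proof. by exists (fun=> mkSub (@is_submodT R M)). Qed.

Lemma len_chain M (P Q : set M) k : chain P Q k -> (k%:R%:E <= len P Q)%E.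
Proof. by move=> h; apply: ereal_sup_ubound; exists k. Qed.
Lemma len_ub M (P Q : set M) (e : \bar F) :
  (forall k, chain P Q k -> (k%:R%:E <= e)%E) -> (len P Q <= e)%E.
Proof. by move=> h; apply: ge_ereal_sup => _ [k /h hk <-]. Qed.
Lemma len_ge0 M (P Q : set M) : (0 <= len P Q)%E.
Proof. exact: (len_chain (chain0 P Q)). Qed.
Hint Resolve len_ge0 : core.

Lemma len_le M M' (P Q : set M) (P' Q' : set M') :
  (forall k, chain P Q k -> chain P' Q' k) -> (len P Q <= len P' Q')%E.
Proof. by move=> h; apply: len_ub => k /h; exact: len_chain. Qed.

Lemma len_mono M (P Q P' Q' : set M) :
  P' `<=` P -> Q `<=` Q' -> (len P Q <= len P' Q')%E.
Proof.
move=> PP QQ; apply: len_le => k [c hc]; exists c => i /hc[cs Pc cQ].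
by split=> // [u /PP /Pc|u /cQ /QQ].
Qed.

Lemma length_len M : length F M = len [set (0 : M)] [set: M].
Proof.
congr (ereal_sup _); apply/seteqP; split=> _ [k [c hc] <-]; exists k => //.
  exists c => i /hc ci; split=> // _ ->; exact: rpred0.
by exists c => i /hc[].
Qed.

(** The hypotheses say that f induces a surjection from Q/P onto Q'/P'. Chains are pulled back along
    f; strictness survives because every element of Q' is an image modulo P'. *)
Lemma len_surj M M' (f : {linear M -> M'}) (P Q : set M) (P' Q' : set M') :
  is_submod Q -> (forall u, P u -> Q u -> P' (f u)) -> P `<=` Q ->
  (forall v, Q' v -> exists u, Q u /\ P' (v - f u)) ->
  (len P' Q' <= len P Q)%E.
Proof.
move=> hQ PP' PQ QQ'; apply: len_le => k [c hc].
have hs i : is_submod (f @^-1` [set` c i] `&` Q).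
  by apply: is_submodI => //; apply/is_submod_preim/is_submod_pred.
exists (fun i => mkSub (hs i)) => i /hc[[cc cn] P'c cQ']; split.
- split=> [u /mkSubE[/= /cc fu Qu]|h]; first exact/mkSubE.
  apply: cn => v vc; have [u [Qu P'u]] := QQ' v (cQ' _ vc).
  have vc' := P'c _ P'u.
  have /mkSubE[/= fu _] : u \in mkSub (hs i).
    apply: h; apply/mkSubE; split=> //; change (f u \in c i.+1).
    have -> : f u = v - (v - f u) by rewrite subKr.
    by rewrite submodClosedB //; apply: cc.
  by rewrite -(subrK (f u) v) rpredD.
- by move=> u Pu; apply/mkSubE; split; [apply/P'c/PP' => //; exact: PQ | exact: PQ].
- by move=> u /mkSubE[].
Qed.

(** The hypotheses say that f induces an injection of Q/P into Q'/P'. A chain c is pushed forward to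
    the chain of the f(c i) + P'. *)
Lemma len_inj M M' (f : {linear M -> M'}) (P Q : set M) (P' Q' : set M') :
  is_submod P' -> is_submod Q' -> P' `<=` Q' ->
  (forall u, Q u -> Q' (f u)) -> (forall u, Q u -> P' (f u) -> P u) ->
  (len P Q <= len P' Q')%E.
Proof.
move=> hP' hQ' PQ' fQ fP; apply: len_le => k [c hc].
have hs i : is_submod (addS (f @` [set` c i]) P').
  by apply: is_submod_addS => //; apply/is_submod_img/is_submod_pred.
exists (fun i => mkSub (hs i)) => i /hc[[cc cn] Pc cQ]; split.
- split=> [u /mkSubE[_ [p [[v vc <-] P'p ->]]]|h].
    by apply/mkSubE; exists (f v), p; split=> //; exists v => //; exact: cc.
  apply: cn => u uc.
  have /mkSubE[_ [p [[v vc <-] P'p E]]] : f u \in mkSub (hs i).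
    by apply: h; apply/mkSubE/addSl => //; exists u.
  rewrite -(subrK v u) rpredD //; apply/Pc/fP.
    by apply: cQ; change (u - v \in c i.+1); rewrite submodClosedB //; exact: cc.
  by rewrite linearB /= E addrC addKr.
- by move=> u Pu; apply/mkSubE; apply: addSr => //; apply/is_submod_img/is_submod_pred.
- move=> u /mkSubE; apply: addS_min => // _ [v vc <-].
  by apply: fQ; exact: cQ.
Qed.

(** Discarding the repetitions in a weakly increasing family leaves a strict chain; the sum counts
    its strict steps. *)
Lemma len_weak M (P Q : set M) (c : nat -> set M) k :
  (forall i, is_submod (c i)) -> (forall i, (i < k)%N -> c i `<=` c i.+1) ->
  P `<=` c 0 -> c k `<=` Q ->
  ((\sum_(i < k) ~~ `[< c i.+1 `<=` c i >])%:R%:E <= len P Q)%E.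
Proof.
move=> hc cc Pc cQ; apply: len_chain.
suff [e [h1 h2 h3]] : exists e : nat -> submodClosed M,
  [/\ forall i, (i < \sum_(j < k) ~~ `[< c j.+1 `<=` c j >])%N -> strict_sub (e i) (e i.+1),
      (forall i, P `<=` [set` e i]) &
      forall i, (i <= \sum_(j < k) ~~ `[< c j.+1 `<=` c j >])%N -> [set` e i] `<=` c k].
  exists e => i ik; split; [exact: h1|exact: h2|].
  by apply: subset_trans cQ; exact: h3.
elim: k cc {cQ} => [|k IH] cc.
  exists (fun=> mkSub (hc 0%N)); rewrite big_ord0; split=> // [_ u /Pc ?|i _ u];
    by rewrite /= mkSubE.
have [|e [h1 h2 h3]] := IH; first by move=> i ik; apply: cc; rewrite ltnS ltnW.
have ck := cc k (ltnSn k).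
rewrite big_ord_recr /=; set m := (\sum_(j < k) _)%N in h1 h3 *.
have [hk|hk] := pselect (c k.+1 `<=` c k).
  rewrite (asboolT hk) addn0; exists e; split=> // i im.
  by apply: subset_trans ck; exact: h3.
rewrite (asboolF hk) addn1.
exists (fun i => if (i <= m)%N then e i else mkSub (hc k.+1)); split.
- move=> i; rewrite ltnS => im; rewrite im.
  have := im; rewrite leq_eqVlt => /predU1P[->|im']; last by rewrite im'; exact: h1.
  rewrite ltnn; split=> [u ue|h]; first by apply/mkSubE/ck/(h3 m).
  by apply: hk => u uc; apply: (h3 m (leqnn m)); apply/h/mkSubE.
- move=> i; case: ifP => // _ u Pu; apply/mkSubE/ck.
  by apply: (h3 0%N) => //; exact: h2.
- move=> i im; case: ifP => [im' u ue|_ u /mkSubE //].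
  by apply: ck; exact: (h3 i).
Qed.

(** A chain from P to S is both intersected with Q and added to Q. By the modular law a strict step
    stays strict in at least one of the two families, and [len_weak] counts the strict steps of
    each. *)
Lemma len_le_add M (P Q S : set M) : is_submod Q -> P `<=` Q -> Q `<=` S -> is_submod S ->
  (len P S <= len P Q + len Q S)%E.
Proof.
move=> hQ PQ QS hS; apply: len_ub => k [c hc].
case: k hc => [|k] hc; first by rewrite adde_ge0.
pose b i := [set` c i] `&` Q; pose e i := addS [set` c i] Q.
have hb i : is_submod (b i) by apply: is_submodI => //; exact: is_submod_pred.
have he i : is_submod (e i) by apply: is_submod_addS => //; exact: is_submod_pred.
have cc i : (i < k.+1)%N -> [set` c i] `<=` [set` c i.+1].
  by move=> /hc[[h _] _ _] u /h.
have lb : ((\sum_(i < k.+1) ~~ `[< b i.+1 `<=` b i >])%:R%:E <= len P Q)%E.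
  apply: len_weak => //.
  - by move=> i /cc h u [/h ? ?].
  - by move=> u Pu; split; [have [_ h _] := hc 0%N isT; exact: h | exact: PQ].
  - by move=> u [].
have le : ((\sum_(i < k.+1) ~~ `[< e i.+1 `<=` e i >])%:R%:E <= len Q S)%E.
  apply: len_weak => //.
  - by move=> i /cc h; exact: addS_mono.
  - by move=> u Qu; apply: addSr => //; exact: is_submod_pred.
  - by apply: addS_min => //; have [_ _ h] := hc k (ltnSn k).
apply: le_trans (leeD lb le); rewrite -EFinD lee_fin -natrD ler_nat -big_split /=.
rewrite -[X in (X <= _)%N]card_ord -sum1_card; apply: leq_sum => i _.
have [[_ cn] _ _] := hc i (ltn_ord i).
case: asboolP => // bi; case: asboolP => // ei; exfalso; apply: cn => u uc.
have [v [w [vc Qw E]]] : e i u by apply: ei; apply: addSl.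
have wc : w \in c i.+1.
  by rewrite -[w](addKr v) addrC -E submodClosedB //; exact: (cc i (ltn_ord i)).
by rewrite E rpredD //; have [] : b i w by apply: bi.
Qed.

Lemma len_ge_add M (P Q S : set M) : P `<=` Q -> Q `<=` S ->
  (len P Q + len Q S <= len P S)%E.
Proof.
move=> PQ QS.
have cat j k : chain P Q j -> chain Q S k -> chain P S (j + k).
  move=> [c hc] [e he].
  case: k he => [|k] he.
    by rewrite addn0; exists c => i /hc[? ? h]; split=> //; exact: subset_trans QS.
  case: j hc => [|j] hc.
    by exists e => i /he[? h ?]; split=> //; exact: subset_trans h.
  (* At the junction [c j.+1] takes the place of [e 0]; since it lies in Q, hence in [e 0], the step
     to [e 1] remains strict. *)
  exists (fun i => if (i <= j.+1)%N then c i else e (i - j.+1)%N) => i ijk.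
  have [hij|hij] := ltnP i j.+1.
    rewrite (ltnW hij); have [? ? h] := hc i hij; split=> //; exact: subset_trans QS.
  have [] := he (i - j.+1)%N _; first by rewrite ltn_subLR.
  rewrite -subSn //; case: ifPn => hij' [h1 h2] h3 h4.
    have E : i = j.+1 by apply/eqP; rewrite eqn_leq hij hij'.
    rewrite {}E subSnn ?subnn in h1 h2 h3 h4 *.
    have [[cc cn] Pc cQ] := hc j (ltnSn j); split=> //.
      split=> [u uc|h]; first by apply: h1; apply: h3; apply: cQ.
      by apply: h2 => u /h uc; apply: h3; apply: cQ.
    by move=> u /Pc uc; apply: cc.
  split=> //; exact: subset_trans h3.
(* The two suprema are taken one after the other by subtraction, which needs finite values. *)
have [->|] := eqVneq (len P S) +oo%E; first exact: leey.
rewrite -ltey => lPS.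
have fS : len P S \is a fin_num by rewrite ge0_fin_numE.
have H j k : chain P Q j -> chain Q S k -> (j%:R%:E + k%:R%:E <= len P S)%E.
  by move=> hj hk; rewrite -EFinD -natrD; apply: len_chain; exact: cat.
have H2 j : chain P Q j -> (j%:R%:E + len Q S <= len P S)%E.
  move=> hj; rewrite addeC -leeBrDr //; apply: len_ub => k hk.
  by rewrite leeBrDr // addeC; exact: H.
have fQ : len Q S \is a fin_num.
  rewrite ge0_fin_numE //; apply: le_lt_trans lPS.
  by rewrite -[X in (X <= _)%E]add0e; exact: (H2 0%N (chain0 _ _)).
rewrite -leeBrDr //; apply: len_ub => j hj; rewrite leeBrDr //; exact: H2.
Qed.

Lemma len_add M (P Q S : set M) : is_submod Q -> P `<=` Q -> Q `<=` S -> is_submod S ->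
  len P S = (len P Q + len Q S)%E.
Proof.
by move=> *; apply/eqP; rewrite eq_le len_le_add ?len_ge_add.
Qed.

Lemma len_eq0 M (P Q : set M) : Q `<=` P -> len P Q = 0%E.
Proof.
move=> QP; apply/eqP; rewrite eq_le len_ge0 andbT; apply: len_ub => -[|k] // [c hc].
have [[_ cn] Pc cQ] := hc 0%N isT; exfalso; apply: cn => u uc.
by apply/Pc/QP/cQ.
Qed.

Lemma len_le1 M (P Q : set M) :
  (forall c : submodClosed M, P `<=` [set` c] -> [set` c] `<=` Q ->
     ~ [set` c] `<=` P -> Q `<=` [set` c]) -> (len P Q <= 1)%E.
Proof.
move=> h; apply: len_ub => -[|[|k]] [c hc]; rewrite ?lee_fin ?ler01 //.
have [[_ c01] Pc0 c1Q] := hc 0%N isT; have [[cc12 c12] Pc1 c2Q] := hc 1%N isT.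
exfalso; apply: c12 => u uc; apply: (h (c 1%N)) => //; last exact: c2Q.
by move=> c1P; apply: c01 => v /c1P /Pc0.
Qed.

Lemma length_submodule M (N : submodClosed M) :
  length F (submodule N) = len [set 0] [set` N].
Proof.
rewrite length_len; apply/eqP; rewrite eq_le; apply/andP; split.
  apply: (len_inj (f := @incl R M N)) => //.
  - exact: is_submod0.
  - exact: is_submod_pred.
  - by move=> _ ->; exact: (rpred0 N).
  - by move=> u _; exact: valP.
  - by move=> u _ /= u0; apply: val_inj; rewrite -[RHS]/(@incl R M N 0) linear0.
apply: (len_surj (f := @incl R M N)) => // [_ -> _|v vN]; first by rewrite linear0.
by exists (exist _ v vN); split=> //=; rewrite subrr.
Qed.

Lemma len_subquot M (N P : submodClosed M) : {subset P <= N} ->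
  (len [set` P] [set` N] <= length F (subquot N P))%E.
Proof.
move=> PN; rewrite length_len.
apply: (@le_trans _ _ (len [set` lin_preim (@incl R M N) P] [set: submodule N])).
  apply: (len_surj (f := @incl R M N)) => // v vN.
  by exists (exist _ v vN); split=> //=; rewrite subrr rpred0.
apply: (len_inj (f := @quotmod_pi R (submodule N) (lin_preim (@incl R M N) P))) => //.
- exact: is_submod0.
- move=> u _ /= u0.
  have /quotmod_eqP : quotmod_pi (lin_preim (@incl R M N) P) u = quotmod_pi _ 0.
    by rewrite u0 linear0.
  by rewrite subr0.
Qed.

End Length.
Arguments len_ge0 {F R M P Q}.
#[global] Hint Extern 0 (is_true (_ <= len _ _ _)%E) => exact: len_ge0 : core.
Arguments len_surj {F R M M' f P Q P' Q'}.
Arguments len_inj {F R M M' f P Q P' Q'}.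
Arguments len_add {F R M P Q S}.
Arguments len_le_add {F R M P Q S}.
Arguments len_ge_add {F R M P Q S}.
Arguments len_eq0 {F R M P Q}.
Arguments len_le1 {F R M P Q}.
Arguments len_mono {F R M P Q P' Q'}.
Arguments len_chain {F R M P Q k}.
Arguments len_ub {F R M P Q e}.

Lemma muleS (F : realType) (n : nat) (x : \bar F) :
  (n.+1%:R%:E * x = x + n%:R%:E * x)%E.
Proof. by rewrite -natr1 EFinD ge0_muleDl ?lee_fin // mul1e addeC. Qed.

Lemma nate_ge0 (F : realType) (n : nat) : (0 <= n%:R%:E :> \bar F)%E.
Proof. by rewrite lee_fin. Qed.
#[global] Hint Extern 0 (is_true (_ <= _%:R%:E)%E) => exact: nate_ge0 : core.

Section LinearMaps.
Variables (R : comNzRingType) (M M' : lmodType R).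
Definition mkLin (f : M -> M') (hf : linear f) : {linear M -> M'} :=
  HB.pack_for {linear M -> M'} f (GRing.isLinear.Build R M M' *:%R f hf).
End LinearMaps.

(** * Kernel and cokernel of multiplication by a ring element *)

Section Multiplication.
Variables (F : realType) (R : comNzRingType) (M : lmodType R) (B Z : set M).
Hypotheses (hB : is_submod B) (hZ : is_submod Z) (BZ : B `<=` Z).

(** With H = Z/B, [mulS a] is the preimage in Z of aH, and [annS a] that of the annihilator of a in
    H. *)
Definition mulS (a : R) : set M := [set u | exists b z, [/\ B b, Z z & u = b + a *: z]].
Definition annS (a : R) : set M := [set z | Z z /\ B (a *: z)].

Lemma is_submod_mulS a : is_submod (mulS a).
Proof.
split=> [|c _ _ [u [v [Bu Zv ->]]] [u' [v' [Bu' Zv' ->]]]].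
  by exists 0, 0; split; rewrite ?scaler0 ?addr0 //; exact: submod0.
exists (c *: u + u'), (c *: v + v'); split.
- by case: hB => _; apply.
- by case: hZ => _; apply.
- by rewrite !scalerDr addrACA !scalerA [a * c]mulrC.
Qed.
Lemma is_submod_annS a : is_submod (annS a).
Proof.
split=> [|c u v [Zu Bu] [Zv Bv]].
  by split; rewrite ?scaler0; exact: submod0.
split; first by case: hZ => _; apply.
by rewrite scalerDr scalerA mulrC -scalerA; case: hB => _; apply.
Qed.
Lemma mulS_B a : B `<=` mulS a.
Proof.
by move=> u Bu; exists u, 0; split; rewrite ?scaler0 ?addr0 //; exact: submod0.
Qed.
Lemma mulS_Z a : mulS a `<=` Z.
Proof.
by move=> _ [b [z [/BZ Zb Zz ->]]]; apply: submodD => //; exact: submodZ.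
Qed.
Lemma annS_B a : B `<=` annS a.
Proof. by move=> u Bu; split; [exact: BZ | exact: submodZ]. Qed.
Lemma mulS_mulr a b : mulS (a * b) `<=` mulS a.
Proof.
move=> _ [u [z [Bu Zz ->]]]; exists u, (b *: z); split; rewrite ?scalerA //.
exact: submodZ.
Qed.
Lemma annS_mulr a b : annS a `<=` annS (a * b).
Proof. by move=> u [Zu Bu]; split=> //; rewrite mulrC -scalerA; exact: submodZ. Qed.

(** Multiplication by a^n maps H/aH onto a^n H/a^(n+1) H, so each further power costs at most the
    length of H/aH. *)
Lemma len_mulS_exp a n :
  (len F (mulS (a ^+ n)) Z <= n%:R%:E * len F (mulS a) Z)%E.
Proof.
elim: n => [|n IH].
  rewrite mul0e len_eq0 // => z Zz; exists 0, z.
  by split=> //; [exact: submod0 | rewrite scale1r add0r].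
rewrite muleS (@len_add F _ _ _ (mulS (a ^+ n))) //; last first.
- exact: mulS_Z.
- by rewrite exprSr; exact: mulS_mulr.
- exact: is_submod_mulS.
apply: leeD => //.
apply: (len_surj (f := *:%R (a ^+ n))) => //.
- move=> _ [b [z [Bb Zz ->]]] _; exists (a ^+ n *: b), z; split=> //.
    exact: submodZ.
  by rewrite /= scalerDr scalerA -exprSr.
- exact: mulS_Z.
- move=> _ [b [z [Bb Zz ->]]]; exists z; split=> //.
  by rewrite /= addrK; exact: mulS_B.
Qed.

(** Multiplication by a^n embeds (0 : a^(n+1))/(0 : a^n) into (0 : a). *)
Lemma len_annS_exp a n :
  (len F B (annS (a ^+ n)) <= n%:R%:E * len F B (annS a))%E.
Proof.
elim: n => [|n IH].
  by rewrite mul0e len_eq0 // => z [_]; rewrite scale1r.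
rewrite muleS addeC (@len_add F _ _ _ (annS (a ^+ n))) //; last first.
- exact: is_submod_annS.
- by rewrite exprSr; exact: annS_mulr.
- exact: annS_B.
- exact: is_submod_annS.
apply: leeD => //.
apply: (len_inj (f := *:%R (a ^+ n))) => //.
- exact: is_submod_annS.
- exact: annS_B.
- by move=> u [Zu Bu]; split; [exact: submodZ | rewrite /= scalerA -exprS].
- by move=> u [Zu _] Bu; split.
Qed.

(* On a finite-length module, multiplication by [a] has kernel and cokernel of the
   same length; this is applied to the annihilator of [a ^+ n]. *)
Lemma len_mulS_annS a n :
  (len F (mulS a) [set z | Z z /\ mulS (a ^+ n.+1) (a ^+ n *: z)] <= len F B (annS a))%E.
Proof.
have [->|] := eqVneq (len F B (annS a)) +oo%E; first exact: leey.
rewrite -ltey => la.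
pose A := annS (a ^+ n).
pose aA : set M := [set u | exists b z, [/\ B b, A z & u = b + a *: z]].
have hA : is_submod A by exact: is_submod_annS.
have haA : is_submod aA.
  split=> [|c _ _ [u [v [Bu Zv ->]]] [u' [v' [Bu' Zv' ->]]]].
    by exists 0, 0; split; rewrite ?scaler0 ?addr0 //; exact: submod0.
  exists (c *: u + u'), (c *: v + v'); split.
  - by case: hB => _; apply.
  - by case: hA => _; apply.
  - by rewrite !scalerDr addrACA !scalerA [a * c]mulrC.
have BA : B `<=` A by exact: annS_B.
have aAA : aA `<=` A.
  by move=> _ [b [z [/BA Ab Az ->]]]; apply: submodD => //; exact: submodZ.
have BaA : B `<=` aA.
  by move=> u Bu; exists u, 0; split; rewrite ?scaler0 ?addr0 //; exact: submod0.
apply: (@le_trans _ _ (len F aA A)).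
  apply: (len_surj (f := idfun)) => //.
  - move=> _ [b [z [Bb [Zz _] ->]]] _; by exists b, z.
  (* If a^n u = b + a^(n+1) z, then u - a z is killed by a^n modulo B, so A maps onto the quotient
     in question. *)
  - move=> u [Zu [b [z [Bb Zz E]]]]; exists (u - a *: z); split; last first.
      by exists 0, z; split=> //; [exact: submod0 | rewrite subKr add0r].
    split; first by apply: submodB => //; exact: submodZ.
    by rewrite scalerBr E scalerA -exprSr addrK.
have lA : (len F B A < +oo)%E.
  by apply: le_lt_trans (len_annS_exp a n) _; apply: lte_mul_pinfty.
have fBaA : len F B aA \is a fin_num.
  by rewrite ge0_fin_numE //; apply: le_lt_trans lA; exact: len_mono.
have hI : is_submod (A `&` annS a) by apply: is_submodI => //; exact: is_submod_annS.
(* The length of A/B is counted twice: through [aA], and through the kernel and image of a on A/B.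
   The finite length of aA/B then cancels. *)
rewrite -(@leeD2rE _ (len F B aA)) // addeC -len_add //.
rewrite (@len_add F _ _ _ (A `&` annS a)) //; last first.
  by move=> u Bu; split; [exact: BA | exact: annS_B].
apply: leeD; first by apply: len_mono => // u [].
apply: (len_inj (f := *:%R a)) => //.
- move=> u Au; exists 0, u; split=> //; [exact: submod0 | by rewrite add0r].
- by move=> u Au Bu; split=> //; split=> //; case: Au.
Qed.

(** The surjection from H/aH onto a^n H/a^(n+1) H has a kernel no longer than (0 : a), by
    [len_mulS_annS]; summing over the first n powers gives the bound. *)
Lemma len_mulS_lower a n :
  (n%:R%:E * len F (mulS a) Z <=
   len F (mulS (a ^+ n)) Z + n%:R%:E * len F B (annS a))%E.
Proof.
elim: n => [|n IH]; first by rewrite !mul0e adde0.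
rewrite !muleS (@len_add F _ _ (mulS (a ^+ n.+1)) (mulS (a ^+ n))) //; last first.
- exact: mulS_Z.
- by rewrite exprSr; exact: mulS_mulr.
- exact: is_submod_mulS.
rewrite addeACA; apply: leeD => //.
pose K := [set z | Z z /\ mulS (a ^+ n.+1) (a ^+ n *: z)].
have hK : is_submod K.
  apply: is_submodI => //.
  by apply: (@is_submod_preim _ _ _ ( *:%R (a ^+ n))); exact: is_submod_mulS.
rewrite (@len_add F _ _ (mulS a) K) //; last 2 first.
- move=> u au; split; first exact: mulS_Z au.
  case: au => b [z [Bb Zz ->]]; exists (a ^+ n *: b), z; split=> //.
    exact: submodZ.
  by rewrite scalerDr scalerA -exprSr.
- by move=> u [].
rewrite addeC; apply: leeD; first exact: len_mulS_annS.
apply: (len_inj (f := *:%R (a ^+ n))) => //.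
- exact: is_submod_mulS.
- exact: is_submod_mulS.
- by rewrite exprSr; exact: mulS_mulr.
- move=> u Zu; exists 0, u; split=> //; [exact: submod0 | by rewrite add0r].
Qed.

End Multiplication.

(** * Complexes, mapping cones and the Koszul complex *)

Section GradedModules.
Variables (R : comNzRingType).

(** A complex is one module with one differential, its degrees being submodules of it. This keeps
    degrees out of the types. *)
Record dgm := Dgm {
  car : lmodType R;
  dif : {linear car -> car};
  gr : nat -> set car;
  gr_sub : forall i, is_submod (gr i);
  dif_gr : forall i u, gr i.+1 u -> gr i (dif u);
  dif_gr0 : forall u, gr 0 u -> dif u = 0;
  difK : forall u, dif (dif u) = 0 }.
Arguments dif {d}.
Arguments gr {d}.
Arguments gr_sub : clear implicits.

Definition cyc (C : dgm) (i : nat) : set (car C) := [set u | gr i u /\ dif u = 0].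
Definition bnd (C : dgm) (i : nat) : set (car C) :=
  [set u | exists v, gr i.+1 v /\ u = dif v].
Arguments cyc : clear implicits.
Arguments bnd : clear implicits.

Lemma is_submod_cyc C i : is_submod (cyc C i).
Proof.
split=> [|a u v [gu du] [gv dv]]; first by split; [exact: submod0 (gr_sub _ _)|exact: linear0].
split; first by case: (gr_sub C i) => _; apply.
by rewrite linearP du dv scaler0 addr0.
Qed.
Lemma is_submod_bnd C i : is_submod (bnd C i).
Proof.
split=> [|a _ _ [u [gu ->]] [v [gv ->]]].
  by exists 0; split; [exact: submod0 (gr_sub _ _)|rewrite linear0].
by exists (a *: u + v); split; [case: (gr_sub C i.+1) => _; apply | rewrite linearP].
Qed.
Lemma bnd_cyc C i : bnd C i `<=` cyc C i.
Proof. by move=> _ [v [gv ->]]; split; [exact: dif_gr | exact: difK]. Qed.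

(** The grading of the copy of C shifted by one degree inside a cone, zero in degree 0. *)
Definition grm (C : dgm) (i : nat) : set (car C) := if i is i'.+1 then gr i' else [set 0].
Arguments grm : clear implicits.
Lemma is_submod_grm C i : is_submod (grm C i).
Proof. by case: i => [|i]; [exact: is_submod0 | exact: gr_sub]. Qed.

Section Cone.
Variables (a : R) (C : dgm).

(** The cone of multiplication by a on C; the second coordinate belongs to the shifted copy, whence
    the sign. *)
Definition cone_dif (u : car C * car C) : car C * car C :=
  (dif u.1 + a *: u.2, - dif u.2).
Fact cone_dif_linear : linear cone_dif.
Proof.
move=> c [u1 u2] [v1 v2].
transitivity (c *: (dif u1 + a *: u2) + (dif v1 + a *: v2), c *: (- dif u2) - dif v2);
  last by [].
rewrite /cone_dif /=; congr (_, _); last by rewrite linearP opprD -scalerN.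
by rewrite linearP !scalerDr addrACA !scalerA [a * c]mulrC.
Qed.
Definition cone_gr i : set (car C * car C)%type :=
  [set u | gr i u.1 /\ grm C i u.2].
Fact cone_gr_sub i : is_submod (cone_gr i).
Proof.
split=> [|c u v [u1 u2] [v1 v2]]; 
  first by split; [exact: submod0 (gr_sub _ _)|exact: submod0 (is_submod_grm _ _)].
by split; [exact: (gr_sub C i).2 | exact: (is_submod_grm C i).2].
Qed.
Fact cone_dif_gr i u : cone_gr i.+1 u -> cone_gr i (mkLin cone_dif_linear u).
Proof.
case: u => u v [/= gu gv]; split=> /=.
  apply: submodD; [exact: gr_sub | exact: dif_gr | exact: submodZ (gr_sub _ _) _].
apply: submodN; first exact: is_submod_grm.
by case: i gv {gu} => [|i] gv /=; [exact: dif_gr0 | exact: dif_gr].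
Qed.
Fact cone_dif_gr0 u : cone_gr 0 u -> mkLin cone_dif_linear u = 0.
Proof.
case: u => u v [/= gu ->] /=; rewrite /cone_dif /=.
by rewrite dif_gr0 // scaler0 addr0 linear0 oppr0.
Qed.
Fact cone_difK u : mkLin cone_dif_linear (mkLin cone_dif_linear u) = 0.
Proof.
case: u => u v.
have E1 : dif (dif u + a *: v) + a *: - dif v = 0.
  by rewrite linearD difK linearZ /= scalerN add0r subrr.
have E2 : - dif (- dif v) = 0 by rewrite linearN difK !oppr0.
by rewrite /= /cone_dif /= E1 E2.
Qed.
Definition cone : dgm :=
  Dgm cone_gr_sub cone_dif_gr cone_dif_gr0 cone_difK.

End Cone.

Section Base.
Variable M : lmodType R.
Definition base_gr i : set M := if i is 0 then [set: M] else [set 0].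
Fact zero_linear : linear (fun _ : M => 0 : M).
Proof. by move=> a u v; rewrite scaler0 addr0. Qed.
Fact base_gr_sub i : is_submod (base_gr i).
Proof. by case: i => [|i]; [exact: is_submodT | exact: is_submod0]. Qed.
Fact base_dif_gr i u : base_gr i.+1 u -> base_gr i (mkLin zero_linear u).
Proof. by case: i. Qed.
Definition base : dgm := @Dgm M (mkLin zero_linear) base_gr base_gr_sub base_dif_gr
  (fun _ _ => erefl) (fun _ => erefl).
End Base.

Definition kos (x : seq R) (M : lmodType R) : dgm := foldr cone (base M) x.

End GradedModules.
Arguments dif {R d}.
Arguments gr {R d}.
Arguments gr_sub {R}.
Arguments cyc {R}.
Arguments bnd {R}.
Arguments grm {R}.

(** * Lengths of the homology of a cone *)

Section KoszulLength.
Variables (F : realType) (R : comNzRingType).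
Implicit Types (C D : dgm R) (M : lmodType R).

Definition hlen C i : \bar F := len F (bnd C i) (cyc C i).
Arguments hlen : clear implicits.

Definition cycm C i : set (car C) := if i is i'.+1 then cyc C i' else [set 0].
Definition bndm C i : set (car C) := if i is i'.+1 then bnd C i' else [set 0].
Arguments cycm : clear implicits.
Arguments bndm : clear implicits.
Lemma is_submod_cycm C i : is_submod (cycm C i).
Proof. by case: i => [|i]; [exact: is_submod0 | exact: is_submod_cyc]. Qed.
Lemma is_submod_bndm C i : is_submod (bndm C i).
Proof. by case: i => [|i]; [exact: is_submod0 | exact: is_submod_bnd]. Qed.
Lemma bndm_cycm C i : bndm C i `<=` cycm C i.
Proof. by case: i => [|i] //; exact: bnd_cyc. Qed.

Fact inl_linear M : linear (fun u : M => (u, 0) : M * M).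
Proof. by move=> a u v; rewrite -[RHS]/(a *: u + v, a *: 0 + 0) scaler0 addr0. Qed.
Fact inr_linear M : linear (fun u : M => (0, u) : M * M).
Proof. by move=> a u v; rewrite -[RHS]/(a *: 0 + 0, a *: u + v) scaler0 addr0. Qed.
Fact fst_linear M : linear (fun u : M * M => u.1). Proof. by []. Qed.
Fact snd_linear M : linear (fun u : M * M => u.2). Proof. by []. Qed.

(* The long exact sequence of the cone, at the level of lengths. *)
Lemma hlen_cone a C i : hlen (cone a C) i =
  (len F (mulS (bnd C i) (cyc C i) a) (cyc C i) +
   len F (bndm C i) (annS (bndm C i) (cycm C i) a))%E.
Proof.
(* Q consists of the cycles whose class dies in H_(i-1)(C). Modulo boundaries it is the cokernel of
   a on H_i(C), and the cycles modulo Q form the kernel of a on H_(i-1)(C). *)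
pose Q : set (car (cone a C)) := [set u | cyc (cone a C) i u /\ bndm C i u.2].
have hQ : is_submod Q.
  apply: is_submodI; first exact: is_submod_cyc.
  by apply: (@is_submod_preim _ _ _ (mkLin (@snd_linear (car C)))); exact: is_submod_bndm.
have bndQ : bnd (cone a C) i `<=` Q.
  move=> u bu; split; first exact: bnd_cyc.
  case: bu => -[p q] [[/= gp gq] ->] /=.
  case: i {Q hQ u} gp gq => [|i] gp gq /=; first by rewrite dif_gr0 // oppr0.
  by exists (- q); split; [exact: submodN (gr_sub _ _) _ | rewrite linearN].
have QZ : Q `<=` cyc (cone a C) i by move=> u [].
have grmcyc q : cycm C i q -> grm C i q by case: (i) => // j [].
rewrite /hlen (len_add hQ bndQ QZ); last exact: is_submod_cyc.
congr (_ + _)%E; apply/eqP; rewrite eq_le; apply/andP; split.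
- apply: (len_surj (f := mkLin (@inl_linear (car C)))).
  + exact: is_submod_cyc.
  + move=> _ [b [z [[p [gp ->]] [gz dz] ->]]] _; exists (p, z); split=> /=.
      by split.
    by rewrite /= /cone_dif /= dz oppr0.
  + by apply: mulS_Z; [exact: is_submod_cyc | exact: bnd_cyc].
  + move=> [p q] [[[/= gp gq] [du dv]] bq].
    have [w [gw Eq]] : exists w, gr i w /\ q = dif w.
      case: (i) gq bq => [|j] /= gq bq; last by case: bq => w [gw ->]; exists w.
      by exists 0; split; [exact: submod0 (gr_sub _ _)|rewrite linear0].
    (* The cycle (p, dw) differs from (p + a w, 0) by the boundary of (0, -w). *)
    exists (p + a *: w); split.
      split; first by apply: submodD; [exact: gr_sub| |exact: submodZ (gr_sub _ _) _].
      by rewrite linearD linearZ /= -Eq.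
    exists (0, - w); split.
      by split=> /=; [exact: submod0 (gr_sub _ _)|exact: submodN (gr_sub _ _) _].
    rewrite -[LHS]/(p - (p + a *: w), q - 0) /= /cone_dif /=.
    congr (_, _); last by rewrite subr0 linearN opprK.
    by rewrite linear0 add0r scalerN opprD addrA subrr add0r.
- apply: (len_inj (f := mkLin (@inl_linear (car C)))) => //.
  + exact: is_submod_bnd.
  + move=> u [gu du]; split=> /=; last exact: submod0 (is_submod_bndm _ _).
    split; first by split=> //=; exact: submod0 (is_submod_grm _ _).
    by rewrite /= /cone_dif /= du scaler0 addr0 linear0 oppr0.
  + move=> u _ [[p q] [[/= gp gq]]]; rewrite /= /cone_dif /= => -[-> /eqP].
    rewrite eq_sym oppr_eq0 => /eqP dq.
    by exists (dif p), q; split=> //; exists p.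
- apply: (len_inj (f := mkLin (@snd_linear (car C)))) => //.
  + exact: is_submod_bndm.
  + by apply: is_submod_annS; [exact: is_submod_bndm | exact: is_submod_cycm].
  + by apply: annS_B; [exact: is_submod_bndm | exact: bndm_cycm].
  + move=> [p q] [[/= gp gq] [du /eqP]]; rewrite oppr_eq0 => /eqP dq.
    case: (i) gp gq => [|j] /= gp gq; first by split=> //; rewrite gq scaler0.
    split=> //; exists (- p); split; first exact: submodN (gr_sub _ _) _.
    by rewrite linearN; apply/eqP; rewrite -addr_eq0 addrC du.
- apply: (len_surj (f := mkLin (@snd_linear (car C)))).
  + exact: is_submod_cyc.
  + by move=> u [].
  + exact: QZ.
  + move=> q [zq aq]; have [p [gp Ep]] : exists p, gr i p /\ dif p = - (a *: q).
      case: (i) zq aq => [|j] /= zq.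
        exists 0; split; first exact: submod0 (gr_sub _ _).
        by rewrite zq scaler0 linear0 oppr0.
      case=> p [gp ->]; exists (- p); split; first exact: submodN (gr_sub _ _) _.
      by rewrite linearN.
    exists (p, q); split; last by rewrite /= subrr; exact: submod0 (is_submod_bndm _ _).
    split; first by split=> //=; exact: grmcyc.
    rewrite /= /cone_dif /= Ep addNr; congr (_, _).
    have -> : dif q = 0; last by rewrite oppr0.
    by case: (i) zq => [->|j []] //; rewrite linear0.
Qed.

Section Powers.
Variables (a : R) (C : dgm R) (n : nat).
Let hZ i := is_submod_cyc C i.
Let hB i := is_submod_bnd C i.
Let hBZ i := @bnd_cyc R C i.
Let hZm i := is_submod_cycm C i.
Let hBm i := is_submod_bndm C i.
Let hBZm i := @bndm_cycm C i.

Lemma hlen_cone_exp i : (hlen (cone (a ^+ n) C) i <= n%:R%:E * hlen (cone a C) i)%E.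
Proof.
rewrite !hlen_cone ge0_muleDr //.
by apply: leeD; [exact: len_mulS_exp | exact: len_annS_exp].
Qed.
Lemma hlen0_cone : hlen (cone a C) 0 = len F (mulS (bnd C 0) (cyc C 0) a) (cyc C 0).
Proof.
by rewrite hlen_cone [X in (_ + X)%E]len_eq0 ?adde0 // => z [].
Qed.
(** This is [len_mulS_lower] for H_0(C): its cokernel term is H_0 of the cone, and the annihilator
    of a in H_0(C) is a quotient of H_1 of the cone. *)
Lemma hlen_cone_lower :
  (n%:R%:E * hlen (cone a C) 0 <=
   hlen (cone (a ^+ n) C) 0 + n%:R%:E * hlen (cone a C) 1)%E.
Proof.
rewrite hlen0_cone; apply: le_trans (len_mulS_lower F (hB 0) (hZ 0) (@hBZ 0) a n) _.
apply: leeD; first by rewrite hlen_cone leeDl.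
by apply: lee_pmul => //; rewrite hlen_cone /= leeDr.
Qed.
End Powers.

End KoszulLength.
Arguments hlen F {R} C i.

Lemma hlen_ge0 (F : realType) (R : comNzRingType) (C : dgm R) i : (0 <= hlen F C i)%E.
Proof. exact: len_ge0. Qed.
#[global] Hint Extern 0 (is_true (_ <= hlen _ _ _)%E) => exact: hlen_ge0 : core.

(** * Null-homotopies, permutations and powers of the Koszul sequence *)

Section Homotopies.
Variables (F : realType) (R : comNzRingType).
Implicit Types (C D E : dgm R) (M : lmodType R).

Definition null_homotopic (b : R) C := exists s : {linear car C -> car C},
  (forall i u, gr i u -> gr i.+1 (s u)) /\ forall u, dif (s u) + s (dif u) = b *: u.

Lemma null_homotopic_bnd b C i z : null_homotopic b C -> cyc C i z -> bnd C i (b *: z).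
Proof.
move=> [s [sg sd]] [gz dz]; exists (s z); split; first exact: sg.
by rewrite -sd dz linear0 addr0.
Qed.

Lemma null_homotopic0 C : null_homotopic 0 C.
Proof.
have lin0 : linear (fun _ : car C => 0 : car C) by move=> a u v; rewrite scaler0 addr0.
exists (mkLin lin0); split=> [i u _|u] /=; first exact: submod0 (gr_sub _ _).
by rewrite linear0 addr0 scale0r.
Qed.

Lemma null_homotopicD a b c C :
  null_homotopic b C -> null_homotopic c C -> null_homotopic (a * b + c) C.
Proof.
move=> [s [sg sd]] [t [tg td]].
have lin : linear (fun u => a *: s u + t u).
  move=> k u v /=; rewrite (linearP s) (linearP t) !scalerDr !scalerA addrACA.
  by rewrite [a * k]mulrC -!scalerA.
exists (mkLin lin); split=> [i u gu|u] /=.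
  by apply: submodD; [exact: gr_sub | apply: submodZ; [exact: gr_sub|exact: sg] | exact: tg].
by rewrite linearP addrACA td -scalerDr sd scalerDl scalerA.
Qed.

(** The homotopy acts with the opposite sign on the shifted copy, to match the sign of the
    differential there. *)
Lemma null_homotopic_cone a b C : null_homotopic b C -> null_homotopic b (cone a C).
Proof.
move=> [s [sg sd]].
have lin : linear (fun u : car C * car C => (s u.1, - s u.2)).
  move=> k [u1 u2] [v1 v2].
  rewrite -[RHS]/(k *: s u1 + s v1, k *: (- s u2) - s v2) /=.
  by congr (_, _); rewrite linearP // opprD scalerN.
exists (mkLin lin); split=> [i [u v] [/= gu gv]|[u v]].
  split=> /=; first exact: sg.
  apply: submodN; first exact: gr_sub.
  by case: i gv {gu} => [->|i gv]; [rewrite linear0; exact: submod0 (gr_sub _ _)|exact: sg].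
have E1 : dif (s u) + a *: (- s v) + s (dif u + a *: v) = b *: u.
  by rewrite linearD linearZ /= -sd scalerN addrACA addNr addr0.
have E2 : - dif (- s v) + - s (- dif v) = b *: v by rewrite !linearN !opprK sd.
by rewrite /= /cone_dif /= -[RHS]/(b *: u, b *: v) -E1 -E2.
Qed.

(** The homotopy moves the first copy of C into the shifted one. *)
Lemma null_homotopic_coneS a C : null_homotopic a (cone a C).
Proof.
have lin : linear (fun u : car C * car C => (0 : car C, u.1)).
  move=> k [u1 u2] [v1 v2].
  by rewrite -[RHS]/(k *: 0 + 0, k *: u1 + v1) /= scaler0 addr0.
exists (mkLin lin); split=> [i [u v] [/= gu gv]|[u v]].
  by split=> //=; exact: submod0 (gr_sub _ _).
rewrite /= /cone_dif /=.
rewrite -[LHS]/(dif 0 + a *: u + 0, - dif u + (dif u + a *: v)).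
by rewrite linear0 add0r addr0 addKr.
Qed.

Lemma kos_null_homotopic (x : seq R) M b :
  gen (x : seq R^o) b -> null_homotopic b (kos x M).
Proof.
elim: x b => [b ->|a x IH b]; first exact: null_homotopic0.
move=> [_ [c [[k ->] /IH hc ->]]]; apply: null_homotopicD.
  exact: null_homotopic_coneS.
exact: null_homotopic_cone.
Qed.

(** Here a kills H_i(C), so the kernel of a in the long exact sequence is all of H_i(C). *)
Lemma hlen_le_cone a C i : null_homotopic a C -> (hlen F C i <= hlen F (cone a C) i.+1)%E.
Proof.
move=> ha; rewrite hlen_cone /=; apply: le_trans (leeDr _ _) => //.
by apply: len_mono => // z zc; split=> //; exact: null_homotopic_bnd.
Qed.

Lemma hlen_cone_le a C i : (hlen F (cone a C) i.+1 <= hlen F C i.+1 + hlen F C i)%E.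
Proof.
rewrite hlen_cone /=; apply: leeD; apply: len_mono => //.
  by apply: mulS_B; exact: is_submod_cyc.
by move=> z [].
Qed.

Definition diso C D := exists (f : {linear car C -> car D}) (g : {linear car D -> car C}),
  [/\ cancel f g, cancel g f, forall u, f (dif u) = dif (f u),
      forall i u, gr i u -> gr i (f u) & forall i u, gr i u -> gr i (g u)].

Lemma diso_refl C : diso C C.
Proof. by exists idfun, idfun; split. Qed.
Lemma diso_sym C D : diso C D -> diso D C.
Proof.
move=> [f [g [fK gK fd fg gg]]]; exists g, f; split=> // u.
by apply: (can_inj fK); rewrite fd !gK.
Qed.
Lemma diso_trans C D E : diso C D -> diso D E -> diso C E.
Proof.
move=> [f [g [fK gK fd fg gg]]] [f' [g' [fK' gK' fd' fg' gg']]].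
exists (f' \o f), (g \o g'); split=> [u|u|u|i u gu|i u gu] /=.
- by rewrite fK' fK.
- by rewrite gK gK'.
- by rewrite fd fd'.
- by apply/fg'/fg.
- by apply/gg/gg'.
Qed.

Lemma diso_hlen_le C D i : diso C D -> (hlen F C i <= hlen F D i)%E.
Proof.
move=> [f [g [fK gK fd fg gg]]]; apply: (len_inj (f := f)).
- exact: is_submod_bnd.
- exact: is_submod_cyc.
- exact: bnd_cyc.
- by move=> u [gu du]; split; [exact: fg | rewrite -fd du linear0].
- move=> u [gu du] [v [gv E]]; exists (g v); split; first exact: gg.
  by apply: (can_inj fK); rewrite fd gK E.
Qed.
Lemma diso_hlen C D i : diso C D -> hlen F C i = hlen F D i.
Proof.
by move=> h; apply/eqP; rewrite eq_le !diso_hlen_le //; exact: diso_sym.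
Qed.

Fact pair_map_linear M M' (f : {linear M -> M'}) :
  linear (fun u : M * M => (f u.1, f u.2)).
Proof.
move=> k [u1 u2] [v1 v2].
by rewrite -[RHS]/(k *: f u1 + f v1, k *: f u2 + f v2) /= !linearP.
Qed.

Lemma diso_cone a C D : diso C D -> diso (cone a C) (cone a D).
Proof.
move=> [f [g [fK gK fd fg gg]]].
exists (mkLin (pair_map_linear f)), (mkLin (pair_map_linear g)).
split=> [[u v]|[u v]|[u v]|i [u v] [/= gu gv]|i [u v] [/= gu gv]] /=.
- by rewrite !fK.
- by rewrite !gK.
- by rewrite /cone_dif /= linearD linearZ linearN /= !fd.
- split=> /=; first exact: fg.
  by case: i gv {gu} => [->|i gv] /=; [rewrite linear0 | exact: fg].
- split=> /=; first exact: gg.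
  by case: i gv {gu} => [->|i gv] /=; [rewrite linear0 | exact: gg].
Qed.

(** The coordinate in both shifted copies changes sign, as the product of the two Koszul generators
    does when they are exchanged. *)
Lemma diso_swap a b C : diso (cone a (cone b C)) (cone b (cone a C)).
Proof.
pose sw (u : (car C * car C) * (car C * car C)) := ((u.1.1, u.2.1), (u.1.2, - u.2.2)).
have lin : linear sw.
  move=> k [[u1 u2] [u3 u4]] [[v1 v2] [v3 v4]].
  rewrite -[RHS]/((k *: u1 + v1, k *: u3 + v3), (k *: u2 + v2, k *: (- u4) - v4)).
  by rewrite /sw /= opprD scalerN.
have swK : cancel sw sw by move=> [[u1 u2] [u3 u4]]; rewrite /sw /= opprK.
have swg c d i u : gr (d := cone c (cone d C)) i u -> gr (d := cone d (cone c C)) i (sw u).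
  move: u => [[u1 u2] [u3 u4]].
  case: i => [|[|i]] [[/= g1 g2]].
  - by case=> -> ->; split=> /=; [split | rewrite g2 oppr0].
  - by move=> [/= g3 g4]; split; split=> //=; rewrite g4 oppr0.
  - move=> [/= g3 g4]; split; split=> //=.
    by apply: submodN => //; exact: gr_sub.
exists (mkLin lin), (mkLin lin); split=> //; last 2 first.
- exact: swg.
- exact: swg.
move=> [[u1 u2] [u3 u4]]; rewrite /= /sw /cone_dif /=.
rewrite -[X in _ = X]/((dif u1 + a *: u3 + b *: u2, - dif u3 + b *: - u4),
   (- (dif u2 + a *: - u4), - - dif (- u4))).
congr ((_, _), (_, _)).
- by rewrite addrAC.
- by rewrite opprD scalerN.
- by rewrite opprD scalerN opprK.
- by rewrite (linearN (dif (d := C))) !opprK.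
Qed.

Lemma diso_kos_perm (x y : seq R) M : perm_eq x y -> diso (kos x M) (kos y M).
Proof.
have mv a s t : diso (kos (a :: s ++ t) M) (kos (s ++ a :: t) M).
  elim: s => [|b s IH]; first exact: diso_refl.
  exact: diso_trans (diso_swap _ _ _) (diso_cone _ IH).
move=> xy; apply: (@catCA_perm_ind _ (fun y => diso (kos x M) (kos y M))) xy _; last first.
  exact: diso_refl.
move=> s1 s2 s3 h; apply: diso_trans h _.
elim: s1 => [|a s1 IH]; first exact: diso_refl.
by apply: diso_trans (mv a s2 (s1 ++ s3)); exact: diso_cone.
Qed.

Lemma hlen_kos_perm (x y : seq R) M i :
  perm_eq x y -> hlen F (kos x M) i = hlen F (kos y M) i.
Proof. by move=> /(diso_kos_perm M); exact: diso_hlen. Qed.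

Definition expseq n (u : seq R) := [seq a ^+ n | a <- u].

(** Each entry of u is permuted to the outermost cone and raised to its power there, at the cost of
    a factor n. *)
Lemma hlen_kos_exp n (u w : seq R) M i :
  (hlen F (kos (expseq n u ++ w) M) i <=
   (n ^ size u)%:R%:E * hlen F (kos (u ++ w) M) i)%E.
Proof.
elim: u w => [|a u IH] w; first by rewrite expn0 mul1e.
have E b s : perm_eq (b :: (s ++ w)) (s ++ b :: w) by rewrite -cat1s perm_catCA.
rewrite [expseq _ _ ++ _]/= (hlen_kos_perm _ _ (E (a ^+ n) _)).
apply: le_trans (IH _) _; rewrite -(hlen_kos_perm _ _ (E (a ^+ n) _)).
rewrite [size _]/= [_ ++ _]/= -/(kos _ M).
rewrite expnSr natrM EFinM -muleA; apply: lee_pmul => //.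
exact: (hlen_cone_exp F a (kos (u ++ w) M)).
Qed.

(** [hlen_cone_lower] is applied to one entry at a time. Every entry adds one error term in H_1, and
    the entries already replaced by powers enlarge that term by [hlen_cone_exp]. *)
Lemma hlen_kos_lower n (u w : seq R) M :
  ((n ^ size u)%:R%:E * hlen F (kos (u ++ w) M) 0 <=
   hlen F (kos (expseq n u ++ w) M) 0 +
   (size u * n ^ size u)%:R%:E * hlen F (kos (u ++ w) M) 1)%E.
Proof.
elim: u w => [|a u IH] w; first by rewrite expn0 mul1e mul0n mul0e adde0.
have E b s : perm_eq (b :: (s ++ w)) (s ++ b :: w) by rewrite -cat1s perm_catCA.
rewrite [expseq _ _ ++ _]/=.
rewrite (hlen_kos_perm _ _ (E (a ^+ n) _)).
have h0 := hlen_cone_lower F a (kos (u ++ w) M) n.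
have h1 := hlen_cone_exp F a (kos (u ++ w) M) n 1.
have := IH (a ^+ n :: w); rewrite -!(hlen_kos_perm _ _ (E (a ^+ n) _)) => h2.
(* The H_1 in the induction hypothesis involves a^n; trading it for a raises the power of n in the
   error by one. *)
have h3 : ((n ^ size u)%:R%:E * hlen F (kos ((a ^+ n)%R :: u ++ w) M) 0 <=
  hlen F (kos ((a ^+ n)%R :: expseq n u ++ w) M) 0 +
  (size u * n ^ (size u).+1)%:R%:E * hlen F (kos (a :: u ++ w) M) 1)%E.
  apply: le_trans h2 _; apply: leeD => //.
  by rewrite expnSr mulnA [(_ * n)%:R]natrM EFinM -muleA; apply: lee_pmul.
rewrite [size _]/= [_ ++ _]/= {1}expnSr natrM EFinM -muleA.
apply: (@le_trans _ _ ((n ^ size u)%:R%:E * (hlen F (kos ((a ^+ n)%R :: u ++ w) M) 0 +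
   n%:R%:E * hlen F (kos (a :: u ++ w) M) 1))%E).
  by apply: lee_pmul => //; rewrite mule_ge0.
rewrite ge0_muleDr ?mule_ge0 // muleA -EFinM -natrM -expnSr.
apply: le_trans (leeD h3 (le_refl _)) _.
by rewrite -addeA -ge0_muleDl // -EFinD -natrD mulSn addnC.
Qed.

(** The submodule (x)M. *)
Fixpoint mulseq M (x : seq R) : set M :=
  if x is a :: x' then [set u | exists v w, mulseq x' w /\ u = a *: v + w] else [set 0].
Arguments mulseq : clear implicits.

Lemma is_submod_mulseq M x : is_submod (mulseq M x).
Proof.
elim: x => [|a x IH]; first exact: is_submod0.
split=> [|c _ _ [u [v [xv ->]]] [u' [v' [xv' ->]]]].
  by exists 0, 0; rewrite scaler0 addr0; split=> //; exact: submod0.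
exists (c *: u + u'), (c *: v + v'); split; first by case: IH => _; apply.
by rewrite !scalerDr addrACA !scalerA [a * c]mulrC.
Qed.
Lemma mulseq_mem M (x : seq R) a (u : M) : a \in x -> mulseq M x (a *: u).
Proof.
elim: x => // b x IH; rewrite inE => /predU1P[->|/IH h].
  by exists u, 0; rewrite addr0; split=> //; exact: submod0 (is_submod_mulseq _ _).
by exists 0, (a *: u); rewrite scaler0 add0r.
Qed.
Lemma mulseq_min M (x : seq R) P : is_submod P ->
  (forall a u, a \in x -> P (a *: u)) -> mulseq M x `<=` P.
Proof.
move=> hP; elim: x => [_ _ ->|a x IH h _ [u [v [xv ->]]]]; first exact: submod0.
apply: submodD => //; first by apply: h; rewrite mem_head.
by apply: IH => // b w bx; apply: h; rewrite inE bx orbT.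
Qed.

(** Degree 0 of the iterated cone is a copy of M, the innermost first coordinate, and its boundaries
    are (x)M. The retraction g is defined on the whole complex so that it can be composed with other
    linear maps. *)
Lemma kos0 (x : seq R) M : exists (f : {linear M -> car (kos x M)})
    (g : {linear car (kos x M) -> M}),
  [/\ cancel f g, forall u, gr 0 u <-> exists v, u = f v &
      forall v, bnd (kos x M) 0 (f v) <-> mulseq M x v].
Proof.
elim: x => [|a x [f [g [fI fg fb]]]].
  exists idfun, idfun; split=> // [u|v]; first by split=> // _; exists u.
  split=> [[w [_ h]]|->]; [exact: h|exists 0]; split=> //; exact: submod0 (gr_sub (base M) 1).
exists (mkLin (@inl_linear R (car (kos x M))) \o f).
exists (g \o mkLin (@fst_linear R (car (kos x M)))); split=> /=.
- by move=> u /=; rewrite fI.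
- move=> [u v]; split=> /= [[/= /fg[w ->] ->]|[w [-> ->]]]; first by exists w.
  by split=> //=; apply/fg; exists w.
- move=> v; split.
    move=> [[p q] [[/= gp /fg[w Eq]]]] [E _].
    have /fb h : bnd (kos x M) 0 (f (v - a *: w)).
      by exists p; split=> //; rewrite linearB linearZ /= E Eq addrK.
    by exists w, (v - a *: w); split=> //; rewrite addrC subrK.
  move=> [w [w' [/fb[p [gp E]] ->]]]; exists (p, f w); split.
    by split=> //=; apply/fg; exists w.
  rewrite /= /cone_dif /= linearD linearZ /= E addrC.
  have -> : dif (f w) = 0 by apply: dif_gr0; apply/fg; exists w.
  by rewrite oppr0.
Qed.

Lemma hlen0 (x : seq R) M : hlen F (kos x M) 0 = len F (mulseq M x) [set: M].
Proof.
have [f [g [fI fg fb]]] := kos0 x M.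
have fc u : cyc (kos x M) 0 (f u).
  have g0 : gr (d := kos x M) 0 (f u) by apply/fg; exists u.
  by split=> //; exact: dif_gr0.
apply/eqP; rewrite eq_le; apply/andP; split.
  apply: (len_surj (f := f)) => // [u /fb //|v [/fg[u ->] _]].
  by exists u; rewrite subrr; split=> //; exact: submod0 (is_submod_bnd _ _).
apply: (len_inj (f := f)) => //.
- exact: is_submod_bnd.
- exact: is_submod_cyc.
- exact: bnd_cyc.
- by move=> u _ /fb.
Qed.

End Homotopies.
Arguments mulseq {R} M x.

(** * Noetherian modules *)

Section Noetherian.
Variables (R : comNzRingType).
Implicit Types (M : lmodType R).

Definition noeth_mod M := forall N : set M, is_submod N -> exists s, N = gen s.

Lemma noeth_ring : noetherian R -> noeth_mod R^o.
Proof.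
move=> hR N hN; have [x hx] := hR (mkSub hN); exists x.
apply/seteqP; split=> u.
  by move=> Nu; apply/span_gen; rewrite -[_ \in _]hx; apply/mkSubE.
by move=> /span_gen; rewrite -[_ \in _]hx => /mkSubE.
Qed.

Lemma gen_cat M (s t : seq M) : gen s `<=` gen (s ++ t) /\ gen t `<=` gen (s ++ t).
Proof.
split; apply: gen_min; try exact: is_submod_gen.
  by move=> v vs; apply: gen_mem; rewrite mem_cat vs.
by move=> v vs; apply: gen_mem; rewrite mem_cat vs orbT.
Qed.

(** Induction on the generators: with v the first one, N is generated by its part in the span of the
    others and by lifts of generators of the ideal I of coefficients of v in N. *)
Lemma noeth_gen M (s : seq M) : noeth_mod R^o -> (forall u, gen s u) -> noeth_mod M.
Proof.
move=> hR sT N hN.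
have {sT} : N `<=` gen s by move=> u _.
elim: s N hN => [|v s IH] N hN Ns.
  exists [::]; apply/seteqP; split=> // u ->; exact: submod0.
have [t' Et'] := IH (N `&` gen s) (is_submodI hN (is_submod_gen s)) (fun u h => h.2).
pose I : set R^o := [set a | exists w, gen s w /\ N (a *: v + w)].
have hI : is_submod I.
  split=> [|a b c [w [sw Nw]] [w' [sw' Nw']]].
    by exists 0; rewrite scale0r addr0; split; [exact: submod0 (is_submod_gen _)|exact: submod0].
  exists (a *: w + w'); split; first by apply: (is_submod_gen s).2.
  rewrite scalerDl -scalerA addrACA -scalerDr; exact: hN.2.
have [as_ Eas] := hR I hI.
have [ts [tsN tsI]] : exists ts : seq M, (forall t, t \in ts -> N t) /\
    forall a, gen as_ a -> exists w t, [/\ gen s w, gen ts t & t = (a : R) *: v + w].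
  have {Eas} : gen as_ `<=` I by rewrite -Eas.
  elim: as_ => [_|a l IHl h].
    exists [::]; split=> // _ ->; exists 0, 0; rewrite scale0r addr0; split=> //.
    exact: submod0 (is_submod_gen _).
  have hl : gen l `<=` gen (a :: l).
    by move=> b lb; apply: addSr => //; exact: is_submod_line.
  have [ts [tsN tsI]] := IHl (subset_trans hl h).
  have [w [sw Nw]] : I a by apply: h; apply: gen_mem; rewrite mem_head.
  exists ((a : R) *: v + w :: ts); split=> [t|_ [_ [b [[k ->] /tsI[w' [t [sw' tt Et]]] ->]]]].
    by rewrite inE => /predU1P[->|/tsN].
  exists (k *: w + w'), (k *: ((a : R) *: v + w) + t); split.
  - exact: (is_submod_gen s).2.
  - by exists (k *: ((a : R) *: v + w)), t; split=> //; exists k.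
  - by rewrite Et scalerDr scalerA addrACA -scalerDl.
have [g1 g2] := gen_cat ts t'.
exists (ts ++ t'); apply/seteqP; split=> [u Nu|]; last first.
  apply: gen_min => // t; rewrite mem_cat => /orP[/tsN //|tt'].
  by have [] : (N `&` gen s) t by rewrite Et'; exact: gen_mem.
have [_ [w [[a ->] sw Eu]]] := Ns u Nu.
have Ia : I a by exists w; rewrite -Eu.
rewrite Eas in Ia; have [w' [t [sw' tst Et]]] := tsI a Ia.
have Nt : N t by apply: (gen_min hN tsN).
rewrite -(subrK t u); apply: submodD; [exact: is_submod_gen | apply: g2 | exact: g1].
rewrite -Et'; split; first exact: submodB.
rewrite Eu Et opprD addrACA subrr add0r.
by apply: submodB => //; exact: is_submod_gen.
Qed.

Lemma noeth_fin_gen M : noeth_mod R^o -> fin_gen M -> noeth_mod M.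
Proof.
by move=> hR [s hs]; apply: (@noeth_gen M s hR) => u; apply/span_gen; exact: hs.
Qed.

(** A counterexample starts, by dependent choice, a strictly increasing sequence of counterexamples.
    Its union is finitely generated, hence contained in one of the terms. *)
Lemma noeth_ind M (Q : set M -> Prop) : noeth_mod M ->
  (forall N, is_submod N ->
     (forall N', is_submod N' -> N `<=` N' -> ~ N' `<=` N -> Q N') -> Q N) ->
  forall N, is_submod N -> Q N.
Proof.
move=> hM step N0 hN0; apply: contrapT => nQ0.
pose X := {N : set M | is_submod N /\ ~ Q N}.
pose bigger (x y : X) := proj1_sig x `<=` proj1_sig y /\ ~ proj1_sig y `<=` proj1_sig x.
have ex x : exists y, bigger x y.
  case: x => N [hN nQ]; apply: contrapT => h; apply: (nQ); apply: step => // N' hN' NN' N'N.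
  by apply: contrapT => nQ'; apply: h; exists (exist _ N' (conj hN' nQ')).
have [f [_ fS]] := dependent_choice (fun x => cid (ex x)) (exist _ N0 (conj hN0 nQ0)).
have fle i j : (i <= j)%N -> proj1_sig (f i) `<=` proj1_sig (f j).
  move=> /subnK <-; elim: (j - i)%N => [|k IH] //.
  by apply: subset_trans IH _; case: (fS (k + i)%N).
pose U : set M := [set u | exists i, proj1_sig (f i) u].
have hf i : is_submod (proj1_sig (f i)) by case: (proj2_sig (f i)).
have hU : is_submod U.
  split=> [|a u v [i fu] [j fv]]; first by exists 0%N; exact: submod0.
  exists (maxn i j); apply: (hf _).2.
    by apply: fle fu; exact: leq_maxl.
  by apply: fle fv; exact: leq_maxr.
have [s Es] := hM U hU.
have [k sk] : exists k, forall v, v \in s -> proj1_sig (f k) v.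
  have : forall v, v \in s -> U v by move=> v vs; rewrite Es; exact: gen_mem.
  elim: (s) => [|v t IH] h; first by exists 0%N.
  have [k hk] : exists k, forall v, v \in t -> proj1_sig (f k) v.
    by apply: IH => w wt; apply: h; rewrite inE wt orbT.
  have [i fi] : U v by apply: h; rewrite mem_head.
  exists (maxn i k) => w; rewrite inE => /predU1P[->|/hk].
    by apply: fle fi; exact: leq_maxl.
  by apply: fle; exact: leq_maxr.
have [_] := fS k; apply => u fu.
have : U u by exists k.+1.
by rewrite Es; apply: gen_min.
Qed.

Lemma noeth_max M (Q : set M -> Prop) N0 : noeth_mod M -> is_submod N0 -> Q N0 ->
  exists N, [/\ is_submod N, Q N &
    forall N', is_submod N' -> Q N' -> N `<=` N' -> N' `<=` N].
Proof.
move=> hM hN0 Q0; apply: contrapT => h.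
suff : forall N, is_submod N -> ~ Q N by move=> /(_ N0 hN0).
apply: (noeth_ind hM) => N hN IH QN; apply: h; exists N; split=> // N' hN' QN' NN'.
by apply: contrapT => N'N; apply: (IH N').
Qed.

End Noetherian.

(** * Calculus of the little-o relation *)

Section LittleO.
Variables (F : realType).
Implicit Types (l : nat -> \bar F) (a : nat -> F).

Lemma little_o_le l l' a : (forall n, (l n <= l' n)%E) -> little_o l' a -> little_o l a.
Proof.
move=> ll h e e0; near=> n; apply: le_trans (ll n) _.
by near: n; exact: h.
Unshelve. all: by end_near. Qed.

Lemma little_oD l l' a : little_o l a -> little_o l' a ->
  little_o (fun n => (l n + l' n)%E) a.
Proof.
move=> h h' e e0; have e2 : 0 < e / 2 by rewrite divr_gt0.
near=> n; have -> : e * a n = e / 2 * a n + e / 2 * a n by lra.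
by rewrite EFinD; apply: leeD; near: n; [exact: h | exact: h'].
Unshelve. all: by end_near. Qed.

Lemma little_oM (k : nat) l a : little_o l a -> (forall n, (0 <= l n)%E) ->
  little_o (fun n => (k%:R%:E * l n)%E) a.
Proof.
(* Dividing by k + 1 instead of k covers k = 0. *)
move=> h l0 e e0; have ek : 0 < e / k.+1%:R by rewrite divr_gt0.
near=> n; have ln : (l n <= (e / k.+1%:R * a n)%:E)%E by near: n; exact: h.
apply: (@le_trans _ _ (k.+1%:R%:E * l n)%E).
  by apply: lee_pmul => //; rewrite lee_fin ler_nat.
have -> : e * a n = k.+1%:R * (e / k.+1%:R * a n) by rewrite mulrA mulrCA divff ?mulr1.
by rewrite EFinM; apply: lee_pmul.
Unshelve. all: by end_near. Qed.

Lemma little_o_scale l a b (c : F) : 0 < c ->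
  (\forall n \near \oo, a n <= c * b n) -> little_o l a -> little_o l b.
Proof.
move=> c0 ab h e e0; have ec : 0 < e / c by rewrite divr_gt0.
near=> n; apply: (@le_trans _ _ (e / c * a n)%:E); first by near: n; exact: h.
rewrite lee_fin; have -> : e * b n = e / c * (c * b n) by field; exact: lt0r_neq0.
rewrite ler_pM2l //; near: n; exact: ab.
Unshelve. all: by end_near. Qed.

End LittleO.

(** * Koszul complexes with coefficients as tensor products *)

Section KoszulTensor.
Variables (F : realType) (R : comNzRingType).

(** The image of n tensor z under the identification of N tensor K(x; R) with K(x; N). *)
Fixpoint act (x : seq R) (N : lmodType R) (n : N) {struct x} :
    car (kos x R^o) -> car (kos x N) :=
  match x return car (kos x R^o) -> car (kos x N) with
  | [::] => fun r => (r : R) *: n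
  | a :: x' => fun u => (act n u.1, act n u.2)
  end.

Variable N : lmodType R.
Implicit Types (x : seq R) (n : N).

Lemma act_linearl x z : linear (fun n => act n z : car (kos x N)).
Proof.
elim: x z => [|a x IH] /= z k u v; first by rewrite scalerDr !scalerA mulrC.
rewrite -[RHS]/(k *: act u z.1 + act v z.1, k *: act u z.2 + act v z.2).
by congr (_, _); exact: IH.
Qed.
Lemma act_linearr x n : linear (@act x N n).
Proof.
elim: x => [|a x IH] /= k u v; first by rewrite scalerDl scalerA.
rewrite -[RHS]/(k *: act n u.1 + act n v.1, k *: act n u.2 + act n v.2).
by congr (_, _); exact: IH.
Qed.
Lemma act_dif x n z : dif (act n z) = act n (dif z) :> car (kos x N).
Proof.
elim: x z => [|a x IH] z; first by rewrite /= scale0r.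
have L := @act_linearr x n.
rewrite /= /cone_dif /= !IH; congr (_, _).
  by rewrite [in RHS]addrC L addrC.
by rewrite -[LHS](linearN (mkLin L)).
Qed.
Lemma act0 x n : act n 0 = 0 :> car (kos x N).
Proof. exact: (linear0 (mkLin (@act_linearr x n))). Qed.
Lemma act_gr x n i z : gr i z -> gr i (act n z : car (kos x N)).
Proof.
elim: x i z => [|a x IH] i z; first by case: i => [|i] //= ->; rewrite scale0r.
move=> [/= g1 g2]; split=> /=; first exact: IH.
by case: i g2 {g1} => [->|i /IH] //=; rewrite act0.
Qed.

Lemma gr_act_gen x i W : gr (d := kos x N) i W ->
  exists s : seq (N * car (kos x R^o)), (forall p, List.In p s -> gr i p.2) /\
    W = \sum_(p <- s) act p.1 p.2.
Proof.
elim: x i W => [|a x IH] i W.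
  case: i => [|i] gW.
    exists [:: (W, 1)]; split=> [p [<-|[]] //|].
    by rewrite big_seq1 /= scale1r.
  by exists [::]; split=> //; rewrite big_nil.
case: W => U V [/= /IH[s [sg ->]] gV].
have [t [tg ->]] : exists t : seq (N * car (kos x R^o)),
    (forall p, List.In p t -> grm (kos x R^o) i p.2) /\ V = \sum_(p <- t) act p.1 p.2.
  case: i gV {sg} => [->|i /IH //].
  by exists [::]; split=> //; rewrite big_nil.
exists ([seq (p.1, (p.2, 0)) | p <- s] ++ [seq (p.1, (0, p.2)) | p <- t]); split.
  move=> p /List.in_app_iff[] /List.in_map_iff[q [<- /= hq]]; split=> /=.
  - exact: sg.
  - exact: submod0 (is_submod_grm _ _).
  - exact: submod0 (gr_sub _ _).
  - exact: tg.
rewrite big_cat !big_map /=.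
have E1 : \sum_(p <- s) ((act p.1 p.2, act p.1 0) : car (kos x N) * car (kos x N)) =
    (\sum_(p <- s) act p.1 p.2, 0).
  elim: (s) => [|p l IHl]; first by rewrite !big_nil.
  by rewrite !big_cons IHl act0 -[LHS]/(_ + _, 0 + 0) addr0.
have E2 : \sum_(p <- t) ((act p.1 0, act p.1 p.2) : car (kos x N) * car (kos x N)) =
    (0, \sum_(p <- t) act p.1 p.2).
  elim: (t) => [|p l IHl]; first by rewrite !big_nil.
  by rewrite !big_cons IHl act0 -[LHS]/(0 + 0, _ + _) addr0.
by rewrite E1 E2 -[RHS]/(_ + 0, 0 + _) addr0 add0r.
Qed.

(** [Th] is the map N tensor [th], read on K(x; N); since it is a well-defined linear map, relations
    between elements [act n z] pass to tensors. *)
Lemma kos_tensor x (Q : lmodType R) (th : {linear car (kos x R^o) -> Q}) :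
  exists Th : {linear car (kos x N) -> tensor N Q},
    forall n z, Th (act n z) = tens n (th z).
Proof.
elim: x th => [|a x IH] th.
  have lin : linear (fun n : N => tens n (th (1 : R^o))).
    by move=> k u v; rewrite tensDl tensZl.
  exists (mkLin lin) => n z /=.
  rewrite tensZl -tensZr -linearZ; congr (tens n (th _)).
  by rewrite /GRing.scale /= mulr1.
have l1 : linear (fun u : car (kos x R^o) => th (u, 0)).
  by move=> k u v; rewrite -linearP; congr (th _); exact: (@inl_linear R (car (kos x R^o))).
have l2 : linear (fun u : car (kos x R^o) => th (0, u)).
  by move=> k u v; rewrite -linearP; congr (th _); exact: (@inr_linear R (car (kos x R^o))).
have [T1 h1] := IH (mkLin l1); have [T2 h2] := IH (mkLin l2).
have lin : linear (fun u : car (kos (a :: x) N) => T1 u.1 + T2 u.2).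
  by move=> k u v /=; rewrite (linearP T1) (linearP T2) scalerDr addrACA.
exists (mkLin lin) => n [z1 z2] /=.
rewrite h1 h2 /= -tensDr -linearD; congr (tens n (th _)).
by rewrite -[LHS]/(z1 + 0, 0 + z2) addr0 add0r.
Qed.

(* [n |-> n z] embeds the orbit of [theta z], modulo a quotient, in the Koszul
   homology of [N]. *)
Lemma len_tens_cycle x (Q : lmodType R) (th : {linear car (kos x R^o) -> Q}) i z :
  cyc (kos x R^o) i z -> (forall v, gr i.+1 v -> th (dif v) = 0) ->
  (len F [set 0%R] [set t : tensor N Q | exists n, t = tens n (th z)] <=
   hlen F (kos x N) i)%E.
Proof.
move=> [gz dz] thb.
have lin : linear (fun n => tens n (th z)) by move=> k u v; rewrite tensDl tensZl.
apply: (@le_trans _ _ (len F [set n | tens n (th z) = 0%R] [set: N])).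
  apply: (len_surj (f := mkLin lin)) => // t [n ->].
  by exists n; rewrite /= subrr.
apply: (len_inj (f := mkLin (@act_linearl x z))).
- exact: is_submod_bnd.
- exact: is_submod_cyc.
- exact: bnd_cyc.
- by move=> n _; split; [exact: act_gr | rewrite /= act_dif dz act0].
(* A boundary W in K(x; N) is a sum of terms n' d(z'), and [Th] sends each of them to n' tensor [th]
   (d z') = 0. *)
- move=> n _ [W [/gr_act_gen[s [sg ->]]]] /= E.
  have [Th hTh] := kos_tensor th.
  rewrite -hTh E !linear_sum.
  elim: s sg {E} => [|p s IHs] sg; first by rewrite big_nil.
  rewrite big_cons act_dif hTh thb; last by apply: sg; left.
  rewrite IHs; last by move=> q qs; apply: sg; right.
  by rewrite addr0 -(scale0r (0 : Q)) tensZr scale0r.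
Qed.

End KoszulTensor.

(** * A criterion for membership in the closure *)

Section Closure.
Variables (F : realType) (R : comNzRingType).
Implicit Types (N B : lmodType R).

(** The image of N tensor A'/A in N tensor B/A, spelled out so that it makes sense for any set A';
    see [lin_img_tensS]. *)
Definition tensS N B (A : submodClosed B) (A' : set B) : set (tensor N (quotmod A)) :=
  [set t | exists s : seq (N * B), {in s, forall p, A' p.2} /\
     t = \sum_(p <- s) tens p.1 (quotmod_pi A p.2)].
Arguments tensS N {B} A A'.

Lemma is_submod_tensS N B (A : submodClosed B) A' : is_submod (tensS N A A').
Proof.
split=> [|a _ _ [s [sA ->]] [s' [sA' ->]]].
  by exists [::]; split=> //; rewrite big_nil.
exists ([seq (a *: p.1, p.2) | p <- s] ++ s'); split.
  by move=> p; rewrite mem_cat => /orP[/mapP[q qs ->]|/sA' //]; exact: (sA q qs).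
rewrite big_cat big_map scaler_sumr; congr (_ + _).
by apply: eq_bigr => p _; rewrite tensZl.
Qed.

Lemma tensS_addS N B (A : submodClosed B) (A' A'' : set B) :
  tensS N A (addS A' A'') `<=` addS (tensS N A A') (tensS N A A'').
Proof.
move=> _ [s [sA ->]].
have hW := is_submod_addS (@is_submod_tensS N B A A') (@is_submod_tensS N B A A'').
rewrite big_seq; apply: submod_sum => // p /sA[u [v [Au Av ->]]].
rewrite linearD tensDr; apply: submodD => //.
  apply: addSl; first exact: is_submod_tensS.
  by exists [:: (p.1, u)]; rewrite big_seq1; split=> // q; rewrite inE => /eqP->.
apply: addSr; first exact: is_submod_tensS.
by exists [:: (p.1, v)]; rewrite big_seq1; split=> // q; rewrite inE => /eqP->.
Qed.

Lemma lin_img_tensS N B (A A' : submodClosed B) :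
  [set` lin_img (tensor_map (idfun : N -> N) (@subquot_incl R B A' A))] = tensS N A [set` A'].
Proof.
apply/seteqP; split=> t.
  move=> /asboolP[tau ->]; have [s ->] := tensorP tau.
  exists [seq (u.1 *: u.2.1, incl (repr u.2.2)) | u <- s]; split.
    by move=> p /mapP[u us ->] /=; exact: (valP (repr u.2.2)).
  rewrite linear_sum big_map; apply: eq_bigr => u _.
  by rewrite linearZ tensZl; congr (_ *: _); exact: tensor_mapE.
move=> [s [sA ->]]; rewrite big_seq.
apply: submod_sum; first exact: is_submod_pred.
move=> p ps; apply/asboolP; have pA : p.2 \in A' := sA p ps.
exists (tens p.1 (quotmod_pi _ (exist _ p.2 pA : submodule A'))).
apply/esym; apply: etrans (tensor_mapE _ _ _ _) _.
by congr (tens _ _); exact: subquot_incl_pi.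
Qed.

Variables (M : nat -> lmodType R) (alpha : nat -> F).

Definition adm B (A : submodClosed B) (A' : set B) := [set` A] `<=` A' /\
  little_o (fun n => len F [set 0] (tensS (M n) A A')) alpha.

Lemma closure_admE B (A A' : submodClosed B) :
  closure_adm M alpha A A' <-> adm A [set` A'].
Proof.
have E n : length F (tensor_image M n A A') = len F [set 0] (tensS (M n) A [set` A']).
  by rewrite /tensor_image length_submodule lin_img_tensS.
by split=> -[AA h]; split=> // e e0; near=> n; have := E n;
  [move=> <- | move=> ->]; near: n; exact: h.
Unshelve. all: by end_near. Qed.

Lemma adm_addS B (A : submodClosed B) A' A'' : is_submod A'' ->
  adm A A' -> adm A A'' -> adm A (addS A' A'').
Proof.
move=> hA'' [AA h'] [_ h'']; split; first by move=> u /AA Au; apply: addSl.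
apply: little_o_le (little_oD h' h'') => n.
pose W' := tensS (M n) A A'; pose W'' := tensS (M n) A A''.
have hW' : is_submod W' by exact: is_submod_tensS.
have hW'' : is_submod W'' by exact: is_submod_tensS.
have hW := is_submod_addS hW' hW''.
apply: (@le_trans _ _ (len F [set 0] (addS W' W''))).
  by apply: len_mono => //; exact: tensS_addS.
rewrite (@len_add F _ _ _ W') //; last 2 first.
- by move=> _ ->; exact: submod0.
- by move=> u W'u; exact: addSl.
apply: leeD => //; apply: (len_surj (f := idfun)) => //.
- by move=> _ -> _; exact: submod0.
- by move=> _ ->; exact: submod0.
- by move=> _ [u [v [Wu Wv ->]]]; exists v; rewrite addrK.
Qed.

(** A + Rz is admissible, and admissible submodules are stable under sums. Hence a maximal
    admissible submodule, which exists because B is Noetherian, is the largest one and contains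
    z. *)
Lemma mclosure_fl_intro B (A : submodClosed B) z : noeth_mod B ->
  little_o (fun n => len F [set 0]
    [set t | exists u : M n, t = tens u (quotmod_pi A z)]) alpha ->
  mclosure_fl M alpha A z.
Proof.
move=> hB hz.
have hAz : is_submod (addS [set` A] (line z)).
  by apply: is_submod_addS; [exact: is_submod_pred | exact: is_submod_line].
have admz : adm A (addS [set` A] (line z)).
  split; first by move=> u Au; apply: addSl => //; exact: is_submod_line.
  (* The class of a + c z in B/A is c z, so every tensor coming from A + Rz is a single u tensor
     z. *)
  apply: little_o_le hz => n; apply: len_mono => // _ [s [sA ->]].
  elim: s sA => [|p s IH] sA.
    by exists 0; rewrite big_nil -(scale0r (0 : M n)) tensZl scale0r.
  rewrite big_cons; have [q qs|u ->] := IH; first by apply: sA; rewrite inE qs orbT.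
  have [a [_ [Aa [c ->] ->]]] := sA p (mem_head _ _).
  exists (c *: p.1 + u); rewrite tensDl.
  have -> : quotmod_pi A (a + c *: z) = c *: quotmod_pi A z.
    by rewrite -linearZ; apply/quotmod_eqP; rewrite addrK.
  by rewrite tensZr tensZl.
have [A' [hA' admA' maxA']] := noeth_max hB hAz admz.
have EA' : [set` mkSub hA'] = A' by apply/seteqP; split=> u h; apply/(mkSubE hA').
have A'max A'' : is_submod A'' -> adm A A'' -> A'' `<=` A'.
  move=> hA'' admA'' u A''u; apply: (maxA' (addS A' A'')).
  - exact: is_submod_addS.
  - exact: adm_addS.
  - by move=> v A'v; exact: addSl.
  - exact: addSr.
exists (mkSub hA'); split.
- by apply/closure_admE; rewrite EA'.
- move=> A'' /closure_admE hA'' u uA''; apply/mkSubE.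
  by apply: (A'max _ (is_submod_pred A'') hA'').
- apply/mkSubE; apply: (A'max _ hAz admz); apply: addSr; last exact: line_gen.
  exact: is_submod_pred.
Qed.

End Closure.

(** * Comparison with the Koszul complex indexed by subsets *)

Section ConcreteKoszul.
Variables (R : comNzRingType) (N : lmodType R).

Definition tot (k : nat) : lmodType R := {ffun {set 'I_k} -> N}.

Definition ksgn (k : nat) (T : {set 'I_k}) (j : 'I_k) : R :=
  (-1) ^+ #|[set t in T | (t < j)%N]|.

(** The differential is organised by its target T: the sources are the sets T with one element j
    added. The sign may be counted in T, since j is not below itself. *)
Definition tot_d (x : seq R) (f : tot (size x)) : tot (size x) :=
  [ffun T : {set 'I_(size x)} => \sum_(j | j \notin T) (ksgn T j * x`_j) *: f (j |: T)].

Definition homog (k i : nat) (f : tot k) := forall S : {set 'I_k}, #|S| <> i -> f S = 0.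

Definition restr (k i : nat) (f : tot k) : koszul N k i :=
  [ffun S : koszul_index k i => f (val S)].
Definition ext (k i : nat) (f : koszul N k i) : tot k :=
  [ffun S : {set 'I_k} => oapp f 0 (insub S)].

Lemma restr_linear k i : linear (@restr k i).
Proof. by move=> a f g; apply/ffunP => S; rewrite !ffunE. Qed.
Lemma ext_homog k i f : homog i (@ext k i f).
Proof. by move=> S /eqP Si; rewrite ffunE insubN. Qed.
Lemma extK k i : cancel (@ext k i) (@restr k i).
Proof. by move=> f; apply/ffunP => S; rewrite !ffunE valK. Qed.
Lemma restrK k i f : homog i f -> @ext k i (restr i f) = f.
Proof.
move=> hf; apply/ffunP => S; rewrite !ffunE; case: insubP => [T _ <-|/eqP Si] /=.
  by rewrite ffunE.
by rewrite hf.
Qed.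
Lemma ext_linear k i : linear (@ext k i).
Proof.
move=> a f g; apply/ffunP => S; rewrite !ffunE.
by case: insubP => [T _ _|_] /=; rewrite ?ffunE // scaler0 addr0.
Qed.

Lemma koszul_d_restr (x : seq R) i (f : tot (size x)) :
  koszul_d (restr i.+1 f) = restr i (tot_d f).
Proof.
apply/ffunP => T; rewrite !ffunE /=.
pose G (S : {set 'I_(size x)}) j := ((-1) ^+ #|[set t in S | (t < j)%N]| * x`_j) *: f S.
transitivity (\sum_(S : koszul_index (size x) i.+1)
    \sum_(j | (j \in val S) && (val S :\ j == val T)) G (val S) j).
  by apply: eq_bigr => S _; apply: eq_bigr => j _; rewrite ffunE.
(* For fixed j, only S = T with j added contributes, and only if j is outside T. *)
rewrite (exchange_big_dep predT) //= [RHS]big_mkcond; apply: eq_bigr => j _.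
have [jT|jT] /= := boolP (j \in val T).
  rewrite big_pred0 // => S; apply/negbTE/negP => /andP[_ /eqP E].
  have : j \in val S :\ j by rewrite E.
  by rewrite setD11.
have cS : #|j |: val T| == i.+1 by rewrite cardsU1 jT (eqP (valP T)).
rewrite (big_pred1 (exist _ (j |: val T) cS : koszul_index _ _)) => [|S].
  rewrite /G /=; congr ((_ ^+ _ * _) *: _); apply: eq_card => t.
  by rewrite !inE; case: eqP => [->|] //=; rewrite ltnn andbF.
apply/andP/eqP => [[jS /eqP E]|->]; last by split; rewrite /= ?setU11 // setU1K.
have {}E : val S :\ j = val T := E.
by apply: val_inj; rewrite /= -E finset.setD1K.
Qed.

(* The subsets of [0, k] avoiding, resp. containing, 0 are indexed by those of [1, k]. *)
Definition lift0S (k : nat) (S : {set 'I_k}) : {set 'I_k.+1} := [set lift ord0 j | j in S].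
Definition lowS (k : nat) (S : {set 'I_k.+1}) : {set 'I_k} := [set j | lift ord0 j \in S].

Lemma mem_lift0S k (S : {set 'I_k}) j : (lift ord0 j \in lift0S S) = (j \in S).
Proof. by rewrite mem_imset //; exact: lift_inj. Qed.
Lemma ord0_lift0S k (S : {set 'I_k}) : (ord0 \in lift0S S) = false.
Proof. by apply/negP => /imsetP[j _ /eqP]; rewrite (negbTE (neq_lift _ _)). Qed.
Lemma lift0SK k (S : {set 'I_k}) : lowS (lift0S S) = S.
Proof. by apply/setP => j; rewrite inE mem_lift0S. Qed.
Lemma lift0SK1 k (S : {set 'I_k}) : lowS (ord0 |: lift0S S) = S.
Proof. by apply/setP => j; rewrite inE in_setU1 mem_lift0S eq_sym (negbTE (neq_lift _ _)). Qed.
Lemma lowSK k (S : {set 'I_k.+1}) :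
  S = if ord0 \in S then ord0 |: lift0S (lowS S) else lift0S (lowS S).
Proof.
apply/setP => j; case: (unliftP ord0 j) => [i ->|->].
  by case: ifP => _; rewrite ?in_setU1 mem_lift0S inE.
by case: ifP => // _; rewrite ?in_setU1 ?eqxx // ord0_lift0S.
Qed.
Lemma card_lift0S k (S : {set 'I_k}) : #|lift0S S| = #|S|.
Proof. by apply: card_imset; exact: lift_inj. Qed.
Lemma lift0SU1 k (S : {set 'I_k}) j : lift ord0 j |: lift0S S = lift0S (j |: S).
Proof. by rewrite /lift0S imsetU1. Qed.

Lemma ksgn_ord0 k (S : {set 'I_k.+1}) : ksgn S ord0 = 1.
Proof. by rewrite /ksgn (eq_card0 (A := _)) ?expr0 // => t; rewrite !inE andbF. Qed.
Lemma lt_lift0 k (i j : 'I_k) : (lift ord0 i < lift ord0 j)%N = (i < j)%N.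
Proof. by rewrite !lift0. Qed.
Lemma ksgn_lift0 k (S : {set 'I_k}) j : ksgn (lift0S S) (lift ord0 j) = ksgn S j.
Proof.
rewrite /ksgn; congr (_ ^+ _); rewrite -[RHS](card_lift0S); apply: eq_card => t.
rewrite inE; case: (unliftP ord0 t) => [i ->|->].
  by rewrite !mem_lift0S inE lt_lift0.
by rewrite !ord0_lift0S.
Qed.
Lemma ksgn_lift1 k (S : {set 'I_k}) j :
  ksgn (ord0 |: lift0S S) (lift ord0 j) = - ksgn S j.
Proof.
rewrite -[in RHS]ksgn_lift0 /ksgn -[RHS]mulN1r -exprS; congr (_ ^+ _).
transitivity #|ord0 |: [set t in lift0S S | (t < lift ord0 j)%N]|.
  by apply: eq_card => t; rewrite !inE; case: eqP => [->|].
by rewrite cardsU1 inE ord0_lift0S.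
Qed.

(** Induction on x. Splitting subsets by whether they contain 0 gives the two coordinates of the
    cone: removing 0 produces the term with a, and 0, preceding every other index, produces the sign
    on the shifted copy. *)
Lemma tot_kos (x : seq R) : exists (f : {linear tot (size x) -> car (kos x N)})
    (g : {linear car (kos x N) -> tot (size x)}),
  [/\ cancel f g, cancel g f, forall u, f (tot_d u) = dif (f u) &
      forall i u, homog i u <-> gr i (f u)].
Proof.
elim: x => [|a x [f [g [fK gK fd fg]]]].
  have E (S T : {set 'I_0}) : S = T by apply/setP => -[].
  have l1 : linear (fun u : tot 0 => u (finset.set0 : {set 'I_0})).
    by move=> k u v; rewrite !ffunE.
  have l2 : linear (fun n : N => [ffun S : {set 'I_0} => n] : tot 0).
    by move=> k u v; apply/ffunP => S; rewrite !ffunE.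
  exists (mkLin l1), (mkLin l2); split=> [u|u|u|i u] /=.
  - by apply/ffunP => S; rewrite ffunE (E S finset.set0).
  - by rewrite ffunE.
  - by rewrite ffunE big1 // => -[].
  - case: i => [|i] /=; split=> //.
    + by move=> _ S; rewrite (E S finset.set0) cards0.
    + by move=> h; apply: h; rewrite cards0.
    + by move=> h S _; rewrite (E S finset.set0).
have l0 : linear (fun u : tot (size x).+1 =>
    [ffun S : {set 'I_(size x)} => u (lift0S S)] : tot (size x)).
  by move=> k u v; apply/ffunP => S; rewrite !ffunE.
have l1 : linear (fun u : tot (size x).+1 =>
    [ffun S : {set 'I_(size x)} => u (ord0 |: lift0S S)] : tot (size x)).
  by move=> k u v; apply/ffunP => S; rewrite !ffunE.
pose p0 := mkLin l0; pose p1 := mkLin l1.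
have lf : linear (fun u : tot (size x).+1 => (f (p0 u), f (p1 u)) : car (kos (a :: x) N)).
  move=> k u v.
  by rewrite -[RHS]/(k *: f (p0 u) + f (p0 v), k *: f (p1 u) + f (p1 v)) -!linearP.
have lg : linear (fun u : car (kos (a :: x) N) =>
    [ffun S : {set 'I_(size x).+1} =>
       if ord0 \in S then g u.2 (lowS S) else g u.1 (lowS S)] : tot (size x).+1).
  move=> k u v; apply/ffunP => S; rewrite !ffunE /=.
  by case: ifP => _; rewrite (linearP g) !ffunE.
exists (mkLin lf), (mkLin lg); split=> [u|[u v]|u|i u].
- apply/ffunP => S; rewrite ffunE /= !fK !ffunE.
  by rewrite [in RHS](lowSK S); case: ifP.
- rewrite /=; congr (_, _).
    rewrite -[RHS]gK; congr (f _); apply/ffunP => S.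
    by rewrite !ffunE ord0_lift0S lift0SK.
  rewrite -[RHS]gK; congr (f _); apply/ffunP => S.
  by rewrite !ffunE setU11 lift0SK1.
- rewrite /= /cone_dif /= -!fd -linearZ -linearD -linearN; congr (_, _); congr (f _).
    apply/ffunP => S; rewrite !ffunE big_mkcond big_ord_recl ord0_lift0S /=.
    rewrite ksgn_ord0 mul1r addrC; congr (_ + _).
    rewrite [RHS]big_mkcond; apply: eq_bigr => j _.
    by rewrite mem_lift0S ksgn_lift0 lift0SU1 ffunE.
  apply/ffunP => S; rewrite !ffunE big_mkcond big_ord_recl setU11 /= add0r.
  rewrite [in RHS]big_mkcond -sumrN; apply: eq_bigr => j _.
  rewrite in_setU1 eq_sym (negbTE (neq_lift _ _)) mem_lift0S ksgn_lift1.
  by case: ifP => _; rewrite ?oppr0 // finset.setUCA lift0SU1 ffunE mulNr scaleNr.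
- have -> : gr i (mkLin lf u) <-> homog i (p0 u) /\
      (if i is i'.+1 then homog i' (p1 u) else p1 u = 0).
    split=> [[/= /fg h0 h1]|[/fg h0 h1]]; split=> //=.
      case: i h1 {h0} => [h1|i /fg //].
      by rewrite -[LHS]fK h1 linear0.
    by case: i h1 {h0} => [h1|i /fg //]; rewrite /= -[LHS]/(f (p1 u)) h1 linear0.
  split=> [h|[h0 h1] S Si].
    split=> [S Si|]; first by rewrite ffunE h // card_lift0S.
    case: i h => [|i] h; last first.
      move=> S Si; rewrite ffunE h // cardsU1 ord0_lift0S card_lift0S add1n.
      by case.
    by apply/ffunP => S; rewrite !ffunE h // cardsU1 ord0_lift0S.
  move: Si; rewrite (lowSK S); case: ifP => _; last first.
    by rewrite card_lift0S => /h0; rewrite ffunE.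
  rewrite cardsU1 ord0_lift0S card_lift0S add1n.
  case: i h1 {h0} => [/ffunP h1 _|i h1 Si]; first by have := h1 (lowS S); rewrite !ffunE.
  by have /h1 : #|lowS S| <> i; [move=> E; apply: Si; rewrite E | rewrite ffunE].
Qed.

Lemma koszul_dE (x : seq R) i (w : koszul N (size x) i.+1) :
  koszul_d w = restr i (tot_d (ext w)).
Proof. by rewrite -koszul_d_restr extK. Qed.

Lemma tot_d_homog (x : seq R) i (f : tot (size x)) :
  homog i.+1 f -> homog i (tot_d f).
Proof.
move=> hf S Si; rewrite ffunE big1 // => j jS; rewrite hf ?scaler0 //.
by rewrite cardsU1 jS add1n => -[].
Qed.

Lemma ext_koszul_d (x : seq R) i (w : koszul N (size x) i.+1) :
  ext (koszul_d w) = tot_d (ext w).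
Proof. by rewrite koszul_dE restrK //; apply: tot_d_homog; exact: ext_homog. Qed.

Lemma hlen_le_koszul (F : realType) (x : seq R) i :
  (hlen F (kos x N) i.+1 <= length F (koszul_homology N x i.+1))%E.
Proof.
have [f [g [fK gK fd fg]]] := tot_kos x.
have gd v : g (dif v) = tot_d (g v) by apply: (can_inj fK); rewrite fd !gK.
have gg j v : gr j v -> homog j (g v) by move=> h; apply/fg; rewrite gK.
have dd (u : tot (size x)) : tot_d (tot_d u) = 0 by rewrite -(fK u) -!gd difK linear0.
apply: le_trans (len_subquot F _) => [|u]; last first.
  move=> /asboolP[w ->]; rewrite unfold_in; apply/eqP.
  rewrite [LHS]koszul_dE ext_koszul_d dd.
  by apply/ffunP => S; rewrite !ffunE.
apply: (len_surj (f := f \o mkLin (@ext_linear (size x) i.+1))).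
- exact: is_submod_pred.
- move=> _ /asboolP[w ->] _ /=; rewrite ext_koszul_d fd.
  by exists (f (ext w)); split=> //; apply/fg; exact: ext_homog.
- move=> _ /asboolP[w ->]; rewrite /= unfold_in; apply/eqP.
  rewrite [LHS]koszul_dE ext_koszul_d dd.
  by apply/ffunP => S; rewrite !ffunE.
- move=> v [gv dv]; exists (restr i.+1 (g v)); split.
    rewrite /= unfold_in; apply/eqP; rewrite [LHS]koszul_d_restr -gd dv linear0.
    by apply/ffunP => S; rewrite !ffunE.
  rewrite /= restrK; last exact: gg.
  by rewrite gK subrr; exact: submod0 (is_submod_bnd _ _).
Qed.

End ConcreteKoszul.

(** K(x; N) is the subcomplex of first coordinates in the cones over y. The projection back commutes
    with the differentials only modulo (y), and c is the defect. *)
Lemma kos_cat (R : comNzRingType) (y x : seq R) (N : lmodType R) :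
  exists (pr : {linear car (kos (y ++ x) N) -> car (kos x N)})
    (inj : {linear car (kos x N) -> car (kos (y ++ x) N)}),
  [/\ cancel inj pr, forall i u, gr i u -> gr i (inj u),
      forall u, dif (inj u) = inj (dif u), forall i w, gr i w -> gr i (pr w) &
      forall w, exists c, mulseq (car (kos x N)) y c /\ pr (dif w) = dif (pr w) + c].
Proof.
elim: y => [|a y [pr [inj [injK gi di gp dp]]]].
  exists idfun, idfun; split=> // w; exists 0; split=> //; by rewrite addr0.
exists (pr \o mkLin (@fst_linear R (car (kos (y ++ x) N)))).
exists (mkLin (@inl_linear R (car (kos (y ++ x) N))) \o inj).
split=> [u|i u gu|u|i [w v] [/= gw _]|[w v]] /=.
- by rewrite injK.
- by split=> /=; [exact: gi | exact: submod0 (is_submod_grm _ _)].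
- by rewrite /cone_dif /= scaler0 addr0 di linear0 oppr0.
- exact: gp.
- have [c [yc E]] := dp w.
  exists (a *: pr v + c); split; first by exists (pr v), c.
  by rewrite linearD linearZ /= E -addrA [c + _]addrC.
Qed.

(** * Smallness of Koszul homology, and the cycle and colon statements *)

Section SystemsOfParameters.
Variables (F : realType) (R : comNzRingType) (m : idealr R).
Variables (M : nat -> lmodType R) (alpha : nat -> F).

Definition hsmall (p : nat) (x : seq R) :=
  forall i, (p <= i)%N -> little_o (fun n => hlen F (kos x (M n)) i) alpha.

Lemma hsmall_perm p x y : perm_eq x y -> hsmall p x -> hsmall p y.
Proof.
move=> xy h i pi; apply: little_o_le (h i pi) => n.
by rewrite (hlen_kos_perm _ _ _ xy).
Qed.

Lemma hsmall_cons p a x : hsmall p x -> hsmall p.+1 (a :: x).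
Proof.
move=> h [|i] // pi.
apply: little_o_le (little_oD (h i.+1 (ltnW pi)) (h i pi)) => n.
exact: hlen_cone_le.
Qed.

Lemma hsmall_behead p a (x : seq R) : gen (x : seq R^o) a -> hsmall p.+1 (a :: x) -> hsmall p x.
Proof.
move=> xa h i pi; apply: little_o_le (h i.+1 _) => // n.
by apply: hlen_le_cone; exact: kos_null_homotopic.
Qed.

Lemma hsmall_exp p n u w : hsmall p (u ++ w) -> hsmall p (expseq n u ++ w).
Proof.
move=> h i pi; apply: little_o_le (little_oM (n ^ size u) (h i pi) _) => k //.
exact: hlen_kos_exp.
Qed.

Lemma hsmall_cat p b x : hsmall p x -> hsmall (size b + p) (b ++ x).
Proof. by move=> h; elim: b => [|a b IH] //=; rewrite addSn; exact: hsmall_cons. Qed.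

(** Each entry of b is first raised to a power lying in (x); that power is null-homotopic on the
    remaining complex, so dropping it lowers the degree bound by one. *)
Lemma hsmall_drop p b (x : seq R) :
  (forall a, a \in b -> exists n, gen (x : seq R^o) (a ^+ n)) ->
  hsmall (size b + p) (b ++ x) -> hsmall p x.
Proof.
elim: b => [|a b IH] //= hb h.
have hb' : forall c, c \in b -> exists n, gen (x : seq R^o) (c ^+ n).
  by move=> c cb; apply: hb; rewrite inE cb orbT.
apply: (IH hb'); have [n xan] := hb a (mem_head _ _).
apply: (@hsmall_behead _ (a ^+ n.+1)).
  apply: (gen_cat (b : seq R^o) x).2; rewrite exprS.
  by apply: (@submodZ R R^o _ a) xan; exact: is_submod_gen.
by move: (@hsmall_exp _ n.+1 [:: a] (b ++ x) h).
Qed.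

(* Smallness in degrees >= 1 for [x] amounts to smallness in degrees > d for the
   concatenation of [x] and [y], and the latter is symmetric in [x] and [y]. *)
Lemma hsmall_sop (x y : seq R) : sop F m x -> sop F m y -> hsmall 1 x -> hsmall 1 y.
Proof.
move=> [dx xm _] [dy _ ym] h.
have E : size x = size y.
  by apply/eqP; rewrite -(eqr_nat F); have := dy; rewrite dx => -[->].
apply: (@hsmall_drop 1 x) => [a /xm /ym[n hn]|]; first by exists n; apply/span_gen.
rewrite E; apply: (hsmall_perm _ (hsmall_cat (b := y) h)).
by rewrite perm_catC.
Qed.

Lemma mem_ideal_pow a t : a \in m -> (a ^+ t : R^o) \in ideal_pow m t.
Proof.
move=> am; elim: t => [|t IH] //=; apply/asboolP => N; apply.
by exists a => //; exists (a ^+ t : R^o) => //; rewrite exprS.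
Qed.

Lemma mulseq_ideal_mul (B : lmodType R) (J : {pred R}) (y : seq R) u :
  {subset y <= J} -> mulseq B y u -> u \in ideal_mul J (fullmod B).
Proof.
move=> yJ; apply: (mulseq_min (is_submod_pred _)) => a v ay.
by apply/asboolP => N; apply; exists a; [exact: yJ | exists v].
Qed.

Lemma expseq_ideal_pow t (y : seq R) : {subset y <= m} ->
  {subset expseq t y <= (ideal_pow m t : {pred R})}.
Proof. by move=> ym _ /mapP[a /ym am ->]; exact: mem_ideal_pow. Qed.

Lemma sum_submod_l (B : lmodType R) (A A' : submodClosed B) u :
  u \in A -> u \in sum_submod A A'.
Proof.
by move=> uA; apply/asboolP; exists u => //; exists 0; rewrite ?addr0 ?rpred0.
Qed.
Lemma sum_submod_r (B : lmodType R) (A A' : submodClosed B) u :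
  u \in A' -> u \in sum_submod A A'.
Proof.
by move=> uA; apply/asboolP; exists 0; rewrite ?rpred0 //; exists u; rewrite ?add0r.
Qed.

Lemma quotmod_pi0 (B : lmodType R) (A : submodClosed B) u : u \in A -> quotmod_pi A u = 0.
Proof.
move=> uA; rewrite -[RHS](linear0 (@quotmod_pi R B A)).
by apply/quotmod_eqP; rewrite subr0.
Qed.

Hypothesis hR : noeth_mod R^o.

Lemma noeth_koszul k i : noeth_mod (koszul R^o k i).
Proof.
pose dl (U : koszul_index k i) : koszul R^o k i := [ffun T => (T == U)%:R].
apply: (@noeth_gen R _ (map dl (enum (koszul_index k i))) hR) => u.
have -> : u = \sum_U (u U : R) *: dl U.
  apply/ffunP => T; rewrite sum_ffunE (bigD1 T) //= big1 => [|U UT].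
    by rewrite !ffunE eqxx /GRing.scale /= mulr1 addr0.
  by rewrite !ffunE eq_sym (negbTE UT) scaler0.
apply: submod_sum; first exact: is_submod_gen.
move=> U _; apply: submodZ; first exact: is_submod_gen.
by apply: gen_mem; apply: map_f; exact: mem_enum.
Qed.

Hypothesis hsm : forall w, sop F m w -> hsmall 1 w.

(** The cycle is viewed in K(y^t, x; R), where y completes x, and [len_tens_cycle] is applied with
    values modulo B_i + m^t K_i. *)
Lemma cycles_mclosure (x : seq R) i z : part_of_sop F m x -> (1 <= i)%N ->
  z \in cycles R^o x i -> mclosure m M alpha (boundaries R^o x i) z.
Proof.
case: i z => // i z [y hxy] _ zc t.
set A := sum_submod _ _.
have ym : {subset y <= m} by move=> a ay; case: hxy => _ h _; apply: h; rewrite mem_cat ay orbT.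
have sm : hsmall 1 (expseq t y ++ x).
  by apply: hsmall_exp; apply: (hsmall_perm _ (hsm hxy)); rewrite perm_catC.
apply: mclosure_fl_intro; first exact: noeth_koszul.
have [f [g [fK gK fd fg]]] := tot_kos R^o x.
have gd v : g (dif v) = tot_d (g v) by apply: (can_inj fK); rewrite fd !gK.
have gg j v : gr j v -> homog j (g v) by move=> h; apply/fg; rewrite gK.
have [pr [inj [injK gi di gp dp]]] := kos_cat (expseq t y) x R^o.
pose rs := mkLin (@restr_linear R R^o (size x) i.+1).
pose th : {linear car (kos (expseq t y ++ x) R^o) -> quotmod A} :=
  (@quotmod_pi R _ A) \o (rs \o (g \o pr)).
pose w := inj (f (ext z)).
have thw : th w = quotmod_pi A z by rewrite /th /= injK fK extK.
apply: little_o_le (sm i.+1 isT) => n; rewrite -thw.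
apply: len_tens_cycle.
  split; first by apply/gi/fg; exact: ext_homog.
  rewrite di -fd -ext_koszul_d.
  move: zc; rewrite unfold_in => /eqP ->.
  by rewrite [ext _](linear0 (mkLin (@ext_linear R R^o (size x) i))) !linear0.
(* After projection, a boundary of K(y^t, x; R) is a boundary of K(x; R) plus the defect c, which
   lies in (y^t)K_i and so in m^t K_i. *)
move=> v gv; rewrite /th /=; apply: quotmod_pi0.
have [c [yc ->]] := dp v.
rewrite linearD gd -[restr _ _]/(rs _) linearD; apply: rpredD.
  apply: sum_submod_l; rewrite /= -koszul_d_restr.
  by apply/asboolP; exists (restr i.+2 (g (pr v))).
apply: sum_submod_r.
have hJ := expseq_ideal_pow (t := t) ym.
suff : mulseq (koszul R^o (size x) i.+1) (expseq t y) (rs (g c)) by exact: mulseq_ideal_mul.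
apply: (mulseq_min (P := (rs \o g) @^-1` _)) yc.
  by apply: is_submod_preim; exact: is_submod_mulseq.
by move=> a u ay /=; rewrite linearZ -[restr _ _]/(rs _) linearZ; exact: mulseq_mem.
Qed.

(** If a y = dp with p of degree 1 in K(w), then (-p, a) is a 1-cycle of the cone of y over K(w),
    and its last coordinate is a. *)
Lemma colon_mclosure (x : seq R) y : part_of_sop F m (rcons x y) ->
  colon (ideal_gen x) y `<=` mclosure m M alpha (ideal_gen x).
Proof.
move=> [y' hxy] a ha t.
set A := sum_submod _ _.
have ym : {subset y' <= m}.
  by move=> b b_y; case: hxy => _ h _; apply: h; rewrite mem_cat b_y orbT.
pose w := expseq t y' ++ x.
have sm : hsmall 1 (y :: w).
  have E b s r : perm_eq (b :: (s ++ r)) (s ++ b :: r) by rewrite -cat1s perm_catCA.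
  apply: (@hsmall_perm _ (expseq t y' ++ y :: x)); first by rewrite perm_sym; exact: E.
  apply: hsmall_exp; apply: (hsmall_perm _ (hsm hxy)).
  by rewrite perm_catC perm_cat2l perm_rcons.
apply: mclosure_fl_intro.
  exact: hR.
have [f [g [fK f0 fb]]] := kos0 w R^o.
have wA r : mulseq R^o w r -> r \in A.
  apply: (mulseq_min (is_submod_pred A)) => b v; rewrite mem_cat => /orP[by_|bx].
    apply: sum_submod_r; apply/asboolP => N; apply.
    by exists b; [exact: (expseq_ideal_pow ym by_) | exists v].
  apply: sum_submod_l; apply/span_gen; rewrite -[_ *: _]/(b * v) mulrC.
  by apply: (@submodZ R R^o); [exact: is_submod_gen | exact: gen_mem].
have [p [gp Ep]] : bnd (kos w R^o) 0 (f (a * y : R)).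
  apply/fb; move: ha => /span_gen.
  apply: gen_min; first exact: is_submod_mulseq.
  move=> b bx; rewrite -[b](mulr1 (b : R)); apply: (@mulseq_mem R R^o).
  by rewrite mem_cat bx orbT.
pose th : {linear car (kos (y :: w) R^o) -> quotmod A} :=
  (@quotmod_pi R _ A) \o (g \o mkLin (@snd_linear R (car (kos w R^o)))).
pose z : car (kos (y :: w) R^o) := (- p, f a).
have thz : th z = quotmod_pi A a by rewrite /th /= fK.
have df r : dif (f r) = 0 by apply: dif_gr0; apply/f0; exists r.
apply: little_o_le (sm 1%N isT) => n; rewrite -thz; apply: len_tens_cycle.
  split; first by split=> /=; [exact: submodN (gr_sub _ _) _ | apply/f0; exists a].
  rewrite /= /cone_dif /= df oppr0 linearN -Ep -linearZ.
  by rewrite -[y *: a]/(y * a) mulrC addNr.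
(* The last coordinate of a boundary is -dv with v of degree 1, hence lies in (w), which is
   contained in A. *)
move=> [u v] [/= gu gv]; rewrite /th /=; apply: quotmod_pi0.
have /f0[r Er] : gr 0 (dif v) by exact: dif_gr.
rewrite Er linearN fK -scaleN1r rpredZ //; apply: wA.
by apply/fb; rewrite -Er; exists v.
Qed.

End SystemsOfParameters.

(** * Prime ideals and prime filtrations *)

Section Primes.
Variables (R : comNzRingType).

(** Properness is part of the condition because [idealr] means proper ideal. *)
Definition ideal_set (I : set R) :=
  [/\ I 0, ~ I 1 & forall a u v, I u -> I v -> I (a * u + v)].
Definition prime_set (I : set R) :=
  ideal_set I /\ forall u v, I (u * v) -> I u \/ I v.

Definition ideal_pred (I : set R) : {pred R} := fun a => `[< I a >].
Fact ideal_pred_closed I : ideal_set I -> idealr_closed (ideal_pred I).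
Proof.
case=> I0 I1 IL; split; first exact/asboolP.
  by apply/negP => /asboolP.
by move=> a u v /asboolP Iu /asboolP Iv; apply/asboolP; exact: IL.
Qed.
Fact ideal_pred_prime I : prime_set I -> prime_idealr_closed (ideal_pred I).
Proof.
by case=> _ IP u v /asboolP /IP[Iu|Iv]; apply/orP; [left|right]; apply/asboolP.
Qed.
Definition mkIdeal (I : set R) (h : ideal_set I) : idealr R :=
  HB.pack_for (idealr R) (ideal_pred I) (isIdealr.Build R (ideal_pred I) (ideal_pred_closed h)).
Definition mkPrime (I : set R) (h : prime_set I) : prime_idealr R :=
  HB.pack_for (prime_idealr R) (ideal_pred I)
    (isIdealr.Build R (ideal_pred I) (ideal_pred_closed h.1))
    (isPrimeIdealrClosed.Build R (ideal_pred I) (ideal_pred_prime h)).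
Lemma mkIdealE I h a : a \in @mkIdeal I h <-> I a.
Proof. by split=> /asboolP. Qed.
Lemma mkPrimeE I h a : a \in @mkPrime I h <-> I a.
Proof. by split=> /asboolP. Qed.

Lemma ideal_setP (p : idealr R) : ideal_set [set` p].
Proof.
split; first exact: idealr0.
  by rewrite /= idealr1.
by move=> a u v pu pv /=; rewrite rpredD // idealMr.
Qed.
Lemma is_submod_ideal (I : set R) : ideal_set I -> @is_submod R R^o I.
Proof. by case. Qed.

(** Equality of the packed structures, by proof irrelevance; it lets occurrences of a prime in a
    filtration be counted. *)
Lemma prime_idealr_eq (p q : prime_idealr R) : p =i q -> p = q.
Proof.
move=> pq; have {pq} : (p : R -> bool) = q by apply/funext => a; exact: pq.
case: p q => [s [[s0] [sN] [sI] [sP]]] [t [[t0] [tN] [tI] [tP]]] /= E.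
move: E s0 sN sI sP => -> s0 sN sI sP.
by rewrite (Prop_irrelevance s0 t0) (Prop_irrelevance sN tN) (Prop_irrelevance sI tI)
  (Prop_irrelevance sP tP).
Qed.

Definition idset (p : prime_idealr R) : set R^o := [set` p].
Lemma is_submod_idset p : is_submod (idset p).
Proof. exact/is_submod_ideal/ideal_setP. Qed.

(** This says that R/p has dimension at least k. *)
Definition haschain (k : nat) (p : prime_idealr R) := exists c : nat -> prime_idealr R,
  c 0%N = p /\ forall i, (i < k)%N -> strict_sub (c i) (c i.+1).

Lemma haschain0 p : haschain 0 p. Proof. by exists (fun=> p). Qed.
Lemma haschainS k (p q : prime_idealr R) :
  strict_sub p q -> haschain k q -> haschain k.+1 p.
Proof.
move=> pq [c [c0 hc]]; exists (fun i => if i is i'.+1 then c i' else p).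
by split=> // -[_|i ik]; [rewrite c0 | exact: hc].
Qed.

Section Filtrations.
Variable M : lmodType R.

(* [pfilt N ps]: a filtration from [N] up to [M] whose successive quotients are
   [R / p], for [p] running over [ps]. *)
Inductive pfilt : set M -> seq (prime_idealr R) -> Prop :=
| PfiltNil (N : set M) : (forall u, N u) -> pfilt N [::]
| PfiltCons (N : set M) u (p : prime_idealr R) ps : (forall a, a \in p <-> N (a *: u)) ->
    pfilt (addS N (line u)) ps -> pfilt N (p :: ps).

(** A colon ideal (N : u), maximal among those with u outside N, is prime; Noetherian induction
    continues from N + Ru. *)
Lemma pfilt_exists N : noeth_mod R^o -> noeth_mod M -> is_submod N ->
  exists ps, pfilt N ps.
Proof.
move=> hR hM; move: N; apply: (noeth_ind hM) => N hN IH.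
have [NT|] := pselect (forall u, N u); first by exists [::]; constructor.
move=> /existsNP[u0 Nu0].
pose col u : set R^o := [set a : R^o | N ((a : R) *: u)].
have hcol u : is_submod (col u).
  split=> [|a b c Nb Nc]; rewrite /col /=; first by rewrite scale0r; exact: submod0.
  by rewrite scalerDl -scalerA; apply: hN.2.
have [_ [_ [u [Nu ->]] umax]] := noeth_max (Q := fun I => exists u, ~ N u /\ I = col u)
  hR (hcol u0) (ex_intro _ u0 (conj Nu0 erefl)).
have hp : prime_set (col u).
  split; first by split; [exact: submod0 (hcol u) | rewrite /col /= scale1r | exact: (hcol u).2].
  move=> a b Nab; have [Nb|Nb] := pselect (N (b *: u)); first by right.
  left; apply: (umax (col (b *: u)) (hcol _)); first by exists (b *: u).
    by move=> c Nc; rewrite /col /= scalerA mulrC -scalerA; exact: submodZ.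
  by rewrite /col /= scalerA.
have [ps hps] : exists ps, pfilt (addS N (line u)) ps.
  apply: IH; first exact: is_submod_addS (is_submod_line u).
    by move=> v Nv; apply: addSl => //; exact: is_submod_line.
  by move=> h; apply/Nu/h/addSr => //; exact: line_gen.
by exists (mkPrime hp :: ps); apply: PfiltCons hps => a; exact: mkPrimeE.
Qed.

Lemma pfilt_sup N ps p a : is_submod N -> pfilt N ps -> List.In p ps ->
  (forall u, N (a *: u)) -> a \in p.
Proof.
move=> hN h; elim: h p hN => // {}N u q {}ps hq _ IH p hN [<- Na|/IH h Na].
  exact/hq.
apply: h => [|v]; first exact: is_submod_addS (is_submod_line u).
by apply: addSl => //; exact: is_submod_line.
Qed.

(** Multiplication by u maps R/(p + wR) onto the quotient of N + Ru + wM by N + wM. *)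
Lemma len_pfilt (F : realType) N ps (w : seq R) : is_submod N -> pfilt N ps ->
  (len F (addS N (mulseq M w)) [set: M] <=
   \sum_(p <- ps) len F (addS (idset p) (mulseq R^o w)) [set: R^o])%E.
Proof.
move=> hN h; elim: h hN => [{}N NT _|{}N u p {}ps hp hps IH hN].
  rewrite big_nil len_eq0 // => v _; apply: addSl => //; exact: is_submod_mulseq.
have hw := is_submod_mulseq M w.
have hN' := is_submod_addS hN (is_submod_line u).
rewrite big_cons (@len_add F _ _ _ (addS (addS N (line u)) (mulseq M w))) //; last 2 first.
- exact: is_submod_addS.
- by apply: addS_mono => // v Nv; apply: addSl => //; exact: is_submod_line.
apply: leeD; last exact: IH.
have lin : linear (fun a : R^o => (a : R) *: u).
  by move=> a b c; rewrite scalerDl scalerA.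
apply: (len_surj (f := mkLin lin)) => //.
  move=> _ [b [c [pb wc ->]]] _ /=; exists (b *: u), (c *: u).
  split; [exact/hp | | by rewrite scalerDl].
  move: c wc; apply: (mulseq_min (P := (mkLin lin) @^-1` mulseq M w)).
    exact: is_submod_preim.
  by move=> a c aw /=; rewrite -[a *: c]/(a * c) -scalerA; exact: mulseq_mem.
move=> _ [_ [c [[n [_ [Nn [a ->] ->]]] wc ->]]]; exists a; split=> //=.
by rewrite addrAC addrK; exists n, c.
Qed.

End Filtrations.
End Primes.
Arguments haschain {R}.

(** * Growth of lengths modulo powers of the parameters *)

Section Growth.
Variables (F : realType) (R : comNzRingType) (m : idealr R) (x : seq R).
Hypothesis hR : noeth_mod R^o.
Hypothesis loc_m : forall I : idealr R, {subset I <= m}.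
Hypothesis rad_x : forall a, a \in m -> exists n, gen (x : seq R^o) (a ^+ n).

Lemma prime_sup_x (p : prime_idealr R) : {subset x <= p} -> p =i m.
Proof.
move=> xp a; apply/idP/idP => [ap|]; first exact: (loc_m ap).
move=> /rad_x[n xa].
have {xa} : a ^+ n \in p.
  by apply: (gen_min (is_submod_ideal (ideal_setP p)) _ xa); exact: xp.
elim: n => [|n IH]; first by rewrite expr0 idealr1.
by rewrite exprS prime_idealrM => /orP[|/IH].
Qed.

Lemma len_max_ideal (p : prime_idealr R) : p =i m ->
  (len F (idset p) [set: R^o] <= 1)%E.
Proof.
move=> pm; apply: len_le1 => c pc _ cp u _ /=.
have [c1|c1] := pselect ((1 : R^o) \in c).
  have : (u : R) *: (1 : R^o) \in c by exact: rpredZ.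
  by rewrite -[_ *: _]/(u * 1) mulr1.
exfalso; apply: cp => v vc; rewrite /idset /= pm.
have hc : ideal_set ([set` c] : set R).
  by split=> //; [exact: (rpred0 c) | exact: (is_submod_pred c).2].
by apply: (@loc_m (mkIdeal hc)); apply/mkIdealE.
Qed.

(** The exponents are independent because the induction in [plen_growth] lowers them one at a
    time. *)
Definition powseq (e : nat -> nat) : seq R := [seq x`_j ^+ e j | j <- iota 0 (size x)].
Lemma powseq_cst n : powseq (fun=> n) = expseq n x.
Proof.
apply: (@eq_from_nth _ 0) => [|j]; rewrite !size_map size_iota // => jx.
by rewrite (nth_map 0%N) ?size_iota // nth_iota // add0n (nth_map 0).
Qed.
Lemma powseq_mem e j : (j < size x)%N -> x`_j ^+ e j \in powseq e.
Proof. by move=> jx; apply/mapP; exists j; rewrite // mem_iota. Qed.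

Definition plen (p : prime_idealr R) (e : nat -> nat) : \bar F :=
  len F (addS (idset p) (mulseq R^o (powseq e))) [set: R^o].

Lemma plen_ge0 p e : (0 <= plen p e)%E. Proof. exact: len_ge0. Qed.
Hint Resolve plen_ge0 : core.

Let hpow e := is_submod_mulseq R^o (powseq e).
Let hprime (p : prime_idealr R) := is_submod_idset p.

(** Multiplication by x_j maps the quotient with e_j lowered by one onto the submodule generated by
    x_j in R/(p, x^e). *)
Lemma len_prime_step (p : prime_idealr R) j e v : (j < size x)%N -> e j = v.+1 ->
  (plen p e <= plen p (fun i => if i == j then v else e i) +
   len F (addS (addS (idset p) (line (x`_j : R^o))) (mulseq R^o (powseq e))) [set: R^o])%E.
Proof.
move=> jx ej; pose e' i := if i == j then v else e i.
have hl := is_submod_line (x`_j : R^o).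
have hpl := is_submod_addS (hprime p) hl.
rewrite /plen (@len_add F _ _ _ (addS (addS (idset p) (line (x`_j : R^o)))
  (mulseq R^o (powseq e)))) //; last 2 first.
- exact: is_submod_addS.
- by apply: addS_mono => // u pu; exact: addSl.
apply: leeD => //.
have lin : linear (fun a : R^o => (a * x`_j : R^o)).
  by move=> a b c; rewrite mulrDl -scalerAl.
apply: (len_surj (f := mkLin lin)) => //.
  move=> _ [b [c [pb wc ->]]] _ /=; rewrite mulrDl; exists (b * x`_j), (c * x`_j).
  split=> //; first by rewrite /= mulrC; exact: (idealMr (idealrI := p)).
  move: c wc; apply: (mulseq_min (P := (mkLin lin) @^-1` mulseq R^o (powseq e))).
    exact: is_submod_preim.
  move=> r c /mapP[i]; rewrite mem_iota add0n => ix -> {r} /=.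
  rewrite -[_ *: c]/(_ * c); case: eqP => [->|_].
    have -> : x`_j ^+ v * c * x`_j = x`_j ^+ e j * c by rewrite ej exprS; ring.
    by apply: (@mulseq_mem R R^o _ _ c); exact: powseq_mem.
  by rewrite -mulrA; apply: (@mulseq_mem R R^o _ _ (c * x`_j)); exact: powseq_mem.
move=> _ [_ [c [[b [_ [pb [a ->] ->]]] wc ->]]]; exists a; split=> //=.
by rewrite -[a *: _]/(a * _) addrAC addrK; exists b, c.
Qed.

(* The length of [R / (p, x^e)] is [O(n^(dim R/p))]; the factor [n] on the left makes
   the statement vacuous for [k = 0]. *)
Lemma plen_growth k (p : prime_idealr R) : ~ haschain k p -> exists C : nat,
  forall n e, (forall j, (e j <= n)%N) -> (n%:R%:E * plen p e <= (C * n ^ k)%:R%:E)%E.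
Proof.
elim: k p => [p []|k IH p hp]; first exact: haschain0.
have [xp|] := pselect {subset x <= p}.
  exists 1%N => n e _; rewrite mul1n.
  apply: (@le_trans _ _ (n%:R%:E * 1)%E).
    apply: lee_pmul => //; apply: le_trans (len_max_ideal (prime_sup_x xp)).
    by apply: len_mono => // u pu; exact: addSl.
  rewrite mule1 lee_fin ler_nat; case: n => // n.
  by rewrite expnS leq_pmulr ?expn_gt0.
(* Some x_j lies outside p, so every prime in a filtration of R/(p, x_j) strictly contains p and the
   induction hypothesis applies to it. *)
move=> /existsNP[_ /not_implyP[/(nthP 0)[j jx <-] xjp]].
have hl := is_submod_line (x`_j : R^o).
have hpl := is_submod_addS (hprime p) hl.
have [ps hps] := pfilt_exists hR hR hpl.
have ps_gt q : List.In q ps -> ~ haschain k q.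
  move=> qps hq; apply: hp; apply: haschainS hq; split.
    move=> a pa; apply: (pfilt_sup hpl hps qps) => u; apply: addSl => //=.
    by rewrite -[a *: u]/(a * u) mulrC; exact: (idealMr (idealrI := p)).
  move=> h; apply/xjp/h; apply: (pfilt_sup hpl hps qps) => u; apply: addSr => //.
  by exists u; rewrite -[LHS]/(_ * u) mulrC.
have [C hC] : exists C : nat, forall n e, (forall j, (e j <= n)%N) ->
    (n%:R%:E * (\sum_(q <- ps) plen q e) <= (C * n ^ k)%:R%:E)%E.
  elim: (ps) ps_gt => [_|q qs IHq h].
    by exists 0%N => n e _; rewrite big_nil mule0.
  have [C1 h1] := IH q (h q (or_introl erefl)).
  have [C2 h2] := IHq (fun r hr => h r (or_intror hr)).
  exists (C1 + C2)%N => n e en; rewrite big_cons mulnDl natrD EFinD ge0_muleDr //.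
    by apply: leeD; [exact: h1 | exact: h2].
  by apply: sume_ge0 => r _.
exists C => n e en.
(* The exponent e_j is brought down to 0 in at most n steps, each costing the total over the
   filtration of R/(p, x_j); at exponent 0 the quotient vanishes. *)
suff : forall v e', (forall i, (e' i <= n)%N) -> e' j = v ->
    (n%:R%:E * plen p e' <= (v * (C * n ^ k))%:R%:E)%E.
  move=> /(_ _ e en erefl) h; apply: le_trans h _.
  by rewrite lee_fin ler_nat expnS mulnCA leq_mul2l leq_mul2r en !orbT.
elim=> [|v IHv] e' e'n e'j.
  rewrite /plen len_eq0 ?mule0 // => u _; apply: addSr => //.
  rewrite -[u]mul1r; apply: (@mulseq_mem R R^o _ _ u).
  by rewrite -(expr0 (x`_j)) -e'j; exact: powseq_mem.
apply: (@le_trans _ _ (n%:R%:E * (plen p (fun i => if i == j then v else e' i) +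
   \sum_(q <- ps) plen q e'))%E).
  apply: lee_pmul => //; apply: le_trans (len_prime_step p jx e'j) _.
  by apply: leeD => //; exact: len_pfilt.
rewrite ge0_muleDr //; last by apply: sume_ge0 => r _.
rewrite mulSn addnC natrD EFinD; apply: leeD; last exact: hC.
apply: IHv => [i|]; last by rewrite eqxx.
case: eqP => [_|_] //; apply: leq_trans (e'n j); rewrite e'j; exact: leqnSn.
Qed.

End Growth.
#[global] Hint Extern 0 (is_true (_ <= plen _ _ _ _)%E) => exact: plen_ge0 : core.

(** * Localization of prime filtrations *)

Section Localizations.
Variables (F : realType) (R : comNzRingType) (p : prime_idealr R) (M : lmodType R).

Definition locS (N : set M) : set (locmod p M) :=
  [set t | exists u s, N u /\ t = Defs.frac u s].

Lemma frac_scale (a : R) (s t : denom p) (u : M) :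
  (Defs.frac (a : R^o) s : locring p) *: (Defs.frac u t : locmod p M) =
  Defs.frac (a *: u) (denomM s t).
Proof. exact: loc_scale_frac. Qed.
Lemma frac_addl (s : denom p) (u v : M) :
  (Defs.frac (u + v) s : locmod p M) = (Defs.frac u s : locmod p M) + (Defs.frac v s : locmod p M).
Proof.
rewrite -[RHS]/(Defs.frac u s + Defs.frac v s) frac_add; apply/frac_eqP; exists (denom1 p).
by rewrite val_denomM val_denom1 !mul1r -scalerDr scalerA.
Qed.
Lemma frac_mulr (s t : denom p) (u : M) :
  Defs.frac u s = Defs.frac (val t *: u) (denomM s t) :> locmod p M.
Proof.
by apply/frac_eqP; exists (denom1 p); rewrite val_denomM val_denom1 !mul1r scalerA.
Qed.

Lemma locS_frac N u s : is_submod N ->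
  locS N (Defs.frac u s) <-> exists a : denom p, N (val a *: u).
Proof.
move=> hN; split=> [[v [t [Nv /frac_eqP[a E]]]]|[a Na]].
  by exists (denomM a t); rewrite val_denomM E; exact: submodZ.
by exists (val a *: u), (denomM s a); split=> //; exact: frac_mulr.
Qed.

Lemma is_submod_locS N : is_submod N -> is_submod (locS N).
Proof.
move=> hN; split=> [|a t t' [u [s [Nu ->]]] [u' [s' [Nu' ->]]]].
  by exists 0, (denom1 p); split=> //; exact: submod0.
have [b [r ->]] := fracP a.
rewrite frac_scale -[_ + _]/(Defs.frac _ _ + Defs.frac _ _) frac_add.
eexists _, _; split; last reflexivity.
by apply: submodD => //; do ?apply: submodZ.
Qed.

Lemma locS_mono N N' : N `<=` N' -> locS N `<=` locS N'.
Proof. by move=> NN _ [u [s [/NN Nu ->]]]; exists u, s. Qed.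
Lemma locS0 : locS [set 0] = [set 0].
Proof.
apply/seteqP; split=> [_ [_ [s [-> ->]]]|_ ->]; last by exists 0, (denom1 p).
by apply/frac_eqP; exists (denom1 p); rewrite !scaler0.
Qed.

Definition cnt (ps : seq (prime_idealr R)) : nat := count (fun q => `[< q = p >]) ps.

(** A factor R/p gives a strict step after localizing at p: u/1 in the smaller submodule would
    require an element outside p that carries u into N. *)
Lemma cnt_le_len N ps : is_submod N -> pfilt N ps ->
  ((cnt ps)%:R%:E <= len F (locS N) [set: locmod p M])%E.
Proof.
move=> hN h; elim: h hN => [{}N _ _|{}N u q {}ps hq hps IH hN]; first exact: len_ge0.
have hl := is_submod_line u; have hN' := is_submod_addS hN hl.
have NN' : N `<=` addS N (line u) by move=> v Nv; exact: addSl.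
apply: le_trans (len_ge_add (locS_mono NN') (@subsetT _ _)).
rewrite /cnt /= natrD EFinD; apply: leeD; last exact: IH.
case: asboolP => [E|_]; last exact: len_ge0.
apply: (@len_chain _ _ _ _ _ 1).
exists (fun i => if i is 0 then mkSub (is_submod_locS hN) else mkSub (is_submod_locS hN')).
case=> // _ /=; split; last by move=> t /asboolP.
  split=> [t /asboolP h|h]; first by apply/asboolP; exact: locS_mono NN' _ h.
  have /h/asboolP : Defs.frac u (denom1 p) \in smod_pred (locS (addS N (line u))).
    apply/asboolP; exists u, (denom1 p); split=> //.
    by apply: addSr => //; exact: line_gen.
  move=> /(locS_frac _ _ hN)[a /hq]; rewrite E => ap.
  by move: (valP a); rewrite ap.
by move=> t Nt; apply/asboolP.
Qed.

Hypothesis pmin : forall q : prime_idealr R, {subset q <= p} -> {subset p <= q}.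

(** When p is minimal, any other factor R/q is killed by an element outside p and vanishes in the
    localization; R/p itself becomes a field, of length at most 1. *)
Lemma len_le_cnt N ps : is_submod N -> pfilt N ps ->
  (len F (locS N) [set: locmod p M] <= (cnt ps)%:R%:E)%E.
Proof.
move=> hN h; elim: h hN => [{}N NT _|{}N u q {}ps hq hps IH hN].
  by rewrite len_eq0 // => t _; have [v [s ->]] := fracP t; exists v, s.
have hl := is_submod_line u; have hN' := is_submod_addS hN hl.
have NN' : N `<=` addS N (line u) by move=> v Nv; exact: addSl.
have hLN := is_submod_locS hN; have hLN' := is_submod_locS hN'.
apply: le_trans (len_le_add hLN' (locS_mono NN') (@subsetT _ _) (@is_submodT _ _)) _.
rewrite /cnt /= natrD EFinD; apply: leeD; last exact: IH.
case: asboolP => [E|qp]; last first.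
  have [s sq sp] : exists2 s, s \in q & s \notin p.
    apply: contrapT => h; apply: qp; apply: prime_idealr_eq => a.
    have qp' : {subset q <= p}.
      by move=> b bq; apply/negPn/negP => bp; apply: h; exists b.
    by apply/idP/idP; [exact: qp' | exact: (pmin qp')].
  rewrite len_eq0 // => _ [_ [t [[v [_ [Nv [a ->] ->]]] ->]]].
  apply/locS_frac => //; exists (exist _ s sp : denom p) => /=.
  rewrite scalerDr scalerA mulrC -scalerA; apply: submodD => //; first exact: submodZ.
  by apply: submodZ => //; exact/hq.
apply: len_le1 => c Nc cN' /existsNP[t /not_implyP[tc tN]].
have [_ [s [[n [_ [Nn [a ->] ->]]] Et]]] := cN' t tc.
have ap : a \notin p.
  apply/negP => ap; apply: tN; rewrite Et; exists (n + a *: u), s; split=> //.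
  by apply: submodD => //; apply/hq; rewrite E.
have uc : (Defs.frac (a *: u) s : locmod p M) \in c.
  have -> : (Defs.frac (a *: u) s : locmod p M) = t - Defs.frac n s.
    by rewrite Et frac_addl addrC addKr.
  by apply: submodClosedB => //; apply: Nc; exists n, s.
move=> _ [_ [r [[n' [_ [Nn' [b ->] ->]]] ->]]] /=.
rewrite frac_addl; apply: rpredD; first by apply: Nc; exists n', r.
pose a' : denom p := exist _ a ap.
(* As a is invertible at p, every fraction of a multiple of u is a multiple of (a u)/s. *)
have -> : (Defs.frac (b *: u) r : locmod p M) =
    (Defs.frac (b * val s : R^o) (denomM r a') : locring p) *: (Defs.frac (a *: u) s : locmod p M).
  rewrite frac_scale; apply/frac_eqP; exists (denom1 p).
  by rewrite !val_denomM val_denom1 /= !scalerA; congr (_ *: _); ring.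
exact: rpredZ.
Qed.

End Localizations.

Lemma quotring_pi0 (R : comNzRingType) (I : idealr R) : quotring_pi I 0 = 0.
Proof. exact: rmorph0. Qed.

(** * The number of generators is bounded by the length of M/xM *)

Section MinimalGenerators.
Variables (F : realType) (R : comNzRingType) (m : idealr R) (M : lmodType R).

Lemma base_change_tens (t : base_change m M) :
  exists u : M, t = tens (1 : {ideal_quot m}) u.
Proof.
have [s ->] := tensorP t.
elim: s => [|[c [q u]] s [v IH]].
  by exists 0; rewrite big_nil -(scale0r (0 : M)) tensZr scale0r.
exists ((c * repr q) *: u + v); rewrite big_cons IH tensDr; congr (_ + _).
rewrite /= tensZr -!tensZl; congr (tens _ u).
rewrite -[LHS]/(quotring_pi m c * q) -[RHS]/(quotring_pi m (c * repr q) * 1).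
by rewrite mulr1 quotring_piM; congr (_ * _); rewrite /quotring_pi reprK.
Qed.

Lemma base_change_scale_tens (a : R) (u : M) :
  (quotring_pi m a : {ideal_quot m}) *: (tens (1 : {ideal_quot m}) u : base_change m M) =
  tens (1 : {ideal_quot m}) (a *: u).
Proof.
rewrite -[LHS]/(base_change_scale _ _) /base_change_scale tensor_mapE /=.
by rewrite tensZr -tensZl; congr (tens _ u).
Qed.

(** A basis of K tensor M gives a flag, whose preimages in M contain xM because x lies in m. If no
    basis exists, [vdim] takes its default value 0 and the bound is trivial. *)
Lemma nu_le_len (x : seq R) : {subset x <= m} ->
  ((nu m M)%:R%:E <= len F (mulseq M x) [set: M])%E.
Proof.
move=> xm; rewrite /nu /vdim; case: xgetP => [n _ [v [vgen vfree]]|_]; last exact: len_ge0.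
pose K := {ideal_quot m}.
pose W i : set M := [set u | exists c : 'I_n -> K, (forall j : 'I_n, (i <= j)%N -> c j = 0) /\
  (tens (1 : K) u : base_change m M) = \sum_(j < n) c j *: v j].
have hW i : is_submod (W i).
  split=> [|a u w [c [ci Ec]] [e [ei Ee]]].
    exists (fun=> 0); split=> //; rewrite big1 => [|j _]; last by rewrite scale0r.
    by rewrite -(scale0r (0 : M)) tensZr scale0r.
  exists (fun j => quotring_pi m a * c j + e j); split.
    by move=> j ij; rewrite ci // ei // mulr0 addr0.
  rewrite tensDr -base_change_scale_tens Ec Ee scaler_sumr -big_split /=.
  by apply: eq_bigr => j _; rewrite scalerDl scalerA.
apply: len_chain; exists (fun i => mkSub (hW i)) => i ilt; split=> //.
- split=> [u /mkSubE[c [ci Ec]]|h].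
    by apply/mkSubE; exists c; split=> // j ij; apply: ci; exact: ltnW.
  have [u Eu] := base_change_tens (v (Ordinal ilt)).
  have /h /mkSubE[c [ci Ec]] : u \in mkSub (hW i.+1).
    apply/mkSubE; exists (fun j => (j == Ordinal ilt)%:R); split.
      by move=> j ij; case: eqP => // Ej; move: ij; rewrite Ej /= ltnn.
    rewrite -Eu (bigD1 (Ordinal ilt)) //= eqxx scale1r big1 ?addr0 // => j /negbTE->.
    by rewrite scale0r.
  have := vfree (fun j => c j - (j == Ordinal ilt)%:R) _ (Ordinal ilt).
  rewrite eqxx ci //= sub0r => /(_ _)/eqP; rewrite oppr_eq0 oner_eq0 => H; apply: notF; apply: H.
  under eq_bigr do rewrite scalerBl.
  rewrite sumrB -Ec (bigD1 (Ordinal ilt)) //= eqxx scale1r big1 ?addr0 ?Eu ?subrr //.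
  by move=> j /negbTE->; rewrite scale0r.
- move=> u xu; apply/mkSubE; apply: (mulseq_min (hW i)) xu => a w ax.
  exists (fun=> 0); split=> //; rewrite big1 => [|j _]; last by rewrite scale0r.
  rewrite -base_change_scale_tens.
  have -> : quotring_pi m a = 0 :> K.
    have E : quotring_pi m a = quotring_pi m 0.
      by apply/eqP; rewrite /quotring_pi -Quotient.idealrBE subr0; exact: xm.
    by rewrite E quotring_pi0.
  by rewrite scale0r.
Qed.

End MinimalGenerators.

(** * Primes of maximal dimension *)

Section QuotientDimension.
Variables (F : realType) (R : comNzRingType) (d : nat).
Hypothesis dimR : krull_dim F R = d%:R%:E.

Lemma haschain_dim k (p : prime_idealr R) : haschain k p -> (k <= d)%N.
Proof.
move=> [c [_ hc]]; rewrite -(ler_nat F) -lee_fin -dimR.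
by apply: ereal_sup_ubound; exists k => //; exists c.
Qed.

Lemma haschain_ex : exists p : prime_idealr R, haschain d p.
Proof.
(* Lengths of chains are integers, so the supremum d is attained: a chain longer than d - 1 has at
   least d steps. *)
have : ((d%:R - 1)%:E < krull_dim F R)%E by rewrite dimR lte_fin ltrBlDr ltrDl.
move=> /ereal_sup_gt[_ [k [c hc] <-]]; rewrite lte_fin ltrBlDr natr1 ltr_nat ltnS => dk.
by exists (c 0%N), c; split=> // i id; apply: hc; exact: leq_trans dk.
Qed.

Lemma haschain_min (p : prime_idealr R) : haschain d p ->
  forall q : prime_idealr R, {subset q <= p} -> {subset p <= q}.
Proof.
move=> hp q qp; apply: contrapT => pq.
by have /haschain_dim : haschain d.+1 q; [exact: haschainS hp | rewrite ltnn].
Qed.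

Lemma krull_dim_quot (p : prime_idealr R) : haschain d p ->
  krull_dim F {ideal_quot p} = krull_dim F R.
Proof.
move=> [c [c0 hc]]; apply/eqP; rewrite eq_le; apply/andP; split.
  apply: ge_ereal_sup => _ [k [q hq] <-].
  have hI i : prime_set [set a : R | quotring_pi p a \in q i].
    split; first split=> /=.
    - by rewrite (quotring_pi0 p); exact: idealr0.
    - by rewrite quotring_pi1 idealr1.
    - by move=> a u v qu qv; rewrite quotring_piD quotring_piM rpredD // idealMr.
    by move=> u v /=; rewrite quotring_piM prime_idealrM => /orP.
  apply: ereal_sup_ubound; exists k => //; exists (fun i => mkPrime (hI i)) => i ik.
  have [q1 q2] := hq i ik; split=> [a /mkPrimeE /q1 h|h]; first exact/mkPrimeE.
  apply: q2 => y; rewrite -[y]reprK => yq.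
  by have /mkPrimeE : repr y \in mkPrime (hI i) by apply: h; apply/mkPrimeE.
rewrite dimR; apply: ereal_sup_ubound; exists d => //.
have pc i : (i <= d)%N -> {subset p <= c i}.
  elim: i => [_|i IH id]; first by rewrite c0.
  by move=> a /(IH (ltnW id)); case: (hc i id) => h _; exact: h.
have rp i a : (i <= d)%N -> (repr (quotring_pi p a) \in c i) = (a \in c i).
  move=> id; have hr : repr (quotring_pi p a) - a \in c i.
    by apply: (pc i id); rewrite Quotient.idealrBE reprK.
  by rewrite -[X in (X \in _) = _](subrK a) (rpredDl _ hr).
have im i : (minn i d <= d)%N by exact: geq_minr.
have piE (y : {ideal_quot p}) : y = quotring_pi p (repr y) by rewrite /quotring_pi reprK.
(* Only [c 0], ..., [c d] are known to contain p, so the index is truncated at d to get a prime of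
   R/p for every i. *)
have hI i : prime_set [set y : {ideal_quot p} | repr y \in c (minn i d)].
  split; first split=> /=.
  - by rewrite -[X in repr X](quotring_pi0 p) rp // idealr0.
  - by rewrite -(quotring_pi1 p) rp // idealr1.
  - move=> a u v ci cj; rewrite (piE a) (piE u) (piE v) -quotring_piM -quotring_piD rp //.
    by rewrite rpredD // idealMr.
  by move=> u v /=; rewrite {1}(piE u) {1}(piE v) -quotring_piM rp // prime_idealrM => /orP.
exists (fun i => mkPrime (hI i)) => i id; have [c1 c2] := hc i id.
have E1 : minn i d = i by apply/minn_idPl; exact: ltnW.
have E2 : minn i.+1 d = i.+1 by apply/minn_idPl.
split=> [y /mkPrimeE /=|h].
  rewrite E1 => yc; apply/(mkPrimeE (hI i.+1)) => /=; rewrite E2; exact: (c1 _ yc).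
apply: c2 => a ac; have : quotring_pi p a \in mkPrime (hI i).
  by apply: h; apply/(mkPrimeE (hI i.+1)) => /=; rewrite rp // E2.
by move=> /mkPrimeE /=; rewrite rp E1 // ltnW.
Qed.

End QuotientDimension.

(** * Bounding H_0 by the rank *)

Section Rank.
Variables (F : realType) (R : comNzRingType).
Hypothesis hR : noeth_mod R^o.

Lemma length_locmod (p : prime_idealr R) (M : lmodType R) :
  length F (locmod p M) = len F (@locS R p M [set 0]) [set: locmod p M].
Proof. by rewrite length_len locS0. Qed.

Lemma length_locring (p : prime_idealr R) :
  length F (locring p)^o = length F (locmod p R^o).
Proof.
have lin1 : linear (fun t : locmod p R^o => t : (locring p)^o) by [].
have lin2 : linear (fun t : (locring p)^o => t : locmod p R^o) by [].
rewrite !length_len; apply/eqP; rewrite eq_le; apply/andP; split.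
  apply: (len_inj (f := mkLin lin2)) => //; exact: is_submod0.
apply: (len_inj (f := mkLin lin1)) => //; exact: is_submod0.
Qed.

Lemma length_locring_ge1 (p : prime_idealr R) : (1 <= length F (locring p)^o)%E.
Proof.
rewrite length_len; apply: (@len_chain F _ _ _ _ 1).
exists (fun i => if i is 0 then mkSub (@is_submod0 _ (locring p)^o)
                 else mkSub (@is_submodT _ (locring p)^o)).
case=> // _ /=; split=> //; last by move=> t ->; apply/asboolP.
split=> [t _|h]; first exact/asboolP.
have /asboolP /eqP : (1 : (locring p)^o) \in smod_pred [set (0 : (locring p)^o)].
  by apply: h; apply/asboolP.
by rewrite oner_eq0.
Qed.

Lemma length_locmod_fin (p : prime_idealr R) (M : lmodType R) : noeth_mod M ->
  (forall q : prime_idealr R, {subset q <= p} -> {subset p <= q}) ->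
  length F (locmod p M) \is a fin_num.
Proof.
move=> hM pmin; have [ps hps] := pfilt_exists hR hM (@is_submod0 R M).
rewrite length_locmod ge0_fin_numE //; apply: le_lt_trans (ltry (cnt p ps)%:R).
by apply: len_le_cnt => //; exact: is_submod0.
Qed.

(* In a domain the only minimal prime is 0. *)
Lemma has_rank_domain (M : lmodType R) : GRing.integral_domain_axiom R ->
  noeth_mod M -> exists r : F, has_rank M r.
Proof.
move=> dom hM.
have h0 : prime_set [set (0 : R)].
  split; first split=> //.
  - by apply/eqP; rewrite oner_eq0.
  - by move=> a u v -> ->; rewrite mulr0 addr0.
  - by move=> u v /dom /orP[/eqP ->|/eqP ->]; [left|right].
pose p0 := mkPrime h0.
have p0min (q : prime_idealr R) : {subset q <= p0} -> {subset p0 <= q}.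
  by move=> _ a /mkPrimeE ->; exact: idealr0.
have f1 := length_locmod_fin hM p0min.
have f2 := length_locmod_fin hR p0min.
exists (fine (length F (locmod p0 M)) / fine (length F (locmod p0 R^o))) => p pmin _.
have -> : p = p0.
  apply: prime_idealr_eq => a; have sub : {subset p0 <= p}.
    by move=> b /mkPrimeE ->; exact: idealr0.
  by apply/idP/idP; [exact: (pmin _ sub) | exact: sub].
rewrite length_locring -(fineK f1) -(fineK f2) -EFinM /= divfK //.
have := length_locring_ge1 p0; rewrite length_locring -(fineK f2) lee_fin => h.
by rewrite gt_eqF // (lt_le_trans ltr01 h).
Qed.

Variables (m : idealr R) (d : nat) (x : seq R).
Hypothesis dimR : krull_dim F R = d%:R%:E.
Hypothesis loc_m : forall I : idealr R, {subset I <= m}.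
Hypothesis rad_x : forall a, a \in m -> exists n, gen (x : seq R^o) (a ^+ n).
Hypothesis size_x : size x = d.

(** All primes in a filtration of R/xR contain x, hence equal m, and each factor has length at most
    1. *)
Lemma len_mulseq_fin : exists L : nat, (len F (mulseq R^o x) [set: R^o] <= L%:R%:E)%E.
Proof.
have hx := is_submod_mulseq R^o x.
have [ps hps] := pfilt_exists hR hR hx; exists (size ps).
apply: (@le_trans _ _ (len F (addS (mulseq R^o x) (mulseq R^o x)) [set: R^o])).
  by apply: len_mono => //; exact: addS_min.
apply: le_trans (len_pfilt F x hx hps) _.
have : forall p, List.In p ps -> (len F (addS (idset p) (mulseq R^o x)) [set: R^o] <= 1)%E.
  move=> p pps; apply: (@le_trans _ _ (len F (idset p) [set: R^o])).
    by apply: len_mono => // u pu; apply: addSl.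
  apply: (len_max_ideal F loc_m); apply: (prime_sup_x loc_m rad_x) => a ax.
  by apply: (pfilt_sup hx hps pps) => u; exact: mulseq_mem.
elim: (ps) => [_|p qs IH h]; first by rewrite big_nil.
rewrite big_cons /= -add1n natrD EFinD; apply: leeD; first by apply: h; left.
by apply: IH => q hq; apply: h; right.
Qed.

(** Since R has dimension d, these are the primes with dim R/p = d. *)
Let big (p : prime_idealr R) := `[< haschain d p >].

(** A big prime contributes at most the length of R/(x^n), which is at most n^d L; the others
    contribute O(n^(d-1)) by [plen_growth], whose extra factor n is kept here. *)
Lemma sum_plen (ps : seq (prime_idealr R)) (L : nat) :
  (len F (mulseq R^o x) [set: R^o] <= L%:R%:E)%E ->
  exists C : nat, forall n, (n%:R%:E * (\sum_(p <- ps) plen F x p (fun=> n)) <=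
    (n * (count big ps * (n ^ d * L)) + C * n ^ d)%:R%:E)%E.
Proof.
move=> hL; elim: ps => [|p ps [C hC]].
  by exists 0%N => n; rewrite big_nil mule0.
have [C' hC'] : exists C : nat, forall n, (n%:R%:E * plen F x p (fun=> n) <=
    (n * (big p * (n ^ d * L)) + C * n ^ d)%:R%:E)%E.
  rewrite /big; case: asboolP => hp.
    exists 0%N => n; rewrite mul0n addn0 mul1n natrM EFinM.
    apply: lee_pmul => //.
    apply: (@le_trans _ _ (len F (mulseq R^o (expseq n x)) [set: R^o])).
      rewrite /plen powseq_cst; apply: len_mono => // u xu; apply: addSr => //.
      exact: is_submod_idset.
    have := hlen_kos_exp F n x [::] R^o 0; rewrite !cats0 !hlen0 size_x => h.
    apply: le_trans h _; rewrite natrM EFinM; exact: lee_pmul.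
  have [C1 h1] := plen_growth F hR loc_m rad_x hp.
  by exists C1 => n; rewrite mul0n muln0 add0n; exact: h1.
exists (C' + C)%N => n; rewrite big_cons ge0_muleDr //; last first.
  by apply: sume_ge0 => q _; exact: plen_ge0.
apply: le_trans (leeD (hC' n) (hC n)) _.
rewrite -EFinD -natrD lee_fin ler_nat /= !mulnDl !mulnDr; lia.
Qed.

(** The lower bound of [hlen_kos_lower] is compared with the upper bound of [sum_plen]; dividing by
    n^(d+1) and letting n grow removes the term in C. *)
Lemma hlen0_le_big (M : lmodType R) ps (L : nat) :
  (len F (mulseq R^o x) [set: R^o] <= L%:R%:E)%E -> pfilt [set (0 : M)] ps ->
  (hlen F (kos x M) 0 <=
   (count big ps * L)%:R%:E + d%:R%:E * hlen F (kos x M) 1)%E.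
Proof.
move=> hL hps; have [C hC] := sum_plen ps hL.
set B := (count big ps) in hC *.
set h0 := hlen F (kos x M) 0; set t := (d%:R%:E * _)%E.
have t0 : (0 <= t)%E by rewrite mule_ge0.
have key n : (n%:R%:E * (n ^ d)%:R%:E * h0 <=
    (n * (B * (n ^ d * L)) + C * n ^ d)%:R%:E + n%:R%:E * (n ^ d)%:R%:E * t)%E.
  have := hlen_kos_lower F n x [::] M; rewrite !cats0 size_x -/h0 hlen0 => h.
  rewrite -[X in (X <= _)%E]muleA.
  apply: le_trans (lee_pmul _ _ (le_refl _) h) _ => //; first by rewrite mule_ge0 // hlen_ge0.
  rewrite ge0_muleDr //; last by rewrite mule_ge0.
  apply: leeD; last by rewrite mulnC natrM EFinM -!muleA.
  apply: le_trans (hC n); apply: lee_pmul => //.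
  apply: (@le_trans _ _ (len F (addS [set 0%R] (mulseq M (expseq n x))) [set: M])).
    apply: len_mono => //; apply: addS_min => //; first exact: is_submod_mulseq.
    by move=> _ ->; exact: submod0 (is_submod_mulseq _ _).
  rewrite /plen powseq_cst.
  exact: (len_pfilt F (expseq n x) (@is_submod0 R M) hps).
(* Once t is finite, so is h0, by [key] at n = 1, and the rest is arithmetic in F. *)
have [->|] := eqVneq t +oo%E; first by rewrite addey // leey.
rewrite -ltey => tfin.
have tf : t \is a fin_num by rewrite ge0_fin_numE.
have h0f : h0 \is a fin_num.
  rewrite ge0_fin_numE ?hlen_ge0 //.
  have := key 1%N; rewrite exp1n !mul1e => h; apply: le_lt_trans h _.
  by rewrite -(fineK tf) -EFinD ltry.
move: key; rewrite -(fineK tf) -(fineK h0f) -EFinD lee_fin.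
move: (fine t) (fine h0) => tau eta key.
rewrite leNgt; apply/negP => lt.
pose del := eta - (B * L)%:R - tau.
have del0 : 0 < del by rewrite /del; lra.
(* If the bound failed by [del], then n [del] would stay below C for every positive n. *)
have [n hn] : exists n : nat, C%:R < n%:R * del.
  exists (Num.bound (C%:R / del)); rewrite -ltr_pdivrMr //.
  by apply: archi_boundP; rewrite divr_ge0 // ltW.
have n0 : (0 < n)%N.
  by case: n hn => //; rewrite mul0r ltNge ler0n.
have := key n; rewrite -!EFinM -EFinD lee_fin => h.
have nd0 : 0 < (n ^ d)%:R :> F by rewrite ltr0n expn_gt0 n0.
have : (n ^ d)%:R * (n%:R * del) <= (n ^ d)%:R * C%:R :> F.
  rewrite /del; move: h; rewrite natrD !natrM; lra.
by rewrite ler_pM2l // leNgt hn.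
Qed.

Lemma big_count_le (psR psM : seq (prime_idealr R)) :
  (forall p, haschain d p -> List.In p psR) ->
  (count big psM <= \sum_(q <- psR) big q * cnt q psM)%N.
Proof.
move=> hin; elim: psM => [|p ps IH] //=.
have -> : (\sum_(q <- psR) big q * cnt q (p :: ps) =
    \sum_(q <- psR) big q * `[< p = q >] + \sum_(q <- psR) big q * cnt q ps)%N.
  by rewrite -big_split /=; apply: eq_bigr => q _; rewrite -mulnDr.
apply: leq_add => //; rewrite /big; case: asboolP => // hp.
move: (hin p hp); elim: (psR) => [[]|q qs IHq]; rewrite big_cons => -[->|/IHq h].
  by rewrite !asboolT.
by apply: leq_trans h _; rewrite leq_addl.
Qed.

(** Every big prime occurs in a filtration of R, its localization being nonzero, so one finite list
    serves for all M. In a filtration of M such a q occurs at most l(M_q) = r l(R_q) times, whence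
    the constant. *)
Lemma rank_bound : exists C : F, forall (M : lmodType R) (r : F), noeth_mod M ->
  has_rank M r -> 0 <= r /\
  (hlen F (kos x M) 0 <= (C * r)%:E + d%:R%:E * hlen F (kos x M) 1)%E.
Proof.
have [L hL] := len_mulseq_fin.
have [psR hpsR] := pfilt_exists hR hR (@is_submod0 R R^o).
pose ell (q : prime_idealr R) : F := fine (length F (locring q)^o).
have ellE q : haschain d q -> length F (locring q)^o = (ell q)%:E.
  move=> hq; rewrite /ell fineK // length_locring.
  by apply: length_locmod_fin => //; exact: (haschain_min dimR hq).
have ell1 q : haschain d q -> 1 <= ell q.
  by move=> hq; rewrite -lee_fin -ellE // length_locring_ge1.
have inR p : haschain d p -> List.In p psR.
  move=> hp; have pmin := haschain_min dimR hp.
  have : (0 < cnt p psR)%N.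
    rewrite -(ltr_nat F) -lte_fin; apply: (@lt_le_trans _ _ 1%E); first exact: lte01.
    apply: le_trans (length_locring_ge1 p) _; rewrite length_locring length_locmod.
    by apply: len_le_cnt => //; exact: is_submod0.
  elim: (psR) => // q qs IH /=; case: asboolP => [->|_]; first by left.
  by rewrite add0n => /IH; right.
pose sg : F := \sum_(q <- psR) (big q)%:R * ell q.
exists (L%:R * sg) => M r hM hr.
have rkE q : haschain d q -> length F (locmod q M) = (r * ell q)%:E.
  move=> hq; rewrite hr; first by rewrite ellE.
  - exact: (haschain_min dimR hq).
  - exact: (krull_dim_quot dimR hq).
split.
  (* A big prime exists, and there r l(R_p) = l(M_p) is nonnegative with l(R_p) at least 1. *)
  have [p hp] := haschain_ex dimR.
  have : (0 <= length F (locmod p M))%E by rewrite length_len len_ge0.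
  by rewrite rkE // lee_fin pmulr_lge0 // (lt_le_trans ltr01 (ell1 p hp)).
have [ps hps] := pfilt_exists hR hM (@is_submod0 R M).
apply: le_trans (hlen0_le_big hL hps) _; apply: leeD => //.
rewrite lee_fin natrM mulrC -mulrA ler_wpM2l //.
apply: (@le_trans _ _ (\sum_(q <- psR) big q * cnt q ps)%N%:R).
  by rewrite ler_nat; exact: big_count_le.
rewrite natr_sum /sg mulr_suml; apply: ler_sum => q _.
rewrite natrM /big; case: asboolP => [hq|_]; last by rewrite !mul0r.
rewrite !mul1r mulrC -lee_fin -rkE // length_locmod.
by apply: cnt_le_len => //; exact: is_submod0.
Qed.

End Rank.

Theorem theorem8p1 (F : realType) (R : comNzRingType) (m : idealr R)
    (hR : local_ring m) (d : nat) (hd : krull_dim F R = (d%:R)%:E)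
    (M : nat -> lmodType R) (hM : lim_CM F m M) :
  [/\
      (forall x : seq R, part_of_sop F m x -> forall i, (1 <= i)%N ->
        forall z, z \in cycles R^o x i ->
          mclosure m M (fun n => (nu m (M n))%:R : F) (boundaries R^o x i) z),
      (forall (x : seq R) (y : R), part_of_sop F m (rcons x y) ->
        colon (ideal_gen x) y `<=`
          mclosure m M (fun n => (nu m (M n))%:R : F) (ideal_gen x))
    &
      GRing.integral_domain_axiom R \/
        (forall n, exists r : F, has_rank (M n) r) ->
      (forall n, has_rank (M n) (rank F (M n))) /\
      (forall x : seq R, part_of_sop F m x -> forall i, (1 <= i)%N ->
        forall z, z \in cycles R^o x i ->
          mclosure m M (fun n => rank F (M n)) (boundaries R^o x i) z) /\
      (forall (x : seq R) (y : R), part_of_sop F m (rcons x y) ->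
        colon (ideal_gen x) y `<=`
          mclosure m M (fun n => rank F (M n)) (ideal_gen x)) ].
Proof.
have [/noeth_ring hN loc_m] := hR.
have [hfg [x hx hH]] := hM.
have hMn n : noeth_mod (M n) by apply: noeth_fin_gen => //; case: (hfg n).
(* Smallness for the one system of parameters in [lim_CM] is carried to all of them. *)
have nu_small w : sop F m w -> hsmall M (fun n => (nu m (M n))%:R : F) 1 w.
  move=> hw; apply: (hsmall_sop hx hw) => -[|i] // _.
  by apply: little_o_le (hH i.+1 isT) => n; exact: hlen_le_koszul.
split.
- by move=> y hy i i1 z; exact: (cycles_mclosure hN nu_small hy i1).
- by move=> y a hy; exact: (colon_mclosure hN nu_small hy).
move=> hrk.
have ex_rank n : exists r : F, has_rank (M n) r.
  by case: hrk => [dom|//]; exact: has_rank_domain.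
have rankP n : has_rank (M n) (rank F (M n)).
  (* Existence of a rank rules out the default value 0 in the definition of [rank]. *)
  by have [r hr] := ex_rank n; apply: (xgetPex 0 (P := [set r | has_rank (M n) r])); exists r.
have [dx xm hxm] := hx.
have rad_x a : a \in m -> exists n, gen (x : seq R^o) (a ^+ n).
  by move=> /hxm[n hn]; exists n; apply/span_gen.
have sx : size x = d.
  by apply/eqP; rewrite -(eqr_nat F); have := dx; rewrite hd => -[->].
have [C hC] := rank_bound hN hd loc_m rad_x sx.
have [k k0 Ck] : exists2 k : F, 0 <= k & C <= k by exists `|C|; rewrite ?ler_norm.
have rank_small w : sop F m w -> hsmall M (fun n => rank F (M n)) 1 w.
  (* For large n, nu is at most k rank + nu/2, hence at most 2k rank; adding 1 makes the constant
     positive. *)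
  move=> hw i i1; apply: (little_o_scale (c := 2 * k + 1)) (nu_small w hw i i1).
    by rewrite ltr_pwDr // mulr_ge0.
  (* With this constant, d times the length of H_1 is at most nu/2 and can be absorbed on the
     left. *)
  have e0 : 0 < (2 * d.+1%:R)^-1 :> F by rewrite invr_gt0 mulr_gt0.
  near=> n.
  have h1 : (hlen F (kos x (M n)) 1 <= ((2 * d.+1%:R)^-1 * (nu m (M n))%:R)%:E)%E.
    by near: n; exact: (nu_small x hx 1%N isT).
  have [r0 hr] := hC (M n) _ (hMn n) (rankP n).
  have := nu_le_len F (M n) xm; rewrite -hlen0 => /le_trans/(_ hr) h2.
  have : ((nu m (M n))%:R%:E <= (C * rank F (M n))%:E +
      d%:R%:E * ((2 * d.+1%:R)^-1 * (nu m (M n))%:R)%:E)%E.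
    by apply: le_trans h2 _; apply: leeD => //; apply: lee_pmul.
  rewrite -EFinM -EFinD lee_fin.
  have -> : d%:R * ((2 * d.+1%:R)^-1 * (nu m (M n))%:R) =
      (d%:R / d.+1%:R) * ((nu m (M n))%:R / 2) :> F.
    by rewrite invfM; ring.
  have dd : d%:R / d.+1%:R <= 1 :> F by rewrite ler_pdivrMr // mul1r ler_nat.
  have nu2 : 0 <= (nu m (M n))%:R / 2 :> F by rewrite divr_ge0.
  have hd2 := ler_wpM2r nu2 dd.
  have hCr : C * rank F (M n) <= k * rank F (M n) by rewrite ler_wpM2r.
  rewrite mulrDl mul1r -[2 * _ * _]mulrA; move: hd2 hCr r0.
  move: (rank _ _) (d%:R / _ * _) (C * _) (k * _) => r a b c.
  lra.
split=> //; split.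
- by move=> y hy i i1 z; exact: (cycles_mclosure hN rank_small hy i1).
- by move=> y a hy; exact: (colon_mclosure hN rank_small hy).
Unshelve. all: by end_near. Qed.
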